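(* Fix a complete, discrete, and proper Iwasawa continued fraction algorithm with fundamental domain $K$ and modular group $\mathcal M$. There is a subset $K_0\subset K$ of full measure such that for all $x,y\in K_0$: $x$ and $y$ are tail-equivalent if and only if $y=M(x)$ for some $M\in\mathcal M$.
   Context: **Spaces.** $k$ is $\mathbb R$, $\mathbb C$ or the quaternions, $n\ge1$; $\mathrm{Im}(k)\subset k$ is the set of purely imaginary elements; $\|\cdot\|$ is the standard norm. The Iwasawa inversion space $\mathbb X=\mathbb X^n_k$ is $k^n\times\mathrm{Im}(k)$ with group law $(z,t)*(z',t')=(z+z',t+t'+2\,\mathrm{Im}\langle z,z'\rangle)$, $\langle z,z'\rangle=\sum_i\overline{z_i}z'_i$. The same formula defines a group law on $k^n\times k$, with gauge $|(z,w)|=\big\|\|z\|^2+|\mathrm{Re}\,w|+\mathrm{Im}\,w\big\|^{1/2}$ and $d((z,w),(z',w'))=|(-z,-w)*(z',w')|$; restricted to $\mathbb X$, $d$ is the Cygan metric. $\mathbb H=\{(z,w)\in k^n\times k:\mathrm{Re}\,w>0\}$, $\partial\mathbb H=\mathbb X$. Let $\phi(z,w)=(1,\sqrt2 z,w+\|z\|^2)\in k^{n+2}$, $\infty$ correspond to $(0,0,1)$, and $J=\begin{bmatrix}0&0&-1\\0&\mathrm{id}_n&0\\-1&0&0\end{bmatrix}$. Via $\phi$, $G=\mathbb PU(J)$ acts on $\mathbb H$ and on $\mathbb X\cup\{\infty\}$ (Möbius transformations). $\mathrm{Isom}(\mathbb X)$ denotes the isometries of $(\mathbb X,d)$ that are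 restrictions of elements of $\mathrm{Stab}_G(\infty)$, viewed as a subgroup of $G$. Measure on $\mathbb X$ is Haar (Lebesgue) measure. An inversion is a Möbius transformation $\iota:\mathbb X\setminus\{0\}\to\mathbb X\setminus\{0\}$ exchanging $0$ and $\infty$ with $|\iota h|=1/|h|$ and $d(\iota h,\iota h')=\frac{d(h,h')}{|h||h'|}$ for all $h\in(\mathbb H\cup\mathbb X)\setminus\{0\}$, $h'\in\mathbb X\setminus\{0\}$. **Iwasawa CF algorithm.** Data: $k,n,\mathbb X$; an inversion $\iota$; a lattice $\mathcal Z\subset\mathrm{Isom}(\mathbb X)$ (discrete subgroup with finite-measure quotient); a fundamental domain $K\subset\mathbb X$ (measurable, $\mathbb X=\bigcup_{a\in\mathcal Z}aK$, and $K\cap\bigcup_{a\in\mathcal Z\setminus\{\mathrm{id}\}}aK$ has measure $0$); and a rounding mapping $[\cdot]:\mathbb X\to\mathcal Z$ with $[y]^{-1}(y)\in K$ for all $y$. The modular group is $\mathcal M=\langle\iota,\mathcal Z\rangle\subset G$. The shift map is $T:K\to K$, $T(0)=0$ if $0\in K$, $T(x)=[\iota(x)]^{-1}(\iota(x))$ otherwise. For $x\in K$: $x_0=x$, digits $a_{i+1}=[\iota(x_i)]$, $x_{i+1}=T(x_i)$, stopping if some $x_i=0$. **Properties.** *Discrete*: $\mathcal M$ is a discrete subgroup of $G$. *Proper*: $\sup\{|x|:x\in K\}<1$. *Complete*: $\mathrm{Stab}_{\mathcal M}(\infty)=\mathcal Z$. Points $x,y\in K$ with infinite digit sequences $(a_i)$,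 $(a'_i)$ are *tail-equivalent* if there are $l,l'\in\mathbb N$ with $a_{l+i}=a'_{l'+i}$ for all $i\ge1$. *)

(* Defs.v *)
From HB Require Import structures.
From mathcomp Require Import all_boot all_order all_algebra ring complex.
From mathcomp Require Import all_classical all_reals all_analysis.

Set Implicit Arguments.
Unset Strict Implicit.
Unset Printing Implicit Defensive.

Import Order.TTheory GRing.Theory Num.Theory.

Local Open Scope classical_set_scope.
Local Open Scope ring_scope.

(* Quat a b c d is the quaternion a + b i + c j + d k. *)
Record quat (R : Type) : Type :=
  Quat { qre : R; qi : R; qj : R; qk : R }.

Definition tuple_of_quat R (q : quat R) := (qre q, qi q, qj q, qk q).
Definition quat_of_tuple R (t : R * R * R * R) :=
  let: (a, b, c, d) := t in Quat a b c d.

Lemma tuple_of_quatK R : cancel (@tuple_of_quat R) (@quat_of_tuple R).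
Proof. by case. Qed.

HB.instance Definition _ (R : eqType) :=
  Equality.copy (quat R) (can_type (@tuple_of_quatK R)).
HB.instance Definition _ (R : choiceType) :=
  Choice.copy (quat R) (can_type (@tuple_of_quatK R)).

Section QuatRing.
Variable R : comNzRingType.
Implicit Types p q : quat R.

Definition quat_add p q :=
  Quat (qre p + qre q) (qi p + qi q) (qj p + qj q) (qk p + qk q).
Definition quat_opp p := Quat (- qre p) (- qi p) (- qj p) (- qk p).
Definition quat_mul p q :=
  let: Quat a b c d := p in
  let: Quat e f g h := q in
  Quat (a * e - b * f - c * g - d * h) (a * f + b * e + c * h - d * g)
       (a * g - b * h + c * e + d * f) (a * h + b * g - c * f + d * e).
Definition quat_real (a : R) := Quat a 0 0 0.
Definition quat_conj p := Quat (qre p) (- qi p) (- qj p) (- qk p).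

Lemma quat_addA : associative quat_add.
Proof.
by move=> [????] [????] [????]; rewrite /quat_add /=; congr Quat; rewrite addrA.
Qed.

Lemma quat_addC : commutative quat_add.
Proof.
by move=> [????] [????]; rewrite /quat_add /=; congr Quat; rewrite addrC.
Qed.

Lemma quat_add0 : left_id (quat_real 0) quat_add.
Proof. by move=> [????]; rewrite /quat_add /= !add0r. Qed.

Lemma quat_addN : left_inverse (quat_real 0) quat_opp quat_add.
Proof. by move=> [????]; rewrite /quat_add /= !addNr. Qed.

HB.instance Definition _ :=
  GRing.isZmodule.Build (quat R) quat_addA quat_addC quat_add0 quat_addN.

Lemma quat_mulA : associative quat_mul.
Proof. by move=> [????] [????] [????] /=; congr Quat; ring. Qed.

Lemma quat_mul1l : left_id (quat_real 1) quat_mul.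
Proof. by move=> [????] /=; congr Quat; ring. Qed.

Lemma quat_mul1r : right_id (quat_real 1) quat_mul.
Proof. by move=> [????] /=; congr Quat; ring. Qed.

Lemma quat_mulDl : left_distributive quat_mul quat_add.
Proof. by move=> [????] [????] [????] /=; congr Quat => /=; ring. Qed.

Lemma quat_mulDr : right_distributive quat_mul quat_add.
Proof. by move=> [????] [????] [????] /=; congr Quat => /=; ring. Qed.

Lemma quat_one_neq0 : quat_real 1 != quat_real 0.
Proof. by apply/eqP => -[] /eqP; rewrite oner_eq0. Qed.

HB.instance Definition _ := GRing.Zmodule_isNzRing.Build (quat R)
  quat_mulA quat_mul1l quat_mul1r quat_mulDl quat_mulDr quat_one_neq0.

End QuatRing.

Inductive scalar_kind := Kreal | Kcomplex | Kquat.

Definition imdim (kk : scalar_kind) : nat :=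
  match kk with Kreal => 0 | Kcomplex => 1 | Kquat => 3 end.

Definition scalars (R : realType) (kk : scalar_kind) : nzRingType :=
  match kk with
  | Kreal => R
  | Kcomplex => R[i]
  | Kquat => quat R
  end.

Section Iwasawa.
Variables (R : realType) (kk : scalar_kind).
Local Notation scal := (scalars R kk).

Definition kcoords : scal -> seq R :=
  match kk return scalars R kk -> seq R with
  | Kreal => fun x => [:: x]
  | Kcomplex => fun x => [:: complex.Re x; complex.Im x]
  | Kquat => fun x => [:: qre x; qi x; qj x; qk x]
  end.

Definition kconj : scal -> scal :=
  match kk return scalars R kk -> scalars R kk with
  | Kreal => id
  | Kcomplex => @conjc R
  | Kquat => @quat_conj R
  end.

Definition kreal : R -> scal :=
  match kk return R -> scalars R kk with
  | Kreal => id
  | Kcomplex => fun a => Complex a 0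
  | Kquat => @quat_real R
  end.

Definition kRe (x : scal) : R := (kcoords x)`_0.
Definition kIm (x : scal) : scal := x - kreal (kRe x).
Definition knorm (x : scal) : R := Num.sqrt (kRe (kconj x * x)).

Variable n : nat.

Definition hdot (z z' : 'cV[scal]_n) : scal :=
  \sum_i kconj (z i 0) * z' i 0.
Definition vnorm (z : 'cV[scal]_n) : R := Num.sqrt (kRe (hdot z z)).

Definition kpt : Type := ('cV[scal]_n * scal)%type.

Definition hmul (p q : kpt) : kpt :=
  (p.1 + q.1, p.2 + q.2 + kIm (hdot p.1 q.1) *+ 2).

Definition gauge (p : kpt) : R :=
  Num.sqrt (knorm (kreal (vnorm p.1 ^+ 2 + `|kRe p.2|) + kIm p.2)).

Definition cygan (p q : kpt) : R := gauge (hmul (- p.1, - p.2) q).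

(* The Iwasawa inversion space k^n x Im k; None : option iwasawa is infinity. *)
Definition iwasawa := {p : kpt | kRe p.2 == 0}.

Lemma kRe0 : kRe 0 == 0.
Proof. by rewrite /kRe /kcoords /scalars; case: kk. Qed.

Definition iw0 : iwasawa := exist _ ((0, 0) : kpt) kRe0.

Definition embed (p : option kpt) : 'cV[scal]_(1 + (n + 1)) :=
  if p is Some (z, w) then
    col_mx 1%:M (col_mx (kreal (Num.sqrt 2) *: z)
                        (w + kreal (vnorm z ^+ 2))%:M)
  else col_mx 0 (col_mx 0 1%:M).

Definition formJ : 'M[scal]_(1 + (n + 1)) :=
  block_mx 0 (row_mx 0 (- 1%:M)) (col_mx 0 (- 1%:M)) (block_mx 1%:M 0 0 0).

Definition unitaryJ (A : 'M[scal]_(1 + (n + 1))) : Prop :=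
  (map_mx kconj A)^T *m formJ *m A = formJ.

(* k^(n+2) is a right k-module, on which matrices act from the left: A sends
   the projective point of embed p to that of embed q. *)
Definition proj_acts (A : 'M[scal]_(1 + (n + 1))) (p q : option kpt) : Prop :=
  exists2 l : scal, l != 0 & A *m embed p = embed q *m l%:M.

Definition induces (A : 'M[scal]_(1 + (n + 1)))
    (f : option iwasawa -> option iwasawa) : Prop :=
  forall p, proj_acts A (omap val p) (omap val (f p)).

(* PU(J) acts faithfully on the boundary of hyperbolic space, so its elements
   are represented by the maps of the boundary which they induce; equality in
   PU(J) is then equality of maps. *)
Definition moebius : set (option iwasawa -> option iwasawa) :=
  [set f | exists2 A, unitaryJ A & induces A f].

Definition minv (f : option iwasawa -> option iwasawa) (q : option iwasawa) :=
  xget None [set p | f p = q].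

Definition subgroup (Gam : set (option iwasawa -> option iwasawa)) : Prop :=
  [/\ Gam `<=` moebius, Gam id,
      forall f g, Gam f -> Gam g -> Gam (f \o g)
    & forall f, Gam f -> Gam (minv f)].

(* The topology of PU(J) is the quotient topology of U(J), so a basis of
   neighbourhoods of the identity consists of the classes of the matrices of
   U(J) close to the identity matrix. *)
Definition discrete_group (Gam : set (option iwasawa -> option iwasawa)) :
    Prop :=
  exists2 e : R, 0 < e & forall A f, unitaryJ A ->
    (forall i j, knorm (A i j - (1%:M : 'M[scal]_(1 + (n + 1))) i j) < e) ->
    induces A f -> Gam f -> f = id.

Definition isomX : set (option iwasawa -> option iwasawa) :=
  [set f | moebius f /\ exists2 g : iwasawa -> iwasawa, f = omap g &
    forall x y, cygan (val (g x)) (val (g y)) = cygan (val x) (val y)].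

(* Real coordinates on iwasawa: those of the entries of z, and the imaginary
   ones of t. *)
Definition iw_index : finType :=
  ('I_n * 'I_(imdim kk).+1 + 'I_(imdim kk))%type.

Definition iw_coord (x : iwasawa) (i : iw_index) : R :=
  match i with
  | inl (j, l) => (kcoords ((val x).1 j 0))`_l
  | inr l => (kcoords (val x).2)`_l.+1
  end.

Definition box (a b : iw_index -> R) : set iwasawa :=
  [set x | forall i, a i <= iw_coord x i <= b i].

Definition box_volume (a b : iw_index -> R) : R := \prod_i (b i - a i).

Definition lebesgue_outer (A : set iwasawa) : \bar R :=
  ereal_inf [set v | exists a b : nat -> iw_index -> R,
    [/\ forall m i, a m i <= b m i,
        A `<=` \bigcup_m box (a m) (b m)
      & v = (\sum_(0 <= m <oo) (box_volume (a m) (b m))%:E)%E]].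

Definition leb_null (A : set iwasawa) : Prop := lebesgue_outer A = 0%E.

Definition leb_measurable (A : set iwasawa) : Prop :=
  caratheodory_measurable lebesgue_outer A.

Definition translate (f : option iwasawa -> option iwasawa)
    (A : set iwasawa) : set iwasawa :=
  [set y | exists2 x, A x & f (Some x) = Some y].

Definition fundamental_domain (Z : set (option iwasawa -> option iwasawa))
    (K : set iwasawa) : Prop :=
  [/\ leb_measurable K,
      \bigcup_(a in Z) translate a K = setT
    & leb_null (K `&` \bigcup_(a in Z `\ id) translate a K)].

(* The measure of the quotient by Z is that of a fundamental domain. *)
Definition lattice (Z : set (option iwasawa -> option iwasawa)) : Prop :=
  [/\ subgroup Z, Z `<=` isomX, discrete_group Z &
      exists2 F, fundamental_domain Z F & (lebesgue_outer F < +oo)%E].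

(* The two distance identities are required on the closure of hyperbolic space,
   where inversions act through the matrix A, which is unique up to a central
   scalar. *)
Definition inversion (f : option iwasawa -> option iwasawa) : Prop :=
  [/\ f (Some iw0) = None, f None = Some iw0 &
      exists A, [/\ unitaryJ A, induces A f &
        forall h q : kpt, 0 <= kRe h.2 -> h != (0, 0) ->
          proj_acts A (Some h) (Some q) ->
          gauge q = (gauge h)^-1 /\
          forall h' q' : iwasawa, h' != iw0 -> f (Some h') = Some q' ->
            cygan q (val q') =
              cygan h (val h') / (gauge h * gauge (val h'))]].

Record iwasawa_cf := IwasawaCF {
  cf_iota : option iwasawa -> option iwasawa;
  cf_Z : set (option iwasawa -> option iwasawa);
  cf_K : set iwasawa;
  cf_round : iwasawa -> option iwasawa -> option iwasawa;
  cf_iotaP : inversion cf_iota;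
  cf_ZP : lattice cf_Z;
  cf_KP : fundamental_domain cf_Z cf_K;
  cf_round_Z : forall y, cf_Z (cf_round y);
  cf_round_K : forall y,
    exists2 x, cf_K x & minv (cf_round y) (Some y) = Some x }.

Section CF.
Variable CF : iwasawa_cf.

(* Both default values below are junk: iota x is finite for x <> 0, and the
   elements of cf_Z fix infinity. *)
Definition cf_inv (x : iwasawa) : iwasawa := odflt iw0 (cf_iota CF (Some x)).

Definition cf_shift (x : iwasawa) : iwasawa :=
  if x == iw0 then iw0
  else let y := cf_inv x in odflt iw0 (minv (cf_round CF y) (Some y)).

(* The digit a_i, for i >= 1. *)
Definition cf_digit (x : iwasawa) (i : nat) :=
  cf_round CF (cf_inv (iter i.-1 cf_shift x)).

Definition cf_infinite (x : iwasawa) : Prop :=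
  forall i, iter i cf_shift x != iw0.

Definition tail_equivalent (x y : iwasawa) : Prop :=
  [/\ cf_infinite x, cf_infinite y & exists l l' : nat,
      forall i, (1 <= i)%N -> cf_digit x (l + i) = cf_digit y (l' + i)].

Definition modular_group : set (option iwasawa -> option iwasawa) :=
  smallest subgroup (cf_iota CF |` cf_Z CF).

Definition cf_discrete : Prop := discrete_group modular_group.

Definition cf_proper : Prop :=
  (ereal_sup [set (gauge (val x))%:E | x in cf_K CF] < 1)%E.

Definition cf_complete : Prop :=
  [set M | modular_group M /\ M None = None] = cf_Z CF.

End CF.
End Iwasawa.

(* Main.v *)
(* Elements of the modular group distort the Cygan metric, extended to infinity, by
   conformal factors.  If x and y have the same digits from some point on, the same
   contracting elements take their remainders to each other's, so these coincide and
   x, y lie in one orbit.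

   Conversely let y = M x.  If a cusp g oo of small radius is close enough to x, then the
   algorithm of x sends it to oo at some step, since otherwise the cross ratio of x,
   g oo and the ends of the geodesic of x would force the images of g oo to follow the
   remainders of x and their radii to grow without bound, against the Shimizu lemma; the
   same holds for M (g oo) and y.  The element of the modular group which takes the
   corresponding remainder of x to that of y then fixes oo, so it is in Z by
   completeness, and it is the identity when no remainder of y meets another tile of the
   tiling by K.

   Almost every x has such close cusps at every scale: near a point of K the algorithm
   produces at each level a cusp which is a hole, of size comparable to the level, in
   the set of points with no close cusp, so that this set is porous, hence null.  The
   porosity argument counts the points of a grid adapted to the dilations of X near the
   set, which avoids a density theorem. *)
Require Import Defs.
From mathcomp Require Import all_boot all_order all_algebra ring lra complex.
From mathcomp Require Import all_classical all_reals all_analysis.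

Set Implicit Arguments.
Unset Strict Implicit.
Unset Printing Implicit Defensive.

Import Order.TTheory GRing.Theory Num.Theory.

Local Open Scope classical_set_scope.
Local Open Scope ring_scope.

(** * Scalars *)

(** A Moebius map is handled through its [weight] on the boundary, read off from the scalars by
    which a matrix of U(J) moves standard lifts. The radius of the cusp g oo is the inverse of the
    weight of g at infinity, so horoballs and geodesics never occur explicitly.

    The obstacle is that the convergents of x and of M x need not correspond, so a cusp met by both
    expansions has to be forced. Its quality may double under M, which is why generic points are
    asked for quality k / 2 where [legendre] accepts k.

    In the Shimizu lemma Z may contain rotations. Pigeonhole on the rotational parts of infinitely
    many elements gives a z without finite fixed point whose rotational part is close to 1. If g oo
    had too large a radius, conjugation by a dilation would bring both z and its conjugate by g
    close to 1; their iterated commutators, trivial by discreteness, would then force z to fix a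
    finite point.

    The algorithm distorts Cygan balls in a controlled way but not coordinate boxes, so nullity is
    first carried over from boxes to balls. *)

Section Scalars.
Variables (R : realType) (kk : scalar_kind).
Local Notation scal := (scalars R kk).
Local Notation kr := (@kreal R kk).
Implicit Types (x y : scal) (a b : R).

Lemma kconjD x y : kconj (x + y) = kconj x + kconj y.
Proof.
move: x y; rewrite /kconj /scalars; case: kk => // [[a b] [c d]|[a b c d] [e f g h]].
  by congr Complex => /=; ring.
by congr Quat => /=; ring.
Qed.

Lemma kconjM x y : kconj (x * y) = kconj y * kconj x.
Proof.
move: x y; rewrite /kconj /scalars; case: kk => [x y|[a b] [c d]|[a b c d] [e f g h]].
- exact: mulrC.
- by congr Complex => /=; ring.
- by congr Quat => /=; ring.
Qed.

Lemma kconjK x : kconj (kconj x) = x.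
Proof.
move: x; rewrite /kconj /scalars; case: kk => // [[a b]|[a b c d]].
  by congr Complex => /=; ring.
by congr Quat => /=; ring.
Qed.

Lemma kconj_real a : kconj (kr a) = kr a.
Proof.
rewrite /kconj /kreal /scalars; case: kk => //.
  by congr Complex => /=; ring.
by congr Quat => /=; ring.
Qed.

Lemma krealD a b : kr (a + b) = kr a + kr b.
Proof.
rewrite /kreal /scalars; case: kk => //.
  by congr Complex => /=; ring.
by congr Quat => /=; ring.
Qed.

Lemma krealM a b : kr (a * b) = kr a * kr b.
Proof.
rewrite /kreal /scalars; case: kk => //.
  by congr Complex => /=; ring.
by congr Quat => /=; ring.
Qed.

Lemma kreal1 : kr 1 = 1.
Proof. by rewrite /kreal /scalars; case: kk. Qed.

Lemma kreal0 : kr 0 = 0.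
Proof. by rewrite /kreal /scalars; case: kk. Qed.

Lemma krealN a : kr (- a) = - kr a.
Proof. by apply/eqP; rewrite -addr_eq0 -krealD addNr kreal0. Qed.

Lemma kreal_comm a x : kr a * x = x * kr a.
Proof.
move: x; rewrite /kreal /scalars; case: kk => [x|[b c]|[b c d e]].
- exact: mulrC.
- by congr Complex => /=; ring.
- by congr Quat => /=; ring.
Qed.

Lemma kReD x y : kRe (x + y) = kRe x + kRe y.
Proof. by move: x y; rewrite /kRe /scalars; case: kk => //= -[??] [??]. Qed.

Lemma kReN x : kRe (- x) = - kRe x.
Proof. by move: x; rewrite /kRe /scalars; case: kk => //= -[??]. Qed.

Lemma kRe_real a : kRe (kr a) = a.
Proof. by rewrite /kRe /scalars; case: kk. Qed.

Lemma kRe_conj x : kRe (kconj x) = kRe x.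
Proof. by move: x; rewrite /kRe /scalars; case: kk => //= -[??]. Qed.

Lemma kRe_realM a x : kRe (kr a * x) = a * kRe x.
Proof.
move: x; rewrite /kRe /kreal /scalars; case: kk => //= -[??] *.
  by rewrite /=; ring.
by rewrite /=; ring.
Qed.

Lemma kReM x y : kRe (x * y) = kRe (y * x).
Proof.
move: x y; rewrite /kRe /scalars; case: kk => [x y|[a b] [c d]|[a b c d] [e f g h]] /=; ring.
Qed.

Lemma size_kcoords x : size (kcoords x) = (imdim kk).+1.
Proof. by move: x; rewrite /scalars; case: kk. Qed.

Lemma kcoordsD x y l : (kcoords (x + y))`_l = (kcoords x)`_l + (kcoords y)`_l.
Proof.
move: x y; rewrite /scalars; case: kk => [x y|[a b] [c d]|[a b c d] [e f g h]] /=.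
- by case: l => [|l] //=; rewrite nth_nil addr0.
- by case: l => [|[|l]] //=; rewrite nth_nil addr0.
- by case: l => [|[|[|[|l]]]] //=; rewrite nth_nil addr0.
Qed.

Lemma kcoordsN x l : (kcoords (- x))`_l = - (kcoords x)`_l.
Proof.
move: x; rewrite /scalars; case: kk => [x|[a b]|[a b c d]] /=.
- by case: l => [|l] //=; rewrite nth_nil oppr0.
- by case: l => [|[|l]] //=; rewrite nth_nil oppr0.
- by case: l => [|[|[|[|l]]]] //=; rewrite nth_nil oppr0.
Qed.

Lemma kcoords0 l : (kcoords (0 : scal))`_l = 0.
Proof. by have := kcoordsD 0 0 l; rewrite addr0 => h; lra. Qed.

Lemma kconj_mul_real x :
  exists2 a, 0 <= a & kconj x * x = kr a /\ x * kconj x = kr a.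
Proof.
move: x; rewrite /kconj /kreal /scalars; case: kk => [x|[a b]|[a b c d]] /=.
- by exists (x ^+ 2); rewrite ?sqr_ge0 // expr2.
- exists (a ^+ 2 + b ^+ 2); first by rewrite addr_ge0 ?sqr_ge0.
  by split; congr Complex => /=; ring.
- exists (a ^+ 2 + b ^+ 2 + c ^+ 2 + d ^+ 2); first by rewrite !addr_ge0 ?sqr_ge0.
  by split; congr Quat => /=; ring.
Qed.

Lemma knorm_sq x : kconj x * x = kr (knorm x ^+ 2).
Proof.
have [a a0 [e _]] := kconj_mul_real x.
by rewrite /knorm e kRe_real sqr_sqrtr.
Qed.

Lemma knorm_sqr x : x * kconj x = kr (knorm x ^+ 2).
Proof.
have [a a0 [e e']] := kconj_mul_real x.
by rewrite /knorm e e' kRe_real sqr_sqrtr.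
Qed.

Lemma knorm_ge0 x : 0 <= knorm x.
Proof. exact: sqrtr_ge0. Qed.

Lemma kreal_inj : injective (kr : R -> scal).
Proof. by move=> a b /(congr1 (@kRe R kk)); rewrite !kRe_real. Qed.

Lemma knormM x y : knorm (x * y) = knorm x * knorm y.
Proof.
have : knorm (x * y) ^+ 2 = (knorm x * knorm y) ^+ 2.
  apply: kreal_inj; rewrite -knorm_sq kconjM -mulrA (mulrA (kconj x)) knorm_sq.
  by rewrite kreal_comm mulrA knorm_sq -krealM -exprMn mulrC.
move/eqP; rewrite eqrXn2 ?mulr_ge0 ?knorm_ge0 // => /eqP.
exact.
Qed.

Lemma knorm_real a : knorm (kr a) = `|a|.
Proof. by rewrite /knorm kconj_real -krealM kRe_real -expr2 sqrtr_sqr. Qed.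

Lemma knorm1 : knorm (1 : scal) = 1.
Proof. by rewrite -kreal1 knorm_real normr1. Qed.

Lemma knorm0 : knorm (0 : scal) = 0.
Proof. by rewrite -kreal0 knorm_real normr0. Qed.

Lemma knorm_conj x : knorm (kconj x) = knorm x.
Proof. by rewrite /knorm kconjK kReM. Qed.

Lemma knormN x : knorm (- x) = knorm x.
Proof. by rewrite -mulN1r -kreal1 -krealN knormM knorm_real normrN1 mul1r. Qed.

Lemma knorm_eq0 x : (knorm x == 0) = (x == 0).
Proof.
apply/eqP/eqP => [x0|->]; last exact: knorm0.
have := knorm_sq x; rewrite x0 expr0n /= kreal0.
move: x {x0}; rewrite /kconj /kreal /scalars; case: kk => [x|[a b]|[a b c d]] /=.
- by move/eqP; rewrite mulf_eq0 orbb => /eqP.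
- move=> /(congr1 (@complex.Re R)) /= h.
  by have [-> ->] : a = 0 /\ b = 0 by split; nra.
- move=> /(congr1 (@qre R)) /= h.
  have [-> [-> [-> ->]]] : a = 0 /\ b = 0 /\ c = 0 /\ d = 0.
    by (have ? : a^+2 + b^+2+c^+2+d^+2 = 0 by lra); do 3?split; nra.
  by [].
Qed.

Lemma knorm_gt0 x : (0 < knorm x) = (x != 0).
Proof. by rewrite lt_def knorm_ge0 andbT knorm_eq0. Qed.

Lemma sqrt_le_sum (s : seq R) l : `|s`_l| <= Num.sqrt (\sum_(i <- s) i ^+ 2).
Proof.
have [ls|sl] := ltnP l (size s); last by rewrite nth_default // normr0 sqrtr_ge0.
rewrite -sqrtr_sqr ler_sqrt; last by apply: sumr_ge0 => *; exact: sqr_ge0.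
rewrite (big_nth 0) (bigD1_seq l) ?iota_uniq //=; last by rewrite mem_index_iota.
by rewrite lerDl; apply: sumr_ge0 => *; exact: sqr_ge0.
Qed.

Lemma knormE x : knorm x = Num.sqrt (\sum_(i <- kcoords x) i ^+ 2).
Proof.
rewrite /knorm; congr Num.sqrt.
by move: x; rewrite /kRe /kconj /scalars; case: kk => [x|[a b]|[a b c d]] /=;
  rewrite !(big_cons, big_nil) /=; ring.
Qed.

Lemma kcoords_le x l : `|(kcoords x)`_l| <= knorm x.
Proof. by rewrite knormE; exact: sqrt_le_sum. Qed.

Lemma kRe_le x : `|kRe x| <= knorm x.
Proof. exact: kcoords_le. Qed.

Lemma knorm_leD x y : knorm (x + y) <= knorm x + knorm y.
Proof.
rewrite -(@ler_pXn2r _ 2) ?nnegrE ?addr_ge0 ?knorm_ge0 //.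
have h (z : scal) : knorm z ^+ 2 = kRe (kconj z * z) by rewrite knorm_sq kRe_real.
rewrite h kconjD mulrDl !mulrDr !kReD -!h sqrrD.
have -> : kRe (kconj y * x) = kRe (kconj x * y) by rewrite -kRe_conj kconjM kconjK.
have := kRe_le (kconj x * y); rewrite knormM knorm_conj => /(le_trans (ler_norm _)).
rewrite !mulr2n => ?; lra.
Qed.

Lemma knorm_sum (I : Type) (r : seq I) (P : pred I) (F : I -> scal) :
  knorm (\sum_(i <- r | P i) F i) <= \sum_(i <- r | P i) knorm (F i).
Proof.
elim/big_ind2 : _ => [|x1 x2 y1 y2 h1 h2|//]; first by rewrite knorm0.
by apply: le_trans (knorm_leD _ _) _; exact: lerD.
Qed.

Lemma knorm_kcoords x : knorm x <= \sum_(l < (imdim kk).+1) `|(kcoords x)`_l|.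
Proof.
have -> : \sum_(l < (imdim kk).+1) `|(kcoords x)`_l| = \sum_(i <- kcoords x) `|i|.
  by rewrite [RHS](big_nth 0) big_mkord size_kcoords.
rewrite knormE; elim: (kcoords x) => [|a s IH]; rewrite ?big_nil ?sqrtr0 // !big_cons.
have s0 : 0 <= \sum_(j <- s) j ^+ 2 by apply: sumr_ge0 => *; exact: sqr_ge0.
have s1 : 0 <= \sum_(j <- s) `|j| by apply: sumr_ge0 => *.
rewrite -(@ler_pXn2r _ 2) ?nnegrE ?addr_ge0 ?sqrtr_ge0 // sqr_sqrtr; last first.
  by rewrite addr_ge0 ?sqr_ge0.
have {}IH : \sum_(j <- s) j ^+ 2 <= (\sum_(j <- s) `|j|) ^+ 2.
  by rewrite -[leLHS]sqr_sqrtr // ler_pXn2r ?nnegrE ?sqrtr_ge0.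
rewrite sqrrD real_normK ?num_real // -addrA lerD2l (le_trans IH) // lerDr.
by rewrite mulrn_wge0 // mulr_ge0.
Qed.

Lemma kIm_conj x : kconj (kIm x) = - kIm x.
Proof.
move: x; rewrite /kIm /kconj /kreal /kRe /scalars; case: kk => [x|[a b]|[a b c d]] /=.
- by rewrite subrr oppr0.
- by congr Complex => /=; ring.
- by congr Quat => /=; ring.
Qed.

Lemma kReIm x : x = kr (kRe x) + kIm x.
Proof. by rewrite /kIm addrC subrK. Qed.

Lemma kIm_id x : kRe x = 0 -> kIm x = x.
Proof. by move=> h; rewrite /kIm h kreal0 subr0. Qed.

Lemma kRe_kIm x : kRe (kIm x) = 0.
Proof. by rewrite /kIm kReD kReN kRe_real subrr. Qed.

Lemma kImN x : kIm (- x) = - kIm x.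
Proof. by rewrite /kIm kReN krealN opprB opprK addrC. Qed.

Lemma kImD x y : kIm (x + y) = kIm x + kIm y.
Proof. by rewrite /kIm kReD krealD opprD addrACA. Qed.

Lemma kconj_im x : kRe x = 0 -> kconj x = - x.
Proof. by move=> h; rewrite -{1}(kIm_id h) kIm_conj kIm_id. Qed.

Lemma kcoords_kIm x l : (kcoords (kIm x))`_l.+1 = (kcoords x)`_l.+1.
Proof.
move: x; rewrite /kIm /kreal /kRe /scalars; case: kk => [x|[a b]|[a b c d]] //=.
- by case: l => [|l] //=; rewrite subr0.
- by case: l => [|[|[|l]]] //=; rewrite subr0.
Qed.

(** [scalars] carries only a ring structure, so the inverse is built from the conjugate; its value
    at 0 is 0. *)
Definition kinv x := kr (knorm x ^- 2) * kconj x.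

Lemma kinvr x : x != 0 -> x * kinv x = 1.
Proof.
move=> x0; rewrite /kinv mulrA -kreal_comm -mulrA knorm_sqr -krealM mulVf ?kreal1 //.
by rewrite sqrf_eq0 knorm_eq0.
Qed.

Lemma kinvl x : x != 0 -> kinv x * x = 1.
Proof.
move=> x0; rewrite /kinv -mulrA knorm_sq -krealM mulVf ?kreal1 //.
by rewrite sqrf_eq0 knorm_eq0.
Qed.

Lemma knorm_inv x : knorm (kinv x) = (knorm x)^-1.
Proof.
have [->|x0] := eqVneq x 0.
  by rewrite /kinv knorm0 expr0n /= !invr0 kreal0 mul0r knorm0.
apply: (@mulIf _ (knorm x)); first by rewrite knorm_eq0.
by rewrite -knormM kinvl // knorm1 mulVf // knorm_eq0.
Qed.

Lemma kinv_neq0 x : x != 0 -> kinv x != 0.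
Proof. by move=> x0; rewrite -knorm_eq0 knorm_inv invr_eq0 knorm_eq0. Qed.

Lemma kcoords_real a : kcoords (kr a) = a :: nseq (imdim kk) 0.
Proof. by rewrite /kcoords /kreal /scalars; case: kk. Qed.

Lemma kcoords_surj (c : nat -> R) : exists x : scal, forall l, (l <= imdim kk)%N -> (kcoords x)`_l = c l.
Proof.
rewrite /kcoords /scalars; case: kk => /=.
- by exists (c 0%N) => -[|l].
- by exists (Complex (c 0%N) (c 1%N)) => -[|[|l]].
- by exists (Quat (c 0%N) (c 1%N) (c 2%N) (c 3%N)) => -[|[|[|[|l]]]].
Qed.

Lemma kcoords_inj x y : (forall l, (kcoords x)`_l = (kcoords y)`_l) -> x = y.
Proof.
move: x y; rewrite /kcoords /scalars; case: kk => [x y|[a b] [c d]|[a b c d] [e f g h]] /= H.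
- exact: (H 0%N).
- by congr Complex; [exact: (H 0%N)|exact: (H 1%N)].
- by congr Quat; [exact: (H 0%N)|exact: (H 1%N)|exact: (H 2%N)|exact: (H 3%N)].
Qed.

End Scalars.

(* The coordinates are additive, so they reduce additive identities of the
   noncommutative ring of scalars to identities of real numbers. *)
Ltac kadd := apply: kcoords_inj => ?; rewrite ?mulr2n ?(kcoordsD, kcoordsN, kcoords0); ring.

(** * The extended Cygan metric and its Hermitian form *)

Lemma cauchy_schwarz (R : realType) (I : finType) (a b : I -> R) :
  (\sum_i a i * b i) ^+ 2 <= (\sum_i a i ^+ 2) * (\sum_i b i ^+ 2).
Proof.
have : 0 <= \sum_i \sum_j (a i * b j - a j * b i) ^+ 2.
  by apply: sumr_ge0 => i _; apply: sumr_ge0 => j _; exact: sqr_ge0.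
have -> : \sum_i \sum_j (a i * b j - a j * b i) ^+ 2 =
    (\sum_i a i ^+ 2) * (\sum_i b i ^+ 2) *+ 2 - (\sum_i a i * b i) ^+ 2 *+ 2.
  rewrite expr2 !big_distrlr /= !mulr2n.
  rewrite [X in _ = X + _ - _]exchange_big /= -!big_split -sumrB /=.
  by apply: eq_bigr => i _; rewrite -!big_split -sumrB /=; apply: eq_bigr => j _; ring.
rewrite !mulr2n; lra.
Qed.

Section Hermitian.
Variables (R : realType) (kk : scalar_kind) (n : nat).
Local Notation scal := (scalars R kk).
Local Notation kr := (@kreal R kk).
Implicit Types (z : 'cV[scal]_n) (p q : kpt R kk n) (u v w : iwasawa R kk n).

Lemma kconj0 : kconj (0 : scal) = 0.
Proof. by rewrite -kreal0 kconj_real. Qed.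

Lemma kconj1 : kconj (1 : scal) = 1.
Proof. by rewrite -kreal1 kconj_real. Qed.

Lemma kconjN (x : scal) : kconj (- x) = - kconj x.
Proof. by apply/eqP; rewrite -addr_eq0 -kconjD addNr kconj0. Qed.

Lemma kconj_sum (I : Type) (r : seq I) (P : pred I) (F : I -> scal) :
  kconj (\sum_(i <- r | P i) F i) = \sum_(i <- r | P i) kconj (F i).
Proof. by apply: (big_morph _ (@kconjD _ _) kconj0). Qed.

Lemma kreal_sum (I : Type) (r : seq I) (P : pred I) (F : I -> R) :
  kr (\sum_(i <- r | P i) F i) = \sum_(i <- r | P i) kr (F i).
Proof. by apply: (big_morph _ (@krealD _ _) (@kreal0 _ _)). Qed.

Lemma hdotDl z z' z'' : hdot (z + z') z'' = hdot z z'' + hdot z' z''.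
Proof.
by rewrite /hdot -big_split; apply: eq_bigr => i _; rewrite /= mxE kconjD mulrDl.
Qed.

Lemma hdotDr z z' z'' : hdot z (z' + z'') = hdot z z' + hdot z z''.
Proof.
by rewrite /hdot -big_split; apply: eq_bigr => i _; rewrite /= mxE mulrDr.
Qed.

Lemma hdotNl z z' : hdot (- z) z' = - hdot z z'.
Proof. by rewrite /hdot -sumrN; apply: eq_bigr => i _; rewrite mxE kconjN mulNr. Qed.

Lemma hdotNr z z' : hdot z (- z') = - hdot z z'.
Proof. by rewrite /hdot -sumrN; apply: eq_bigr => i _; rewrite mxE mulrN. Qed.

Lemma hdot_conj z z' : kconj (hdot z z') = hdot z' z.
Proof.
by rewrite /hdot kconj_sum; apply: eq_bigr => i _; rewrite kconjM kconjK.
Qed.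

Lemma hdot_diag z : hdot z z = kr (\sum_i knorm (z i 0) ^+ 2).
Proof. by rewrite /hdot kreal_sum; apply: eq_bigr => i _; rewrite knorm_sq. Qed.

Lemma vnorm_sq z : vnorm z ^+ 2 = \sum_i knorm (z i 0) ^+ 2.
Proof.
by rewrite /vnorm hdot_diag kRe_real sqr_sqrtr // sumr_ge0 // => *; exact: sqr_ge0.
Qed.

Lemma hdot_vnorm z : hdot z z = kr (vnorm z ^+ 2).
Proof. by rewrite hdot_diag vnorm_sq. Qed.

Lemma vnorm_ge0 z : 0 <= vnorm z.
Proof. exact: sqrtr_ge0. Qed.

Lemma hdot_le z z' : knorm (hdot z z') <= vnorm z * vnorm z'.
Proof.
apply: le_trans (knorm_sum _ _ _) _.
rewrite -(@ler_pXn2r _ 2) ?nnegrE ?mulr_ge0 ?vnorm_ge0 //; last first.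
  by apply: sumr_ge0 => *; exact: knorm_ge0.
rewrite exprMn !vnorm_sq; apply: le_trans (cauchy_schwarz _ _).
by rewrite le_eqVlt; apply/orP; left; apply/eqP; congr (_ ^+ 2);
  apply: eq_bigr => i _; rewrite knormM knorm_conj.
Qed.

Lemma vnormN z : vnorm (- z) = vnorm z.
Proof. by rewrite /vnorm hdotNl hdotNr opprK. Qed.

Lemma vnorm0 : vnorm (0 : 'cV[scal]_n) = 0.
Proof.
apply/eqP; rewrite -sqrf_eq0 vnorm_sq big1 // => i _.
by rewrite mxE knorm0 expr0n.
Qed.

Lemma vnorm_eq0 z : vnorm z = 0 -> z = 0.
Proof.
move/eqP; rewrite -sqrf_eq0 vnorm_sq psumr_eq0; last by move=> *; exact: sqr_ge0.
move=> /allP h; apply/matrixP => i j; rewrite ord1 mxE; apply/eqP.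
by rewrite -knorm_eq0 -sqrf_eq0; apply: h; rewrite mem_index_enum.
Qed.

Lemma knorm_le_vnorm z i : knorm (z i 0) <= vnorm z.
Proof.
rewrite -(@ler_pXn2r _ 2) ?nnegrE ?vnorm_ge0 ?knorm_ge0 // vnorm_sq (bigD1 i) //=.
by rewrite lerDl sumr_ge0 // => *; exact: sqr_ge0.
Qed.

Lemma vnorm_le_sum z : vnorm z <= \sum_i knorm (z i 0).
Proof.
have s0 : 0 <= \sum_i knorm (z i 0) by apply: sumr_ge0 => *; exact: knorm_ge0.
rewrite -(@ler_pXn2r _ 2) ?nnegrE ?vnorm_ge0 // vnorm_sq expr2 mulr_suml.
apply: ler_sum => i _; rewrite expr2 ler_wpM2l ?knorm_ge0 // (bigD1 i) //=.
by rewrite lerDl sumr_ge0 // => *; exact: knorm_ge0.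
Qed.

Lemma knorm_real_im (a : R) (x : scal) : kRe x = 0 ->
  knorm (kr a + x) ^+ 2 = a ^+ 2 + knorm x ^+ 2.
Proof.
move=> x0; apply: (@kreal_inj _ kk); rewrite krealD -!knorm_sq kconjD kconj_real.
rewrite mulrDl !mulrDr krealM (kconj_im x0) kreal_comm !mulNr; kadd.
Qed.

Lemma iw_re u : kRe (val u).2 = 0.
Proof. by case: u => p /= /eqP. Qed.

Lemma gaugeE p : kRe p.2 = 0 -> gauge p ^+ 2 = knorm (kr (vnorm p.1 ^+ 2) + p.2).
Proof. by move=> h; rewrite /gauge sqr_sqrtr ?knorm_ge0 // h normr0 addr0 kIm_id. Qed.

Lemma gauge_ge0 p : 0 <= gauge p.
Proof. exact: sqrtr_ge0. Qed.

Lemma gauge4 p : kRe p.2 = 0 -> gauge p ^+ 4 = vnorm p.1 ^+ 4 + knorm p.2 ^+ 2.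
Proof.
move=> h; rewrite (_ : 4 = 2 * 2)%N // !(exprM _ 2 2) gaugeE // knorm_real_im //.
Qed.

Lemma vnorm_le_gauge p : kRe p.2 = 0 -> vnorm p.1 <= gauge p.
Proof.
move=> h; rewrite -(@ler_pXn2r _ 4) ?nnegrE ?vnorm_ge0 ?gauge_ge0 // gauge4 //.
by rewrite lerDl sqr_ge0.
Qed.

Lemma knorm_le_gauge p : kRe p.2 = 0 -> knorm p.2 <= gauge p ^+ 2.
Proof.
move=> h; rewrite -(@ler_pXn2r _ 2) ?nnegrE ?knorm_ge0 ?exprn_ge0 ?gauge_ge0 //.
by rewrite -exprM gauge4 // lerDr exprn_ge0 // vnorm_ge0.
Qed.

Lemma gauge_le p : kRe p.2 = 0 -> gauge p ^+ 2 <= vnorm p.1 ^+ 2 + knorm p.2.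
Proof.
move=> h; rewrite gaugeE //; apply: le_trans (knorm_leD _ _) _.
by rewrite knorm_real ger0_norm ?sqr_ge0.
Qed.

Lemma gauge_eq0 p : kRe p.2 = 0 -> gauge p = 0 -> p = (0, 0).
Proof.
case: p => z t /= h g; have := gauge4 (p := (z, t)) h; rewrite g expr0n /=.
have := vnorm_ge0 z; have := knorm_ge0 t => h1 h2 e.
have [e1 e2] : vnorm z ^+ 4 = 0 /\ knorm t ^+ 2 = 0.
  have : 0 <= vnorm z ^+ 4 by rewrite exprn_ge0.
  have : 0 <= knorm t ^+ 2 by rewrite exprn_ge0.
  by move=> *; split; lra.
congr pair; first by move/eqP: e1; rewrite expf_eq0 /= => /eqP; exact: vnorm_eq0.
by apply/eqP; rewrite -knorm_eq0 -sqrf_eq0 e2.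
Qed.

Lemma gauge0 : gauge ((0, 0) : kpt R kk n) = 0.
Proof.
apply/eqP; rewrite -sqrf_eq0 gaugeE; last by apply/eqP; exact: kRe0.
by rewrite /= vnorm0 expr0n /= kreal0 addr0 knorm0.
Qed.

Lemma hmul_re p q : kRe p.2 = 0 -> kRe q.2 = 0 -> kRe (hmul p q).2 = 0.
Proof. by move=> hp hq; rewrite /hmul /= (kReD (p.2 + q.2)) kReD hp hq !add0r mulr2n kReD kRe_kIm addr0. Qed.

(** Cygan's argument: the twist 2 Im <z,z'> completes <z,z'> + <z',z> to 2 <z,z'>, so the scalar
    whose norm is the squared gauge of the product is the sum of the two scalars of the factors and
    of 2 <z,z'>, which Cauchy-Schwarz bounds. *)
Lemma gauge_hmul p q : kRe p.2 = 0 -> kRe q.2 = 0 ->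
  gauge (hmul p q) <= gauge p + gauge q.
Proof.
move=> hp hq; rewrite -(@ler_pXn2r _ 2) ?nnegrE ?addr_ge0 ?gauge_ge0 //.
rewrite gaugeE ?hmul_re //.
have -> : kr (vnorm (hmul p q).1 ^+ 2) + (hmul p q).2 =
    (kr (vnorm p.1 ^+ 2) + p.2) + (kr (vnorm q.1 ^+ 2) + q.2) + hdot p.1 q.1 *+ 2.
  rewrite /hmul /= -!hdot_vnorm hdotDl !hdotDr -(hdot_conj p.1 q.1).
  have -> : kconj (hdot p.1 q.1) = hdot p.1 q.1 - kIm (hdot p.1 q.1) *+ 2.
    set b := hdot _ _; rewrite {1}(kReIm b) kconjD kconj_real kIm_conj /kIm; kadd.
  kadd.
apply: le_trans (knorm_leD _ _) _; rewrite mulr2n.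
have := knorm_leD (kr (vnorm p.1 ^+ 2) + p.2) (kr (vnorm q.1 ^+ 2) + q.2).
have := knorm_leD (hdot p.1 q.1) (hdot p.1 q.1); rewrite -!gaugeE //.
have := hdot_le p.1 q.1.
have : vnorm p.1 * vnorm q.1 <= gauge p * gauge q.
  by apply: ler_pM; rewrite ?vnorm_ge0 ?vnorm_le_gauge.
rewrite sqrrD mulr2n => *; lra.
Qed.

Lemma opp_re p : kRe p.2 = 0 -> kRe (- p.1, - p.2).2 = 0.
Proof. by move=> /= h; rewrite kReN h oppr0. Qed.

Definition cyg u v : R := cygan (val u) (val v).

Lemma cyg_ge0 u v : 0 <= cyg u v.
Proof. exact: gauge_ge0. Qed.

Lemma kIm_real (a : R) : kIm (kr a) = 0.
Proof. by rewrite /kIm kRe_real subrr. Qed.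

Lemma cyg_triangle u v w : cyg u w <= cyg u v + cyg v w.
Proof.
rewrite /cyg /cygan; set a := hmul _ (val v); set b := hmul _ (val w).
set c := hmul _ (val w).
have -> : b = hmul a c.
  rewrite /a /b /c /hmul /=; congr pair; first by rewrite addrA addrK.
  rewrite !(hdotDl, hdotDr, hdotNl, hdotNr, kImD, kImN) (hdot_vnorm (val v).1) kIm_real.
  kadd.
by apply: gauge_hmul; apply: hmul_re; rewrite ?opp_re ?iw_re.
Qed.

Lemma gaugeN p : kRe p.2 = 0 -> gauge (- p.1, - p.2) = gauge p.
Proof.
move=> h; have := gauge4 (p := (- p.1, - p.2)) (opp_re h).
rewrite /= vnormN knormN -gauge4 // => /eqP.
by rewrite eqrXn2 ?gauge_ge0 // => /eqP.
Qed.

Lemma cyg_sym u v : cyg u v = cyg v u.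
Proof.
rewrite /cyg /cygan -gaugeN; last by apply: hmul_re; rewrite ?opp_re ?iw_re.
congr gauge; rewrite /hmul /=; congr pair; first by rewrite opprD opprK addrC.
rewrite !hdotNl !kImN -(hdot_conj (val v).1) /kIm kRe_conj.
have -> : kconj (hdot (val v).1 (val u).1) =
    kr (kRe (hdot (val v).1 (val u).1)) *+ 2 - hdot (val v).1 (val u).1.
  set x := hdot _ _; rewrite {1}(kReIm x) kconjD kconj_real kIm_conj /kIm; kadd.
kadd.
Qed.

Lemma cyg_diag u : cyg u u = 0.
Proof.
rewrite /cyg /cygan /hmul /= hdotNl kImN hdot_vnorm kIm_real !addNr.
by rewrite oppr0 mul0rn addr0 gauge0.
Qed.

Lemma cyg_eq0 u v : cyg u v = 0 -> u = v.
Proof.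
move/gauge_eq0 => h; have /h : kRe (hmul (- (val u).1, - (val u).2) (val v)).2 = 0.
  by apply: hmul_re; rewrite ?opp_re ?iw_re.
rewrite /hmul /= hdotNl kImN => -[e1 e2].
have e : (val u).1 = (val v).1 by apply/eqP; rewrite eq_sym -subr_eq0 addrC e1.
move: e2; rewrite -e hdot_vnorm kIm_real oppr0 mul0rn addr0 => e2.
have e' : (val u).2 = (val v).2 by apply/eqP; rewrite eq_sym -subr_eq0 addrC e2.
by apply: val_inj; rewrite (surjective_pairing (val u)) e e' -surjective_pairing.
Qed.

(** The value 1 between infinity and a finite point makes the square of [bdist] the norm of the
    Hermitian form on standard lifts in all cases ([bform_embed]). It is not a metric: the triangle
    inequality holds among finite points only. *)
Definition bdist (x y : option (iwasawa R kk n)) : R :=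
  match x, y with
  | Some u, Some v => cyg u v
  | None, None => 0
  | _, _ => 1
  end.

Definition bform (a b : 'cV[scal]_(1 + (n + 1))) : scal :=
  ((map_mx (@kconj R kk) a)^T *m @formJ R kk n *m b) 0 0.

Lemma bformE (a1 : 'cV_1) (a2 : 'cV_n) (a3 : 'cV_1) (b1 : 'cV_1) (b2 : 'cV_n) (b3 : 'cV_1) :
  bform (col_mx a1 (col_mx a2 a3)) (col_mx b1 (col_mx b2 b3)) =
  hdot a2 b2 - kconj (a1 0 0) * b3 0 0 - kconj (a3 0 0) * b1 0 0.
Proof.
rewrite /bform /formJ !map_col_mx !tr_col_mx mul_row_block mul_row_col.
rewrite mul_mx_row mul_row_block mul_row_col !(mulmx0, mulmx1, mulmxN, addr0, add0r).
rewrite add_row_mx !(addr0, add0r) mul_row_col !mulNmx !mxE !big_ord1 !mxE addrC -addrA.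
rewrite addrA; congr (_ - _ - _).
by rewrite /hdot; apply: eq_bigr => i _; rewrite !mxE.
Qed.

Lemma bform_embed (x y : option (iwasawa R kk n)) :
  knorm (bform (embed (omap val x)) (embed (omap val y))) = bdist x y ^+ 2.
Proof.
have hd0 (m : nat) (a b : 'cV[scal]_n) : a = 0 \/ b = 0 -> hdot a b = 0.
  by rewrite /hdot => -[->|->]; apply: big1 => i _; rewrite mxE ?kconj0 ?mul0r ?mulr0.
case: x => [[[zu tu] /= hu]|]; case: y => [[[zv tv] /= hv]|] /=.
- rewrite /cyg /cygan /=; move/eqP in hu; move/eqP in hv.
  rewrite bformE !mxE /= !mulr1n kconj1 mul1r mulr1 kconjD kconj_real kconj_im //.
  rewrite gaugeE; last by apply: hmul_re => //=; rewrite kReN hu oppr0.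
  rewrite -knormN; congr knorm; rewrite /hmul /= -!hdot_vnorm.
  rewrite !(hdotDl, hdotDr, hdotNl, hdotNr) kImN.
  have -> : hdot (kr (Num.sqrt 2) *: zu) (kr (Num.sqrt 2) *: zv) = hdot zu zv *+ 2.
    rewrite /hdot -sumrMnl; apply: eq_bigr => i _; rewrite !mxE kconjM kconj_real.
    rewrite -mulrA (mulrA (kr _)) -krealM -expr2 sqr_sqrtr //.
    by rewrite krealD kreal1 mulrDl mul1r mulrDr mulr2n.
  have -> : hdot zv zu = kr (kRe (hdot zu zv)) *+ 2 - hdot zu zv.
    rewrite -hdot_conj {1}(kReIm (hdot zu zv)) kconjD kconj_real kIm_conj /kIm; kadd.
  rewrite /kIm; kadd.
- by rewrite bformE !mxE /= mulr1n kconj1 mul1r mulr0 subr0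
    hd0 ?sub0r ?knormN ?knorm1 ?expr1n //; right.
- by rewrite bformE !mxE /= !mulr1n kconj0 mul0r kconj1 subr0
    hd0 ?sub0r ?mul1r ?knormN ?knorm1 ?expr1n //; left.
- by rewrite bformE !mxE /= kconj0 mul0r mulr0 !subr0 hd0 ?knorm0 ?expr0n //; left.
Qed.

Lemma bformM (A : 'M[scal]_(1 + (n + 1))) a b : unitaryJ A ->
  bform (A *m a) (A *m b) = bform a b.
Proof.
move=> AJ; rewrite /bform; congr (fun_of_matrix _ 0 0).
have -> : (map_mx (@kconj R kk) (A *m a))^T =
    (map_mx (@kconj R kk) a)^T *m (map_mx (@kconj R kk) A)^T.
  apply/matrixP => i j; rewrite !mxE kconj_sum; apply: eq_bigr => l _.
  by rewrite !mxE kconjM.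
by rewrite -[in RHS]AJ !mulmxA.
Qed.

Lemma bformZ a b (l m : scal) : bform (a *m l%:M) (b *m m%:M) = kconj l * bform a b * m.
Proof.
rewrite /bform mulmxA !mxE big_ord1 !mxE mulr1n; congr (_ * _).
rewrite mulr_sumr; apply: eq_bigr => i _; rewrite mulrA; congr (_ * _).
rewrite !mxE mulr_sumr; apply: eq_bigr => j _; rewrite mulrA; congr (_ * _).
by rewrite !mxE big_ord1 !mxE mulr1n kconjM.
Qed.
End Hermitian.

(** * Conformal weights of Moebius maps *)

Section Weights.
Variables (R : realType) (kk : scalar_kind) (n : nat).
Local Notation scal := (scalars R kk).
Local Notation X := (iwasawa R kk n).
Local Notation D := (@bdist R kk n).
Implicit Types (x y : option X) (f g : option X -> option X) (s t : option X -> R).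

Lemma bdist_ge0 x y : 0 <= D x y.
Proof. by case: x; case: y => * //=; exact: cyg_ge0. Qed.

Lemma bdist_sym x y : D x y = D y x.
Proof. by case: x; case: y => * //=; exact: cyg_sym. Qed.

Lemma bdist_diag x : D x x = 0.
Proof. by case: x => * //=; exact: cyg_diag. Qed.

Lemma bdist_eq0 x y : D x y = 0 -> x = y.
Proof.
case: x => [u|]; case: y => [v|] //=; first by move/cyg_eq0 => ->.
  by move=> e; have := @oner_neq0 R; rewrite e eqxx.
by move=> e; have := @oner_neq0 R; rewrite e eqxx.
Qed.

Lemma bdist_gt0 x y : x <> y -> 0 < D x y.
Proof. by move=> h; rewrite lt_def bdist_ge0 andbT; apply/eqP => /bdist_eq0. Qed.

Lemma bdist_None x : x <> None -> D x None = 1.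
Proof. by case: x. Qed.

(* A Moebius map multiplies the Cygan distance, extended by [bdist] to
   infinity, by a product of conformal factors. *)
Definition weight f s :=
  (forall x, 0 < s x) /\ forall x y, D (f x) (f y) * (s x * s y) = D x y.

(** The factor at x is the square root of the norm of the scalar [l x] relating the image of the
    lift of x to the lift of [f x]; invariance of the form does the rest. *)
Lemma moebius_weight f : moebius f -> exists s, weight f s.
Proof.
move=> [A AJ Af].
pose l x := sval (cid2 (Af x)).
have l0 x : l x != 0 by rewrite /l; case: cid2.
have lE x : A *m embed (omap val x) = embed (omap val (f x)) *m (l x)%:M.
  by rewrite /l; case: cid2.
have ll x : 0 <= knorm (l x) by exact: knorm_ge0.
exists (fun x => Num.sqrt (knorm (l x))); split=> [x|x y].
  by rewrite sqrtr_gt0 knorm_gt0.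
apply/eqP; rewrite -(@eqrXn2 _ 2) ?mulr_ge0 ?bdist_ge0 ?sqrtr_ge0 //; apply/eqP.
rewrite !exprMn !sqr_sqrtr // -!bform_embed -[in RHS](bformM _ _ AJ) !lE bformZ !knormM knorm_conj.
by rewrite [RHS]mulrAC mulrC.
Qed.

Lemma weight_id : weight id (fun=> 1).
Proof. by split=> // x y; rewrite !mulr1. Qed.

Lemma weight_inj f s : weight f s -> injective f.
Proof.
move=> [_ fs] x y e; apply: bdist_eq0; rewrite -fs e bdist_diag mul0r //.
Qed.

Lemma weight_comp f s g t : weight f s -> weight g t ->
  weight (f \o g) (fun x => s (g x) * t x).
Proof.
move=> [s0 fs] [t0 gt]; split=> [x|x y]; first by rewrite mulr_gt0.
by rewrite -[RHS]gt -(fs (g x)) /= -[RHS]mulrA [X in _ = _ * X]mulrACA.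
Qed.

Lemma weight_inv f s g : weight f s -> cancel g f -> weight g (fun y => (s (g y))^-1).
Proof.
move=> [s0 fs] gf; split=> [x|x y]; first by rewrite invr_gt0.
rewrite -(fs (g x)) !gf -mulrA [X in _ * X]mulrACA.
by rewrite !mulfV ?mulr1 // gt_eqF.
Qed.

Definition isoD f := f None = None /\ forall x y, D (f x) (f y) = D x y.

Lemma isomX_isoD f : isomX f -> isoD f.
Proof.
move=> [_ [g -> gi]]; split=> // -[u|] [v|] //=; exact: gi.
Qed.

Lemma isoD_weight f : isoD f -> weight f (fun=> 1).
Proof. by move=> [_ fi]; split=> // x y; rewrite !mulr1. Qed.

Lemma minv_eq f p : injective f -> minv f (f p) = p.
Proof.
by move=> fi; apply: fi; rewrite /minv; case: xgetP => [q _ //|/(_ p)] /(_ erefl).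
Qed.

Section Subgroup.
Variables (Gam : set (option X -> option X)) (GG : subgroup Gam).

Lemma subgroup_weight f : Gam f -> exists s, weight f s.
Proof. by case: GG => GM _ _ _ /GM; exact: moebius_weight. Qed.

Lemma subgroup_inj f : Gam f -> injective f.
Proof. by move=> /subgroup_weight[s]; exact: weight_inj. Qed.

Lemma subgroup_minv f : Gam f -> Gam (minv f).
Proof. by case: GG => _ _ _; apply. Qed.

Lemma subgroup_comp f g : Gam f -> Gam g -> Gam (f \o g).
Proof. by case: GG => _ _ h _; apply: h. Qed.

(* [minv f] takes the value None off the range of f, so it could not be
   injective if f were not surjective. *)
Lemma minvKr f : Gam f -> cancel (minv f) f.
Proof.
move=> Gf q; rewrite {1}/minv; case: xgetP => [p _ //|h].
have fq : minv f q = None by rewrite /minv; case: xgetP => // p _ /h.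
have : minv f q = minv f (f None) by rewrite fq minv_eq //; exact: subgroup_inj.
by move/(subgroup_inj (subgroup_minv Gf)) => ->.
Qed.

Lemma minvKl f : Gam f -> cancel f (minv f).
Proof. by move=> Gf p; rewrite minv_eq //; exact: subgroup_inj. Qed.

End Subgroup.
End Weights.

(** * The modular group and the conformal factor of the inversion *)

Section Modular.
Variables (R : realType) (kk : scalar_kind) (n : nat).
Local Notation X := (iwasawa R kk n).
Local Notation D := (@bdist R kk n).
Variable CF : iwasawa_cf R kk n.

Lemma Z_subgroup : subgroup (cf_Z CF).
Proof. by case: (cf_ZP CF). Qed.

Lemma Z_isoD a : cf_Z CF a -> isoD a.
Proof. by case: (cf_ZP CF) => _ h _ _ /h; exact: isomX_isoD. Qed.

Lemma Z_id : cf_Z CF id.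
Proof. by case: Z_subgroup. Qed.

Hypothesis compl : cf_complete CF.

(* Were there no subgroup containing iota and Z, [modular_group] would be
   everything, against completeness. *)
Lemma modular_subgroup : subgroup (modular_group CF).
Proof.
have [[Gam GG sG]|noG] := pselect (exists2 G, subgroup G & cf_iota CF |` cf_Z CF `<=` G).
  split.
  - by move=> f /(_ Gam (conj GG sG)); case: GG => h _ _ _; exact: h.
  - by move=> G [] [].
  - move=> f g hf hg G HG; have := hf G HG; have := hg G HG.
    by case: HG => -[_ _ h _] _ gG fG; apply: h.
  - move=> f hf G HG; have := hf G HG.
    by case: HG => -[_ _ _ h] _ fG; apply: h.
have bad : cf_Z CF (fun=> None).
  rewrite -compl; split=> // G [GG sG]; exfalso.
  by apply: noG; exists G.
have [_ /(_ None (Some (iw0 R kk n)))] := Z_isoD bad.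
by rewrite /= => e; have := @oner_neq0 R; rewrite -e eqxx.
Qed.

Lemma modular_iota : modular_group CF (cf_iota CF).
Proof. by move=> G [_ h]; apply: h; left. Qed.

Lemma modular_Z a : cf_Z CF a -> modular_group CF a.
Proof. by move=> Za G [_ h]; apply: h; right. Qed.

Lemma modular_fix f : modular_group CF f -> f None = None -> cf_Z CF f.
Proof. by move=> Mf f0; rewrite -compl. Qed.

Local Notation o0 := (Some (iw0 R kk n)).

Lemma gauge_bdist (u : X) : gauge (val u) = D (Some u) o0.
Proof.
rewrite bdist_sym /= /cyg /cygan /hmul /=; congr gauge.
rewrite (surjective_pairing (val u)) /=; congr pair; first by rewrite oppr0 add0r.
rewrite oppr0 add0r /hdot big1 => [|i _]; last by rewrite !mxE oppr0 kconj0 mul0r.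
by rewrite kIm_id ?mul0rn ?addr0 //; apply/eqP; exact: kRe0.
Qed.

Hypothesis hn : (1 <= n)%N.

(** These horizontal points supply a third point besides 0 and infinity, and points arbitrarily far
    from 0. *)
Definition hvec (a : R) : kpt R kk n := (const_mx (kreal kk a), 0).

Lemma hvec_re a : kRe (hvec a).2 == 0.
Proof. exact: kRe0. Qed.

Definition iwh a : X := exist _ (hvec a) (hvec_re a).

Lemma gauge_iwh a : `|a| <= D (Some (iwh a)) o0.
Proof.
rewrite -gauge_bdist; apply: le_trans (vnorm_le_gauge _); last exact/eqP/hvec_re.
by apply: le_trans (knorm_le_vnorm _ (Ordinal hn)); rewrite mxE knorm_real.
Qed.

Lemma iwh1_neq0 : iwh 1 != iw0 R kk n.
Proof.
apply/eqP => e; have := gauge_iwh 1; rewrite e bdist_diag normr1.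
by rewrite leNgt ltr01.
Qed.

Definition iota_weight (x : option X) : R :=
  if x is Some u then if u == iw0 R kk n then 1 else gauge (val u) else 1.

(** For finite u other than 0, the pairs (u, 0) and (u, oo) give s(u) s(0) = s(u) s(oo) = |u|, the
    second one by |iota u| = 1 / |u|, and the pair (0, oo) gives s(0) s(oo) = 1. Hence s is 1 at 0
    and at infinity, and s(u) = |u|. *)
Lemma iota_weightP : weight (cf_iota CF) iota_weight.
Proof.
have [i0 iN [A [AJ Ai Aq]]] := cf_iotaP CF.
have Mi : moebius (cf_iota CF) by exists A.
have [s [s0 sw]] := moebius_weight Mi.
have iinj := weight_inj (conj s0 sw).
have h (u : X) : u != iw0 R kk n -> s (Some u) * s o0 = gauge (val u) /\
    s (Some u) * s None = gauge (val u).
  move=> u0; have fu : cf_iota CF (Some u) <> None.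
    by rewrite -i0 => /iinj [] /eqP; rewrite (negbTE u0).
  have := sw (Some u) o0; rewrite i0 bdist_None // mul1r gauge_bdist => ->; split=> //.
  have := sw (Some u) None; rewrite iN /=.
  case E : (cf_iota CF (Some u)) fu => [v|] // _.
  have := Ai (Some u); rewrite E => /= uv.
  have [||gv _] := Aq (val u) (val v) _ _ uv.
  - by rewrite iw_re.
  - by apply: contraNneq u0 => e; apply/eqP; apply: val_inj.
  have g0 : D (Some u) o0 != 0 by rewrite gt_eqF // bdist_gt0 // => -[] /eqP; rewrite (negbTE u0).
  rewrite -[cyg _ _]/(D (Some v) o0) -gauge_bdist gv => e.
  apply: (mulfI (x := (gauge (val u))^-1)); first by rewrite invr_eq0 gauge_bdist.
  by rewrite e gauge_bdist mulVf.
have e0N : s o0 * s None = 1 by have := sw o0 None; rewrite i0 iN /= mul1r.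
have s0N : s o0 = s None.
  have [h1 h2] := h _ iwh1_neq0; apply: (mulfI (x := s (Some (iwh 1)))); last by rewrite h1 h2.
  by rewrite gt_eqF.
have sN : s None = 1.
  by apply/eqP; rewrite -(@pexpr_eq1 _ _ 2) ?ltW // expr2 -{1}s0N e0N.
have se : s = iota_weight.
  apply/funext => -[u|] //=; case: eqP => [->|/eqP u0]; first by rewrite s0N.
  by have [_ <-] := h u u0; rewrite sN mulr1.
by rewrite -se; split.
Qed.

End Modular.

(** * Remainders of a point, and cusps close to it *)

Section RealBounds.
Variable R : realFieldType.
Implicit Types a b k r d : R.

Lemma half_gap a k r x q : a <= 4 * k -> 8 * k <= 1 - r -> x <= r -> q <= a + x ->
  q <= (1 + r) / 2.
Proof. lra. Qed.

Lemma half_sep a b k d l : a <= 4 * k -> 8 * k <= d -> d <= l -> l <= a + b -> l <= 2 * b.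
Proof. lra. Qed.

Lemma small_ratio a b k x q : 0 < k -> 8 * k < 1 -> q <= 1 -> 0 < q -> 0 < x ->
  q <= x + a -> a <= 2 * k * q ^+ 2 -> b * (x * q) = a -> b <= 4 * k.
Proof.
move=> k0 k8 q1 q0 x0 xq aq e.
have x2 : q / 2 <= x.
  have : 2 * k * q ^+ 2 <= q / 2.
    have -> : 2 * k * q ^+ 2 = (2 * k * q) * q by ring.
    have -> : q / 2 = 2^-1 * q by ring.
    apply: ler_wpM2r; first exact: ltW.
    by apply: (@le_trans _ _ (2 * k * 1)); [apply: ler_wpM2l|]; lra.
  by lra.
rewrite -(@ler_pM2r _ (x * q)) ?mulr_gt0 // e; apply: le_trans aq _.
have -> : 2 * k * q ^+ 2 = 4 * k * (q / 2 * q) by field.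
apply: ler_wpM2l; first by lra.
by apply: ler_wpM2r => //; exact: ltW.
Qed.
End RealBounds.

Lemma exp_small (R : realType) (c e : R) : 0 <= c -> c < 1 -> 0 < e -> exists m, c ^+ m < e.
Proof.
move=> c0 c1 e0.
have /cvgrPdist_lt /(_ e e0) [N _ /(_ N (leqnn _))] /= :
    (GRing.exp c : R^nat) @ \oo --> (0 : R^o).
  by apply: cvg_expr; rewrite ger0_norm.
by rewrite sub0r normrN ger0_norm ?exprn_ge0 // => h; exists N.
Qed.

Section Dynamics.
Variables (R : realType) (kk : scalar_kind) (n : nat).
Local Notation X := (iwasawa R kk n).
Local Notation D := (@bdist R kk n).
Local Notation o0 := (Some (iw0 R kk n)).
Variable CF : iwasawa_cf R kk n.
Local Notation M := (modular_group CF).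
Local Notation T := (cf_shift CF).
Implicit Types (x y : X) (u v : option X).
Hypotheses (hn : (1 <= n)%N) (compl : cf_complete CF).

Let MG : subgroup M := modular_subgroup compl.
Let iotaW := iota_weightP CF hn.

Lemma bdist_triangle x y (z : X) : D (Some x) (Some z) <= D (Some x) (Some y) + D (Some y) (Some z).
Proof. exact: cyg_triangle. Qed.

Lemma iota_weightE u : u <> None -> u <> o0 -> iota_weight u = D u o0.
Proof.
case: u => [x|] // _ x0; rewrite /iota_weight -gauge_bdist; case: eqP => // e.
by case: x0; rewrite e.
Qed.

Lemma isoD_comp_weight a f (s : option X -> R) : isoD a -> weight f s -> weight (a \o f) s.
Proof. by move=> [_ ai] [s0 fs]; split=> // u v; rewrite /= ai. Qed.

Lemma minv_isoD a : cf_Z CF a -> isoD (minv a).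
Proof. by move=> Za; apply: (Z_isoD (CF := CF)); exact: (subgroup_minv (Z_subgroup CF)). Qed.

(** The step dictated by the digit of x, as a map of the whole boundary: it is also applied to
    cusps, which thus follow the digits of x and not their own. *)
Definition cf_step x : option X -> option X := minv (cf_round CF (cf_inv CF x)) \o cf_iota CF.

Lemma cf_step_weight x : weight (cf_step x) (@iota_weight R kk n).
Proof. by apply: isoD_comp_weight iotaW; apply: minv_isoD; exact: cf_round_Z. Qed.

Lemma cf_stepP x : x != iw0 R kk n -> cf_step x (Some x) = Some (T x) /\ cf_K CF (T x).
Proof.
move=> x0; rewrite /cf_shift (negbTE x0) /cf_step /cf_inv /=.
have [i0 _ _] := cf_iotaP CF.
case E : (cf_iota CF (Some x)) => [y|] /=.
  by have [z Kz ->] := cf_round_K CF y.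
by move: E; rewrite -i0 => /(weight_inj iotaW) [] /eqP; rewrite (negbTE x0).
Qed.

Lemma cf_step_mod x : M (cf_step x).
Proof.
apply: (subgroup_comp MG); last exact: modular_iota.
by apply: modular_Z; apply: (subgroup_minv (Z_subgroup CF)); exact: cf_round_Z.
Qed.

Lemma cf_step_o0 x : cf_step x o0 = None.
Proof.
have [i0 _ _] := cf_iotaP CF; rewrite /cf_step /= i0.
by have [] := minv_isoD (cf_round_Z CF (cf_inv CF x)).
Qed.

(* [cf_move x m] is the element of the modular group by which the algorithm
   takes x to its m-th remainder, and [cf_fac x m] is its conformal factor. *)
Fixpoint cf_move x m : option X -> option X :=
  if m is m'.+1 then cf_step (iter m' T x) \o cf_move x m' else id.

Fixpoint cf_fac x m : option X -> R :=
  if m is m'.+1 then fun u => iota_weight (cf_move x m' u) * cf_fac x m' u else fun=> 1.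

Lemma cf_move_weight x m : weight (cf_move x m) (cf_fac x m).
Proof.
elim: m => [|m IH] /=; first exact: weight_id.
by apply: weight_comp IH; exact: cf_step_weight.
Qed.

Lemma cf_move_mod x m : M (cf_move x m).
Proof.
elim: m => [|m IH] /=; first by case: MG.
by apply: (subgroup_comp MG) => //; exact: cf_step_mod.
Qed.

Lemma cf_fac_gt0 x m u : 0 < cf_fac x m u.
Proof. by have [] := cf_move_weight x m. Qed.

Lemma cf_facE x m u v :
  D (cf_move x m u) (cf_move x m v) * (cf_fac x m u * cf_fac x m v) = D u v.
Proof. by have [_] := cf_move_weight x m. Qed.

Section Infinite.
Variables (x : X) (Kx : cf_K CF x) (ix : cf_infinite CF x).
Local Notation xs m := (iter m T x).

Lemma cf_move_self m : cf_move x m (Some x) = Some (xs m).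
Proof.
elim: m => [|m IH] //=; rewrite IH.
by have [-> _] := cf_stepP (ix m).
Qed.

Lemma cf_K_iter m : cf_K CF (xs m).
Proof. by case: m => [|m] //=; have [] := cf_stepP (ix m). Qed.

Lemma iota_weight_iter m : iota_weight (Some (xs m)) = D (Some (xs m)) o0.
Proof. by rewrite iota_weightE // => -[] e; have := ix m; rewrite e eqxx. Qed.

Lemma bdist_iter_gt0 m : 0 < D (Some (xs m)) o0.
Proof. by rewrite bdist_gt0 // => -[] e; have := ix m; rewrite e eqxx. Qed.

Definition cf_rho m : R := cf_fac x m (Some x).

Lemma cf_rhoS m : cf_rho m.+1 = D (Some (xs m)) o0 * cf_rho m.
Proof. by rewrite -iota_weight_iter -cf_move_self. Qed.

Lemma cf_rho_gt0 m : 0 < cf_rho m.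
Proof. exact: cf_fac_gt0. Qed.

Variables (r : R).
Hypotheses (r0 : 0 < r) (r1 : r < 1) (Kr : forall y, cf_K CF y -> D (Some y) o0 <= r).

Lemma cf_rho_le m : cf_rho m <= r ^+ m.
Proof.
elim: m => [|m IH]; first by rewrite expr0.
rewrite cf_rhoS exprS ler_pM ?bdist_ge0 //; first exact: ltW (cf_rho_gt0 m).
by apply: Kr; exact: cf_K_iter.
Qed.

(** The ends of the geodesic from infinity to x, moved by the algorithm, are the two points compared
    here; the image of infinity is the analogue of minus the ratio of consecutive denominators. *)
Definition cf_sep m : R := D (Some (xs m)) (cf_move x m None).

Lemma cf_sepE m : cf_sep m * (cf_rho m * cf_fac x m None) = 1.
Proof. by rewrite /cf_sep -cf_move_self cf_facE. Qed.

(** A step divides the separation L by |x_m| |y|, where |x_m| <= r and |y| <= r + L, so the new one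
    is at least L / (r (r + L)). This is increasing in L and fixes r^-1 - r. Starting from infinity
    the new separation is 1 / |x_m|, which is larger still. *)
Lemma cf_sep_ge m : cf_move x m None = None \/ r^-1 - r <= cf_sep m.
Proof.
elim: m => [|m IH]; first by left.
have [_ iN _] := cf_iotaP CF.
have [_ st] := cf_step_weight (xs m).
have [sx _] := cf_stepP (ix m).
have xr := Kr (cf_K_iter m); have x0 := bdist_iter_gt0 m.
rewrite /cf_sep -[iter m.+1 T x]/(T (xs m)).
rewrite -[cf_move x m.+1 None]/(cf_step (xs m) (cf_move x m None)).
have := st (Some (xs m)) (cf_move x m None); rewrite sx iota_weight_iter.
set d' := D _ _; set dx := D _ o0 in xr x0 *.
have rr : 0 < r^-1 by rewrite invr_gt0.
have rV : r * r^-1 = 1 by rewrite mulfV ?gt_eqF.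
case E : (cf_move x m None) IH => [y|] IH.
  have [->|y0] := eqVneq y (iw0 R kk n); first by left; exact: cf_step_o0.
  case: IH => // IH; rewrite iota_weightE //; last by case=> e; rewrite e eqxx in y0.
  move: IH; rewrite /cf_sep E; set L := D _ _ => IH e; right.
  have := bdist_triangle y (xs m) (iw0 R kk n).
  rewrite [D (Some y) (Some (xs m))]bdist_sym -/L -/dx; set dy := D _ o0 in e * => tr.
  have dy0 : 0 < dy by rewrite bdist_gt0 // => -[] e'; rewrite e' eqxx in y0.
  rewrite -(@ler_pM2r _ (dx * dy)) ?mulr_gt0 // e.
  have dL : (r^-1 - r) * r = 1 - r ^+ 2 by rewrite mulrBl mulrC rV expr2.
  have del0 : 0 <= r^-1 - r.
    by rewrite -(@pmulr_lge0 _ r) // dL subr_ge0 expr_le1 ?ltW.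
  apply: (@le_trans _ _ ((r^-1 - r) * (r * (r + L)))).
    apply: ler_wpM2l => //; apply: ler_pM => //; [exact: ltW|exact: ltW|].
    by apply: le_trans tr _; rewrite addrC lerD2r.
  rewrite mulrA dL -subr_ge0.
  have -> : L - (1 - r ^+ 2) * (r + L) = r ^+ 2 * L - (1 - r ^+ 2) * r by ring.
  rewrite -dL; have -> : r ^+ 2 * L - (r^-1 - r) * r * r = r ^+ 2 * (L - (r^-1 - r)) by ring.
  by rewrite mulr_ge0 ?sqr_ge0 // subr_ge0.
rewrite /= mulr1 => e; right.
have : r^-1 <= d'.
  rewrite -(@ler_pM2r _ dx) // e -rV mulrC ler_wpM2r // ltW //.
by move=> h; apply: le_trans h; rewrite gerBl ltW.
Qed.

(* The cross ratio of x, g oo, and the two endpoints of the geodesic from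
   infinity to x is invariant under the algorithm.  By the Shimizu lemma
   [shim], a small enough cross ratio confines the remainders of g oo to a
   small neighbourhood of those of x; but then g oo is pushed away from the
   parabolic point 0 forever while the conformal factor tends to 0. *)
Lemma legendre (R0 : R) (R0_gt0 : 0 < R0)
    (shim : forall g (s : option X -> R), M g -> weight g s -> g None <> None -> 1 <= R0 * s None)
    (k : R) (k_gt0 : 0 < k) (k1 : 8 * k <= r^-1 - r) (k2 : 8 * k <= 1 - r)
    g (s : option X -> R) :
  M g -> weight g s ->
  D (Some x) (g None) * (R0 * s None) ^+ 2 <= k ->
  exists m, cf_move x m (g None) = None.
Proof.
move=> Mg gs close; apply: contrapT => /forallNP nN.
have [s0 _] := gs.
pose q m := cf_move x m (g None).
pose t m := cf_fac x m (g None) * s None.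
have gsm m := weight_comp (cf_move_weight x m) gs.
have Mgm m : M (cf_move x m \o g) by apply: (subgroup_comp MG) => //; exact: cf_move_mod.
have q0 m : q m <> o0.
  by move=> e; apply: (nN m.+1); rewrite /= -/(q m) e cf_step_o0.
have dq0 m : 0 < D (q m) o0 by exact: bdist_gt0.
have wq m : iota_weight (q m) = D (q m) o0 by apply: iota_weightE; [exact: nN|exact: q0].
have tS m : t m.+1 = D (q m) o0 * t m by rewrite /t /= -/(q m) wq mulrA.
have t0 m : 0 < t m by rewrite mulr_gt0 // cf_fac_gt0.
have sh1 m : 1 <= R0 * t m by exact: shim (Mgm m) (gsm m) (nN m).
(* Shimizu is applied again after [iota]. This puts the factor |q_m|^2 into [ab], which makes up for
   the division by |x_m| |q_m| in the next step. *)
have sh2 m : 1 <= R0 * (D (q m) o0 * t m).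
  have [i0 _ _] := cf_iotaP CF.
  have := shim _ _ (subgroup_comp MG (@modular_iota _ _ _ CF) (Mgm m)) (weight_comp iotaW (gsm m)).
  rewrite /= -/(q m) wq; apply => /eqP; rewrite -i0.
  by move=> /eqP/(weight_inj iotaW) /(q0 m).
pose a m := D (Some (xs m)) (q m).
pose b m := D (cf_move x m None) (q m).
(* Multiplying [e1] by [e2] and comparing with [cf_sepE] cancels the factors at x and at infinity:
   this is the invariance of the cross ratio. *)
have cross m : a m * b m * (R0 * t m) ^+ 2 <= k * cf_sep m.
  have e1 : a m * (cf_rho m * cf_fac x m (g None)) = D (Some x) (g None).
    by rewrite /a -cf_move_self cf_facE.
  have e2 : b m * (cf_fac x m None * cf_fac x m (g None)) = 1.
    rewrite /b cf_facE bdist_sym bdist_None //; exact: (nN 0%N).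
  have e3 := cf_sepE m.
  have w0 : 0 < cf_rho m * cf_fac x m None by rewrite mulr_gt0 ?cf_rho_gt0 ?cf_fac_gt0.
  rewrite -(@ler_pM2r _ (cf_rho m * cf_fac x m None)) // -[leRHS]mulrA e3 mulr1.
  apply: le_trans close; rewrite -e1 -[leRHS]mulr1 -e2 /t le_eqVlt; apply/orP; left; apply/eqP; ring.
have sep0 m : 0 < cf_sep m.
  rewrite lt_def bdist_ge0 andbT; apply/eqP => e.
  by have /eqP := cf_sepE m; rewrite e mul0r eq_sym oner_eq0.
have ab m : a m * b m <= k * D (q m) o0 ^+ 2 * cf_sep m.
  have a0 : 0 <= a m * b m by rewrite mulr_ge0 ?bdist_ge0.
  have := cross m => cm.
  have : a m * b m <= a m * b m * (R0 * (D (q m) o0 * t m)) ^+ 2.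
    by rewrite ler_peMr // expr_ge1 // (le_trans ler01).
  move=> h; apply: le_trans h _.
  have -> : a m * b m * (R0 * (D (q m) o0 * t m)) ^+ 2 = D (q m) o0 ^+ 2 * (a m * b m * (R0 * t m) ^+ 2) by ring.
  by rewrite (mulrC k) -[leRHS]mulrA ler_wpM2l ?sqr_ge0.
have k8 : 8 * k < 1 by apply: le_lt_trans k2 _; rewrite gtrBl.
have qr m : a m <= 4 * k -> D (q m) o0 <= (1 + r) / 2.
  have := Kr (cf_K_iter m).
  rewrite /a; have := nN m; rewrite -/(q m); case: (q m) => [z|] // _ h1 h2.
  have := bdist_triangle z (xs m) (iw0 R kk n); rewrite [D (Some z) (Some (xs m))]bdist_sym.
  move=> h3; exact: half_gap h2 k2 h1 h3.
(* While a_m <= 4 k the separation is at most 2 b_m, so [ab] gives a_m <= 2 k |q_m|^2. Then |x_m| >=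
   |q_m| / 2, and dividing by |x_m| |q_m| yields 4 k again. *)
have step m : a m <= 4 * k -> a m.+1 <= 4 * k.
  move=> am; have qm := qr m am.
  have am2 : a m <= 2 * k * D (q m) o0 ^+ 2.
    have hb : cf_sep m <= 2 * b m.
      case E : (cf_move x m None) (cf_sep_ge m) => [y|].
        case=> // h; move: am; rewrite /a /b /cf_sep E in h *.
        have := nN m; rewrite -/(q m); case: (q m) => [z|] // _ am.
        have := bdist_triangle (xs m) z y; rewrite [D (Some z) _]bdist_sym.
        move=> h3; exact: half_sep am k1 h h3.
      move=> _; rewrite /cf_sep /b E bdist_None // bdist_sym bdist_None; last exact: nN.
      by rewrite mulr1 ler1n.
    have := ab m; have := sep0 m; have := bdist_ge0 (Some (xs m)) (q m); rewrite -/(a m) => a0 L0 h.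
    rewrite -(ler_pM2r L0); apply: (@le_trans _ _ (a m * (2 * b m))); first by rewrite ler_wpM2l.
    by rewrite mulrCA -[leRHS]mulrA -[leRHS]mulrA ler_pM2l // mulrA.
  have [_ st] := cf_step_weight (xs m).
  have [sx _] := cf_stepP (ix m).
  have := st (Some (xs m)) (q m); rewrite sx wq iota_weight_iter.
  rewrite -[cf_step _ (q m)]/(q m.+1) -[D (Some (T _)) _]/(a m.+1) -/(a m) => e.
  have x0 := bdist_iter_gt0 m.
  have xq : D (q m) o0 <= D (Some (xs m)) o0 + a m.
    rewrite /a; have := nN m; rewrite -/(q m); case: (q m) => [z|] // _.
    by have := bdist_triangle z (xs m) (iw0 R kk n); rewrite [D (Some z) (Some (xs m))]bdist_sym addrC.
  apply: small_ratio k_gt0 k8 _ (dq0 m) x0 xq am2 e.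
  by apply: le_trans qm _; rewrite ler_pdivrMr // mul1r; rewrite -[2]/(1 + 1) lerD2l ltW.
have a_le m : a m <= 4 * k.
  elim: m => [|m]; last exact: step.
  have b0 : b 0%N = 1 by rewrite /b bdist_sym bdist_None //; exact: (nN 0%N).
  have := cross 0%N; rewrite b0 -[cf_sep 0]/(1 : R) !mulr1.
  have a0 : 0 <= a 0%N by exact: bdist_ge0.
  move=> h; have : a 0%N <= k.
    by apply: le_trans h; rewrite ler_peMr // expr_ge1 // (le_trans ler01).
  by move=> h'; apply: le_trans h' _; rewrite ler_peMl ?ler1n // ltW.
have tle m : t m <= ((1 + r) / 2) ^+ m * t 0%N.
  elim: m => [|m IH]; first by rewrite expr0 mul1r.
  rewrite tS exprS -mulrA.
  by apply: ler_pM => //; [exact: bdist_ge0|exact: ltW|exact: qr (a_le m)].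
have [m hm] : exists m, ((1 + r) / 2) ^+ m * (R0 * t 0%N) < 1.
  have c0 : 0 < R0 * t 0%N by rewrite mulr_gt0.
  have [|||N hN] := @exp_small _ ((1 + r) / 2) (R0 * t 0%N)^-1 _ _.
  - by rewrite divr_ge0 // addr_ge0 // ltW.
  - by rewrite ltr_pdivrMr // mul1r -[2]/(1 + 1) ltrD2l.
  - by rewrite invr_gt0.
  - by exists N; rewrite -ltr_pdivlMr // div1r.
have := sh1 m; rewrite leNgt => /negP; apply.
apply: le_lt_trans hm; rewrite [leRHS]mulrCA ler_wpM2l //; exact: ltW.
Qed.

End Infinite.
End Dynamics.

(** * Matrices of Moebius maps *)

Section MatrixNorm.
Variables (R : realType) (kk : scalar_kind).
Local Notation scal := (scalars R kk).

Definition mnorm p q (A : 'M[scal]_(p, q)) : R := \sum_i \sum_j knorm (A i j).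

Lemma mnorm_ge0 p q (A : 'M[scal]_(p, q)) : 0 <= mnorm A.
Proof. by apply: sumr_ge0 => i _; apply: sumr_ge0 => j _; exact: knorm_ge0. Qed.

Lemma knorm_le_mnorm p q (A : 'M[scal]_(p, q)) i j : knorm (A i j) <= mnorm A.
Proof.
rewrite /mnorm (bigD1 i) //= (bigD1 j) //= -addrA lerDl addr_ge0 //.
  by apply: sumr_ge0 => *; exact: knorm_ge0.
by apply: sumr_ge0 => *; apply: sumr_ge0 => *; exact: knorm_ge0.
Qed.

Lemma mnorm_le p q (A : 'M[scal]_(p, q)) (c : R) :
  (forall i j, knorm (A i j) <= c) -> mnorm A <= c *+ (p * q).
Proof.
move=> h; have -> : c *+ (p * q) = \sum_(i < p) \sum_(j < q) c.
  by rewrite !sumr_const !card_ord mulnC mulrnA.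
by apply: ler_sum => i _; apply: ler_sum => j _.
Qed.

Lemma mnormD p q (A B : 'M[scal]_(p, q)) : mnorm (A + B) <= mnorm A + mnorm B.
Proof.
rewrite /mnorm -big_split; apply: ler_sum => i _; rewrite -big_split.
by apply: ler_sum => j _; rewrite mxE knorm_leD.
Qed.

Lemma mnormN p q (A : 'M[scal]_(p, q)) : mnorm (- A) = mnorm A.
Proof.
by apply: eq_bigr => i _; apply: eq_bigr => j _; rewrite mxE knormN.
Qed.

Lemma mnormM p q m (A : 'M[scal]_(p, q)) (B : 'M[scal]_(q, m)) :
  mnorm (A *m B) <= mnorm A * mnorm B.
Proof.
apply: (@le_trans _ _ (\sum_i \sum_j \sum_k knorm (A i k) * knorm (B k j))).
  apply: ler_sum => i _; apply: ler_sum => j _; rewrite mxE.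
  by apply: le_trans (knorm_sum _ _ _) _; apply: ler_sum => k _; rewrite knormM.
rewrite /mnorm mulr_suml; apply: ler_sum => i _.
rewrite exchange_big mulr_suml; apply: ler_sum => k _ /=.
rewrite -mulr_sumr ler_wpM2l ?knorm_ge0 // (bigD1 k) //= lerDl.
by apply: sumr_ge0 => *; apply: sumr_ge0 => *; exact: knorm_ge0.
Qed.

Lemma mnorm1 p : mnorm (1%:M : 'M[scal]_p) = p%:R.
Proof.
have h (i : 'I_p) : \sum_j knorm ((1%:M : 'M[scal]_p) i j) = 1.
  rewrite (bigD1 i) //= big1 ?addr0 => [|j ji]; first by rewrite mxE eqxx knorm1.
  by rewrite mxE eq_sym (negbTE ji) knorm0.
by rewrite /mnorm (eq_bigr (fun=> 1)) // sumr_const card_ord.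
Qed.

(* Zassenhaus: the commutator of two matrices close to 1 is quadratically
   close to 1. *)
Lemma mnorm_comm p (A B Ai Bi : 'M[scal]_p) : A *m Ai = 1%:M -> B *m Bi = 1%:M ->
  mnorm (A *m B *m Ai *m Bi - 1%:M) <=
  2 * mnorm (A - 1%:M) * mnorm (B - 1%:M) * (mnorm Ai * mnorm Bi).
Proof.
move=> hA hB.
have -> : A *m B *m Ai *m Bi - 1%:M =
    ((A - 1%:M) *m (B - 1%:M) - (B - 1%:M) *m (A - 1%:M)) *m (Ai *m Bi).
  have -> : (A - 1%:M) *m (B - 1%:M) - (B - 1%:M) *m (A - 1%:M) = A *m B - B *m A.
    rewrite !(mulmxBl, mulmxBr, mulmx1, mul1mx); move: (A *m B) (B *m A) => C E.
    by apply/matrixP => i j; rewrite !mxE; kadd.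
  rewrite mulmxBl !mulmxA; congr (_ - _).
  by rewrite -(mulmxA B) hA mulmx1 hB.
apply: le_trans (mnormM _ _) _; apply: ler_pM; rewrite ?mnorm_ge0 ?mnormM //.
apply: le_trans (mnormD _ _) _; rewrite mnormN.
have -> : 2 * mnorm (A - 1%:M) * mnorm (B - 1%:M) =
  mnorm (A - 1%:M) * mnorm (B - 1%:M) + mnorm (B - 1%:M) * mnorm (A - 1%:M) by ring.
by apply: lerD; exact: mnormM.
Qed.

(** The inverse is 1 minus itself times A - 1, and that last term is at most half its norm; p is the
    norm of the identity. *)
Lemma mnorm_inv p (A Ai : 'M[scal]_p) : Ai *m A = 1%:M -> mnorm (A - 1%:M) <= 1 / 2 ->
  mnorm Ai <= 2 * p%:R.
Proof.
move=> hA h.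
have e : Ai = 1%:M - Ai *m (A - 1%:M) by rewrite mulmxBr hA mulmx1 opprB addrCA subrr addr0.
have : mnorm Ai <= p%:R + mnorm Ai * mnorm (A - 1%:M).
  rewrite {1}e; apply: le_trans (mnormD _ _) _; rewrite mnorm1 mnormN lerD2l; exact: mnormM.
move: (mnorm_ge0 Ai) h; set a := mnorm Ai; set b := mnorm _ => a0 b2 h.
have : a * b <= a * (1 / 2) by rewrite ler_wpM2l.
by move: h; set c := a * b; rewrite !mulrA mulr1; clear -a0; clearbody a c => *; lra.
Qed.
End MatrixNorm.

(** * Coordinates of standard lifts, graded by the dilations *)

Section HeightGrading.
Variables (R : realType) (kk : scalar_kind) (n : nat).
Local Notation scal := (scalars R kk).
Local Notation kr := (@kreal R kk).
Local Notation X := (iwasawa R kk n).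
Local Notation D := (@bdist R kk n).
Local Notation o0 := (Some (iw0 R kk n)).
Local Notation N := (1 + (n + 1))%N.
Local Notation emb u := (embed (omap val (u : option X))).

Definition ifst : 'I_N := lshift (n + 1) ord0.
Definition imid (j : 'I_n) : 'I_N := rshift 1 (lshift 1 j).
Definition ilst : 'I_N := rshift 1 (rshift n ord0).

(** The degree of the coordinate under the dilation of ratio s, which multiplies it by s ^ [gr i].
    For this grading the matrices fixing infinity are block lower triangular. *)
Definition gr (i : 'I_N) : nat := if i == ifst then 0 else if i == ilst then 2 else 1.

Lemma gr_fst : gr ifst = 0%N. Proof. by rewrite /gr eqxx. Qed.
Lemma gr_lst : gr ilst = 2%N. Proof. by rewrite /gr eqxx. Qed.
Lemma gr_mid j : gr (imid j) = 1%N.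
Proof.
rewrite /gr; case: eqP => [/(congr1 val) /=|_]; first by rewrite add1n.
case: eqP => [/(congr1 val) /= /(@addnI 1) e|//].
by have := ltn_ord j; rewrite e addn0 ltnn.
Qed.

Lemma idx_ind (P : 'I_N -> Prop) : P ifst -> (forall j, P (imid j)) -> P ilst -> forall i, P i.
Proof.
move=> h0 h1 h2 i; case: (split_ordP i) => j ->; first by rewrite (ord1 j).
by case: (split_ordP j) => k ->; [exact: h1|rewrite (ord1 k)].
Qed.

Lemma big_idx (V : nmodType) (F : 'I_N -> V) :
  \sum_i F i = F ifst + (\sum_j F (imid j) + F ilst).
Proof. by rewrite big_split_ord big_ord1 big_split_ord big_ord1. Qed.

Lemma bform_idx (a b : 'cV[scal]_N) : bform a b =
  \sum_j kconj (a (imid j) 0) * b (imid j) 0 - kconj (a ifst 0) * b ilst 0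
  - kconj (a ilst 0) * b ifst 0.
Proof.
have := bformE (usubmx a) (usubmx (dsubmx a)) (dsubmx (dsubmx a))
               (usubmx b) (usubmx (dsubmx b)) (dsubmx (dsubmx b)).
rewrite !vsubmxK => ->; rewrite !mxE /hdot; congr (_ - _ - _).
by apply: eq_bigr => j _; rewrite !mxE.
Qed.

Lemma embed_fst p : embed (Some p : option (kpt R kk n)) ifst 0 = 1.
Proof. by case: p => z w; rewrite /= col_mxEu mxE. Qed.

Lemma embed_mid p j : embed (Some p : option (kpt R kk n)) (imid j) 0 = kr (Num.sqrt 2) * p.1 j 0.
Proof. by case: p => z w; rewrite /= col_mxEd col_mxEu mxE. Qed.

Lemma embed_lst p : embed (Some p : option (kpt R kk n)) ilst 0 = p.2 + kr (vnorm p.1 ^+ 2).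
Proof. by case: p => z w; rewrite /= !col_mxEd mxE. Qed.

Lemma embed_None i : embed (None : option (kpt R kk n)) i 0 = (i == ilst)%:R.
Proof.
move: i; apply: idx_ind => [|j|].
- by rewrite /embed col_mxEu mxE (_ : _ == _ = false) //; apply/eqP => /(congr1 gr); rewrite gr_fst gr_lst.
- by rewrite /embed col_mxEd col_mxEu mxE (_ : _ == _ = false) //; apply/eqP => /(congr1 gr); rewrite gr_mid gr_lst.
- by rewrite /= !col_mxEd mxE eqxx.
Qed.

Lemma mul_embed_None (A : 'M[scal]_N) i : (A *m embed None) i 0 = A i ilst.
Proof.
rewrite mxE (bigD1 ilst) //= embed_None eqxx mulr1 big1 ?addr0 // => j jl.
by rewrite embed_None (negbTE jl) mulr0.
Qed.

Lemma mul_embed_Some (A : 'M[scal]_N) p i : (A *m embed (Some p)) i 0 =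
  A i ifst + (\sum_j A i (imid j) * (kr (Num.sqrt 2) * p.1 j 0)
              + A i ilst * (p.2 + kr (vnorm p.1 ^+ 2))).
Proof.
rewrite mxE big_idx embed_fst mulr1 embed_lst; congr (_ + (_ + _)).
by apply: eq_bigr => j _; rewrite embed_mid.
Qed.

Definition hbasis (j : 'I_n) : X := exist _ ((delta_mx j 0, 0) : kpt R kk n) (kRe0 R kk).

Lemma vnorm_delta (j : 'I_n) : vnorm (delta_mx j 0 : 'cV[scal]_n) = 1.
Proof.
apply/eqP; rewrite -(@pexpr_eq1 _ _ 2) ?vnorm_ge0 // vnorm_sq (bigD1 j) //=.
rewrite mxE !eqxx knorm1 expr1n big1 ?addr0 // => i ij.
by rewrite mxE (negbTE ij) knorm0 expr0n.
Qed.

Lemma mul_emb_o0 (A : 'M[scal]_N) i : (A *m emb o0) i 0 = A i ifst.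
Proof.
rewrite mul_embed_Some /= vnorm0 expr0n kreal0 addr0 mulr0 addr0 big1 ?addr0 // => j _.
by rewrite mxE !mulr0.
Qed.

Lemma mul_emb_hbasis (A : 'M[scal]_N) i j : (A *m emb (Some (hbasis j))) i 0 =
  A i ifst + (A i (imid j) * kr (Num.sqrt 2) + A i ilst).
Proof.
rewrite mul_embed_Some /= vnorm_delta expr1n kreal1 add0r mulr1; congr (_ + (_ + _)).
rewrite (bigD1 j) //= mxE !eqxx mulr1 big1 ?addr0 // => k kj.
by rewrite mxE (negbTE kj) !mulr0.
Qed.

(* The images of infinity, 0 and the horizontal unit vectors determine a
   matrix. *)
Lemma emb_spans (A B : 'M[scal]_N) :
  (forall u : option X, A *m emb u = B *m emb u) -> A = B.
Proof.
move=> h.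
have hl i : A i ilst = B i ilst.
  by have /matrixP /(_ i 0) := h None; rewrite !mul_embed_None.
have hf i : A i ifst = B i ifst.
  by have /matrixP /(_ i 0) := h o0; rewrite !mul_emb_o0.
apply/matrixP => i; apply: idx_ind => [|j|]; [exact: hf| |exact: hl].
have /matrixP /(_ i 0) := h (Some (hbasis j)); rewrite !mul_emb_hbasis hf hl.
move/addrI/addIr => e.
have s2 : kr (Num.sqrt 2) * kr (Num.sqrt 2)^-1 = 1.
  by rewrite -krealM mulfV ?kreal1 // gt_eqF // sqrtr_gt0.
by rewrite -[LHS]mulr1 -[RHS]mulr1 -s2 !mulrA e.
Qed.

(** Quantitative form of [emb_spans]: a middle column, times the square root of 2, is the image of a
    lift minus the first and last columns, hence the factor 3. *)
Lemma mnorm_emb (A : 'M[scal]_N) (c : R) :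
  mnorm (A *m emb None) <= c -> mnorm (A *m emb o0) <= c ->
  (forall j, mnorm (A *m emb (Some (hbasis j))) <= c) ->
  mnorm A <= (3 * c) *+ (N * N).
Proof.
move=> h1 h2 h3; apply: mnorm_le => i.
have c0 : 0 <= c := le_trans (mnorm_ge0 _) h1.
have b1 : knorm (A i ilst) <= c.
  by rewrite -mul_embed_None; apply: le_trans h1; exact: knorm_le_mnorm.
have b2 : knorm (A i ifst) <= c.
  by rewrite -mul_emb_o0; apply: le_trans h2; exact: knorm_le_mnorm.
have c3 : c <= 3 * c by rewrite ler_peMl // ler1n.
apply: idx_ind => [|j|]; [exact: le_trans c3| |exact: le_trans c3].
have := le_trans (knorm_le_mnorm _ i 0) (h3 j); rewrite mul_emb_hbasis.
set x := A i (imid j) => h.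
have : knorm (x * kr (Num.sqrt 2)) <= 3 * c.
  have -> : x * kr (Num.sqrt 2) = (A i ifst + (x * kr (Num.sqrt 2) + A i ilst)) - A i ifst - A i ilst.
    by kadd.
  apply: le_trans (knorm_leD _ _) _; rewrite knormN.
  have -> : 3 * c = c + c + c by ring.
  apply: lerD => //; apply: le_trans (knorm_leD _ _) _; rewrite knormN.
  by apply: lerD.
apply: le_trans; rewrite knormM knorm_real ler_peMr ?knorm_ge0 // ger0_norm ?sqrtr_ge0 //.
by rewrite -[leLHS]sqrtr1 ler_sqrt // ler1n.
Qed.
End HeightGrading.

(** * Representing matrices and their inverses *)

Section Inverse.
Variables (R : realType) (kk : scalar_kind) (n : nat).
Local Notation scal := (scalars R kk).
Local Notation kr := (@kreal R kk).
Local Notation X := (iwasawa R kk n).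
Local Notation D := (@bdist R kk n).
Local Notation o0 := (Some (iw0 R kk n)).
Local Notation N := (1 + (n + 1))%N.
Local Notation emb u := (embed (omap val (u : option X))).
Local Notation J := (@formJ R kk n).
Implicit Types (A B : 'M[scal]_N) (f g : option X -> option X).

Definition ctr p q (A : 'M[scal]_(p, q)) : 'M[scal]_(q, p) := (map_mx (@kconj R kk) A)^T.

Lemma ctrM p q m (A : 'M[scal]_(p, q)) (B : 'M[scal]_(q, m)) : ctr (A *m B) = ctr B *m ctr A.
Proof.
apply/matrixP => i j; rewrite !mxE kconj_sum; apply: eq_bigr => l _.
by rewrite !mxE kconjM.
Qed.

Lemma ctrK p q (A : 'M[scal]_(p, q)) : ctr (ctr A) = A.
Proof. by apply/matrixP => i j; rewrite !mxE kconjK. Qed.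

Lemma mnorm_ctr p q (A : 'M[scal]_(p, q)) : mnorm (ctr A) = mnorm A.
Proof.
rewrite /mnorm exchange_big; apply: eq_bigr => i _; apply: eq_bigr => j _.
by rewrite !mxE knorm_conj.
Qed.

Lemma map_conj0 p q : map_mx (@kconj R kk) (0 : 'M[scal]_(p, q)) = 0.
Proof. by apply/matrixP => i j; rewrite !mxE kconj0. Qed.

Lemma map_conj1 p : map_mx (@kconj R kk) (1%:M : 'M[scal]_p) = 1%:M.
Proof. by apply/matrixP => i j; rewrite !mxE; case: (i == j); rewrite ?kconj1 ?kconj0. Qed.

Lemma map_conjN p q (A : 'M[scal]_(p, q)) : map_mx (@kconj R kk) (- A) = - map_mx (@kconj R kk) A.
Proof. by apply/matrixP => i j; rewrite !mxE kconjN. Qed.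

Lemma tr_1 p : (1%:M : 'M[scal]_p)^T = 1%:M.
Proof. by apply/matrixP => i j; rewrite !mxE eq_sym. Qed.

Lemma ctrJ : ctr J = J.
Proof.
rewrite /ctr /formJ !(map_block_mx, map_row_mx, map_col_mx, map_conjN, map_conj0, map_conj1).
have trN p q (A : 'M[scal]_(p, q)) : (- A)^T = - A^T by apply/matrixP => i j; rewrite !mxE.
by rewrite !(tr_block_mx, tr_row_mx, tr_col_mx, trmx0, trN, tr_1).
Qed.

Lemma JJ : J *m J = 1%:M.
Proof.
rewrite /formJ mulmx_block mul_row_col mul_row_block mul_block_col mul_col_row mulmx_block.
rewrite !(mulmx0, mul0mx, mulmx1, mul1mx, mulNmx, mulmxN, oppr0, opprK, addr0, add0r).
rewrite add_block_mx !(addr0, add0r) -scalar_mx_block.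
by rewrite row_mx0 col_mx0 -scalar_mx_block.
Qed.

(** The adjoint of A for the form J, whose square is 1; it inverts elements of U(J) over
    noncommutative scalars and has norm controlled by that of A. *)
Definition invJ A := J *m ctr A *m J.

Lemma invJ_mul A : unitaryJ A -> invJ A *m A = 1%:M.
Proof. by rewrite /unitaryJ -/(ctr A) => AJ; rewrite /invJ -!mulmxA (mulmxA (ctr A)) AJ JJ. Qed.

Lemma mnorm_invJ A : mnorm (invJ A) <= mnorm J * mnorm A * mnorm J.
Proof.
apply: le_trans (mnormM _ _) _; rewrite ler_wpM2r ?mnorm_ge0 //.
by apply: le_trans (mnormM _ _) _; rewrite mnorm_ctr.
Qed.

Definition rep A f := unitaryJ A /\ induces A f.

Lemma rep_mul A B f g : rep A f -> rep B g -> rep (A *m B) (f \o g).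
Proof.
move=> [AJ Af] [BJ Bg]; split.
  rewrite /unitaryJ -/(ctr (A *m B)) ctrM.
  have -> : ctr B *m ctr A *m J *m (A *m B) = ctr B *m (ctr A *m J *m A) *m B by rewrite !mulmxA.
  by rewrite AJ.
move=> u; have [l l0 lE] := Bg u; have [m m0 mE] := Af (g u).
exists (m * l).
  by rewrite -knorm_eq0 knormM mulf_neq0 // knorm_eq0.
rewrite -mulmxA lE mulmxA mE -mulmxA; congr (_ *m _).
by rewrite -scalar_mxM.
Qed.

Section Rep.
Variables (Gam : set (option X -> option X)) (GG : subgroup Gam).

Lemma rep_ex f : Gam f -> exists A, rep A f.
Proof. by case: GG => h _ _ _ /h [A AJ Af]; exists A. Qed.

Lemma rep_invl A f p q (l : scal) : unitaryJ A -> l != 0 ->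
  A *m emb p = emb q *m l%:M -> invJ A *m emb q = emb p *m (kinv l)%:M.
Proof.
move=> AJ l0 e; have : emb p = invJ A *m emb q *m l%:M.
  by rewrite -mulmxA -e mulmxA invJ_mul // mul1mx.
move=> ->; rewrite -mulmxA -scalar_mxM kinvr //.
by rewrite mulmx1.
Qed.

(* Only the left inverse is formal over a noncommutative ring; the right one
   holds because f is onto and the vectors [embed p] span. *)
Lemma rep_mulV A f : Gam f -> rep A f -> A *m invJ A = 1%:M.
Proof.
move=> Gf [AJ Af]; apply: emb_spans => q; rewrite mul1mx.
have [l l0 lE] := Af (minv f q); rewrite (minvKr GG Gf) in lE.
rewrite -mulmxA (rep_invl f AJ l0 lE) mulmxA lE -mulmxA -scalar_mxM kinvr //.
by rewrite mulmx1.
Qed.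

Lemma rep_inv A f : Gam f -> rep A f -> rep (invJ A) (minv f).
Proof.
move=> Gf rA; have AV := rep_mulV Gf rA; case: rA => AJ Af; split.
  rewrite /unitaryJ -/(ctr _) /invJ !ctrM ctrJ ctrK.
  rewrite -!mulmxA (mulmxA J J) JJ mul1mx (mulmxA J (ctr A)).
  by rewrite -/(invJ A) AV mulmx1.
move=> q; have [l l0 lE] := Af (minv f q); rewrite (minvKr GG Gf) in lE.
exists (kinv l); first exact: kinv_neq0.
exact: (rep_invl f AJ l0 lE).
Qed.
End Rep.

Lemma rep_scalar2 A f u v (l m : scal) : unitaryJ A ->
  A *m emb u = emb (f u) *m l%:M -> A *m emb v = emb (f v) *m m%:M ->
  knorm l * knorm m * D (f u) (f v) ^+ 2 = D u v ^+ 2.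
Proof.
move=> AJ eu ev; rewrite -!bform_embed -[in RHS](bformM _ _ AJ) eu ev bformZ !knormM knorm_conj.
by rewrite mulrAC.
Qed.

Hypothesis hn : (1 <= n)%N.

Lemma two_others (u : option X) : exists v w, [/\ u <> v, u <> w & v <> w].
Proof.
have h1 : o0 <> Some (@iwh R kk n 1).
  by move=> /Some_inj e; have := @iwh1_neq0 R kk n hn; rewrite -e eqxx.
have [->|u1] := pselect (u = None); first by exists o0, (Some (@iwh R kk n 1)).
have [->|u2] := pselect (u = o0); first by exists None, (Some (@iwh R kk n 1)).
by exists None, o0.
Qed.

(** A weight is known only through products over pairs of distinct points; with three points the
    three products determine each factor. So the given s agrees with the one read off from A. *)
Lemma rep_scalar A f s u (l : scal) : rep A f -> weight f s ->
  A *m emb u = emb (f u) *m l%:M -> knorm l = s u ^+ 2.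
Proof.
move=> [AJ Af] fs eu; have [v [w [uv uw vw]]] := two_others u.
have [l2 _ ev] := Af v; have [l3 _ ew] := Af w.
have [s0 sE] := fs.
have h x y a b : x <> y -> A *m emb x = emb (f x) *m a%:M -> A *m emb y = emb (f y) *m b%:M ->
    knorm a * knorm b = s x ^+ 2 * s y ^+ 2.
  move=> xy ex ey; have := rep_scalar2 AJ ex ey; rewrite -[D x y]sE exprMn mulrC exprMn.
  apply: mulfI; rewrite expf_eq0 /=; rewrite gt_eqF //.
  by apply: bdist_gt0 => /(weight_inj fs).
have h1 := h _ _ _ _ uv eu ev; have h2 := h _ _ _ _ uw eu ew; have h3 := h _ _ _ _ vw ev ew.
have p2 x : 0 < s x ^+ 2 by rewrite exprn_gt0.
have : knorm l ^+ 2 = (s u ^+ 2) ^+ 2.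
  apply: (@mulIf _ (knorm l2 * knorm l3)); first by rewrite h3 mulf_neq0 // gt_eqF.
  have -> : knorm l ^+ 2 * (knorm l2 * knorm l3) = (knorm l * knorm l2) * (knorm l * knorm l3) by ring.
  by rewrite h1 h2 h3; ring.
by move/eqP; rewrite eqrXn2 ?knorm_ge0 ?ltW // => /eqP.
Qed.

Lemma fst_lst : (ifst n == ilst n) = false.
Proof. by apply/eqP => /(congr1 (@gr n)); rewrite gr_fst gr_lst. Qed.
Lemma mid_lst j : (imid j == ilst n) = false.
Proof. by apply/eqP => /(congr1 (@gr n)); rewrite gr_mid gr_lst. Qed.
Lemma mid_fst j : (imid j == ifst n) = false.
Proof. by apply/eqP => /(congr1 (@gr n)); rewrite gr_mid gr_fst. Qed.
Lemma mid_mid (i j : 'I_n) : (imid i == imid j) = (i == j).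
Proof. by apply/eqP/eqP => [/rshift_inj/lshift_inj|->]. Qed.

Definition idxE := (fst_lst, mid_lst, mid_fst, mid_mid,
  eq_sym (ilst n) (ifst n), fun j => eq_sym (ilst n) (imid j), fun j => eq_sym (ifst n) (imid j)).

Lemma unitary_cols A k l : unitaryJ A ->
  \sum_j kconj (A (imid j) k) * A (imid j) l - kconj (A (ifst n) k) * A (ilst n) l
    - kconj (A (ilst n) k) * A (ifst n) l =
  \sum_j kconj ((1%:M : 'M[scal]_N) (imid j) k) * (1%:M : 'M[scal]_N) (imid j) l
    - kconj ((1%:M : 'M[scal]_N) (ifst n) k) * (1%:M : 'M[scal]_N) (ilst n) l
    - kconj ((1%:M : 'M[scal]_N) (ilst n) k) * (1%:M : 'M[scal]_N) (ifst n) l.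
Proof.
move=> AJ; have := bformM (col k 1%:M) (col l 1%:M) AJ.
have colA m : A *m col m 1%:M = col m A by rewrite !colE mul1mx.
rewrite !colA !bform_idx.
have colS B m (F : 'I_n -> scal) : \sum_j kconj (col m B (imid j) 0) * F j = \sum_j kconj (B (imid j) m) * F j.
  by apply: eq_bigr => j _; rewrite mxE.
rewrite !colS; rewrite ![col _ _ _ _]mxE.
under eq_bigr do rewrite [col _ _ _ _]mxE.
move=> ->; congr (_ - _ - _).
by apply: eq_bigr => j _; rewrite [col _ _ _ _]mxE.
Qed.

End Inverse.

(** One constant dominating the bounds met for the various blocks in [iso_fix_close], where v is
    n. *)
Lemma fix_close_bounds (R : realFieldType) (v h : R) : 0 <= v -> 0 <= h ->
  let H := (v + 1) * (4 + 8 * v ^+ 2) in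
  [/\ 0 <= H * h, h <= H * h, (2 * (v + 1)) * h <= H * h, v * ((2 * (v + 1)) * h) <= H * h
    & v * (v * ((2 * (v + 1)) * h) * 2) + 2 * h <= H * h].
Proof.
move=> v0 h0 H.
have v2 : 0 <= v ^+ 2 := sqr_ge0 v.
have v3 : 0 <= v ^+ 3 by rewrite exprn_ge0.
have e : H = 4 + 4 * v + 8 * v ^+ 2 + 8 * v ^+ 3 by rewrite /H; ring.
have le c : c <= H -> c * h <= H * h by move=> ch; exact: ler_wpM2r.
have v1 : 0 <= 1 + v - 2 * v + v ^+ 2 + 8 * v ^+ 2 by have := sqr_ge0 (v - 1); rewrite sqrrB1 -mulr_natl; lra.
split.
- by rewrite mulr_ge0 // e; lra.
- by rewrite -{1}[h]mul1r; apply: le; rewrite e; lra.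
- by apply: le; rewrite e; lra.
- rewrite mulrA; apply: le; rewrite e; have -> : v * (2 * (v + 1)) = 2 * v ^+ 2 + 2 * v by ring.
  lra.
- have -> : v * (v * (2 * (v + 1) * h) * 2) + 2 * h = (4 * v ^+ 3 + 4 * v ^+ 2 + 2) * h by ring.
  by apply: le; rewrite e; lra.
Qed.

(** * Matrices of isometries fixing infinity *)

Section Triangular.
Variables (R : realType) (kk : scalar_kind) (n : nat).
Local Notation scal := (scalars R kk).
Local Notation kr := (@kreal R kk).
Local Notation X := (iwasawa R kk n).
Local Notation D := (@bdist R kk n).
Local Notation o0 := (Some (iw0 R kk n)).
Local Notation N := (1 + (n + 1))%N.
Local Notation emb u := (embed (omap val (u : option X))).
Implicit Types (A B : 'M[scal]_N).

Definition upper0 A := forall i j, (gr i < gr j)%N -> A i j = 0.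
(** Only the diagonal blocks are bounded: for an isometry they carry the rotational part, while the
    translation part below them may be large. *)
Definition diag_le A (c : R) := forall i j, gr i = gr j -> knorm (A i j) <= c.

Lemma upper0_mul A B : upper0 A -> upper0 B -> upper0 (A *m B).
Proof.
move=> uA uB i j ij; rewrite mxE big1 // => k _.
have [ik|ki] := ltnP (gr i) (gr k); first by rewrite uA ?mul0r.
by rewrite uB ?mulr0 //; exact: leq_ltn_trans ki ij.
Qed.

Lemma diag_le_mul A B a b : upper0 A -> upper0 B -> 0 <= a -> 0 <= b ->
  diag_le A a -> diag_le B b -> diag_le (A *m B) (N%:R * (a * b)).
Proof.
move=> uA uB a0 b0 dA dB i j ij; rewrite mxE; apply: le_trans (knorm_sum _ _ _) _.
have -> : N%:R * (a * b) = \sum_(k < N) a * b by rewrite sumr_const card_ord mulr_natl.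
apply: ler_sum => k _; rewrite knormM.
have [ik|ki|ik] := ltngtP (gr i) (gr k).
- by rewrite uA // knorm0 mul0r mulr_ge0.
- by rewrite uB -?ij // knorm0 mulr0 mulr_ge0.
- by apply: ler_pM; rewrite ?knorm_ge0 ?dA ?dB // -ik.
Qed.

Lemma upper0D A B : upper0 A -> upper0 B -> upper0 (A - B).
Proof. by move=> uA uB i j ij; rewrite !mxE uA // uB // subr0. Qed.

Lemma upper0_1 : upper0 1%:M.
Proof. by move=> i j ij; rewrite mxE; case: eqP ij => // ->; rewrite ltnn. Qed.

Hypothesis hn : (1 <= n)%N.

Section Iso.
Variables (a : option X -> option X) (A : 'M[scal]_N).
Hypotheses (ai : isoD a) (rA : rep A a).

Lemma iso_scalar u (l : scal) : A *m emb u = emb (a u) *m l%:M -> knorm l = 1.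
Proof. by move=> e; rewrite (rep_scalar hn rA (isoD_weight ai) e) expr1n. Qed.

(** Fixing infinity makes the last column a multiple of the last basis vector, by a scalar of norm
    1; its orthogonality to the middle columns then clears the first row. *)
Lemma iso_upper0 : upper0 A /\ knorm (A (ilst n) (ilst n)) = 1.
Proof.
have [AJ Aa] := rA; have [aN _] := ai; have [l l0 e] := Aa None.
have l1 := iso_scalar e; rewrite aN in e.
have Al i : A i (ilst n) = (i == ilst n)%:R * l.
  by rewrite -mul_embed_None e mxE big_ord1 embed_None mxE eqxx mulr1n.
have nl : knorm (A (ilst n) (ilst n)) = 1 by rewrite Al eqxx mul1r.
have fm j : A (ifst n) (imid j) = 0.
  have := unitary_cols (ilst n) (imid j) AJ.
  rewrite big1 => [|i _]; last by rewrite Al idxE mul0r kconj0 mul0r.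
  rewrite [A (ifst n) (ilst n)]Al !idxE mul0r kconj0 mul0r subr0 sub0r.
  rewrite big1 => [|i _]; last by rewrite !mxE idxE kconj0 mul0r.
  rewrite !mxE !idxE kconj0 mul0r mulr0 !subr0 => /eqP; rewrite oppr_eq0 -knorm_eq0 knormM knorm_conj nl mul1r.
  by rewrite knorm_eq0 => /eqP.
split=> // i j; move: i j; apply: idx_ind => [|i|] ; apply: idx_ind => [|j|];
  rewrite ?gr_fst ?gr_mid ?gr_lst // => _; rewrite ?Al ?idxE ?mul0r //.
Qed.

(** Pairing the first and last columns makes the product of the corner norms 1, and each middle
    column has norm 1 for the form, hence entries of norm at most 1 in the middle block. *)
Lemma iso_diag : diag_le A 1 /\ knorm (A (ifst n) (ifst n)) = 1.
Proof.
have [u0 nl] := iso_upper0; have [AJ _] := rA.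
have ml j : A (imid j) (ilst n) = 0 by apply: u0; rewrite gr_mid gr_lst.
have fl : A (ifst n) (ilst n) = 0 by apply: u0; rewrite gr_fst gr_lst.
have fm j : A (ifst n) (imid j) = 0 by apply: u0; rewrite gr_fst gr_mid.
have nf : knorm (A (ifst n) (ifst n)) = 1.
  have := unitary_cols (ilst n) (ifst n) AJ.
  rewrite big1 => [|i _]; last by rewrite ml kconj0 mul0r.
  rewrite fl kconj0 mul0r subr0 sub0r.
  rewrite big1 => [|i _]; last by rewrite !mxE idxE kconj0 mul0r.
  rewrite !mxE !eqxx !idxE kconj0 mul0r subr0 sub0r kconj1 mulr1.
  by move/(congr1 (@knorm R kk)); rewrite !knormN knormM knorm_conj nl mul1r knorm1.
split=> // i j; move: i j; apply: idx_ind => [|i|] ; apply: idx_ind => [|j|];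
  rewrite ?gr_fst ?gr_mid ?gr_lst // => _; rewrite ?nf ?nl //.
have := unitary_cols (imid j) (imid j) AJ.
rewrite fm kconj0 mul0r mulr0 !subr0.
have -> : \sum_i kconj ((1%:M : 'M[scal]_N) (imid i) (imid j)) *
    (1%:M : 'M[scal]_N) (imid i) (imid j) = 1 :> scal.
  rewrite (bigD1 j) //= big1 => [|k kj]; first by rewrite mxE eqxx kconj1 mul1r addr0.
  by rewrite !mxE idxE (negbTE kj) kconj0 mul0r.
rewrite !mxE !idxE kconj0 !mul0r !subr0.
under eq_bigr do rewrite knorm_sq.
rewrite -kreal_sum -(kreal1 R kk) => /kreal_inj s1.
rewrite -(@ler_pXn2r _ 2) ?nnegrE ?knorm_ge0 // expr1n -s1 (bigD1 i) //= lerDl.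
by apply: sumr_ge0 => *; exact: sqr_ge0.
Qed.

Lemma iso_last_row k : knorm (A (ilst n) (imid k)) <= \sum_j knorm (A (imid j) (ifst n)).
Proof.
have [u0 nl] := iso_upper0; have [d1 nf] := iso_diag; have [AJ _] := rA.
have fm j : A (ifst n) (imid j) = 0 by apply: u0; rewrite gr_fst gr_mid.
have := unitary_cols (ifst n) (imid k) AJ.
rewrite fm mulr0 subr0.
rewrite [X in _ = X - _ - _]big1 => [|i _]; last by rewrite !mxE idxE kconj0 mul0r.
rewrite !mxE !eqxx !idxE kconj0 mul0r mulr0 !subr0 => /eqP; rewrite subr_eq0 => /eqP e.
have -> : knorm (A (ilst n) (imid k)) = knorm (kconj (A (ifst n) (ifst n)) * A (ilst n) (imid k)).
  by rewrite knormM knorm_conj nf mul1r.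
rewrite -e; apply: le_trans (knorm_sum _ _ _) _; apply: ler_sum => j _.
by rewrite knormM knorm_conj ler_piMr ?knorm_ge0 // d1 // !gr_mid.
Qed.

(** The rows of the fixed point equation express the translation part through the rotational part:
    the middle rows bound the first column, [iso_last_row] bounds the last row, and the last
    equation bounds the remaining corner. *)
Lemma iso_fix_close (x : X) (h : R) : 0 <= h -> a (Some x) = Some x -> D (Some x) o0 <= 1 ->
  diag_le (A - 1%:M) h ->
  forall i j, knorm ((A - 1%:M) i j) <= (n.+1%:R * (4 + 8 * n%:R ^+ 2)) * h.
Proof.
move=> h0 ax x1 dA.
have [u0 nl] := iso_upper0; have [d1 nf] := iso_diag; have [AJ Aa] := rA.
have ml j : A (imid j) (ilst n) = 0 by apply: u0; rewrite gr_mid gr_lst.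
have fl : A (ifst n) (ilst n) = 0 by apply: u0; rewrite gr_fst gr_lst.
have fm j : A (ifst n) (imid j) = 0 by apply: u0; rewrite gr_fst gr_mid.
have [l _ e] := Aa (Some x); rewrite ax in e.
have row i := congr1 (fun B : 'cV_N => B i 0) e.
have rx := iw_re x.
have g1 : gauge (val x) <= 1 by rewrite gauge_bdist.
have xk k : knorm ((val x).1 k 0) <= 1.
  by apply: le_trans g1; apply: le_trans (vnorm_le_gauge rx); exact: knorm_le_vnorm.
have s2 : knorm (kr (Num.sqrt 2)) <= 2.
  by rewrite knorm_real ger0_norm ?sqrtr_ge0 // -[leRHS](@sqr_sqrtr _ 2) // expr2 ler_peMr ?sqrtr_ge0 // -[leLHS]sqrtr1 ler_sqrt // ler1n.
have sx k : knorm (kr (Num.sqrt 2) * (val x).1 k 0) <= 2.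
  by rewrite knormM -[leRHS]mulr1; apply: ler_pM; rewrite ?knorm_ge0.
have tau1 : knorm ((val x).2 + kr (vnorm (val x).1 ^+ 2)) <= 1.
  by rewrite addrC -gaugeE // expr_le1 // gauge_ge0.
have el : l = A (ifst n) (ifst n).
  have := row (ifst n); rewrite mul_embed_Some fl mul0r addr0 big1 ?addr0 => [|j _]; last by rewrite fm mul0r.
  by rewrite mxE big_ord1 embed_fst mxE eqxx mulr1n mul1r => ->.
have dl : knorm (l - 1) <= h by have := dA (ifst n) (ifst n) erefl; rewrite !mxE eqxx -el.
have hb j : knorm (A (imid j) (ifst n)) <= (2 * n.+1%:R) * h.
  have := row (imid j); rewrite mul_embed_Some ml mul0r addr0 mxE big_ord1 embed_mid mxE eqxx mulr1n.
  set y := fun k => kr (Num.sqrt 2) * (val x).1 k 0 in sx *.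
  rewrite -/(y j) => e1.
  have -> : A (imid j) (ifst n) = y j * (l - 1) - \sum_k (A - 1%:M) (imid j) (imid k) * y k.
    have -> : \sum_k (A - 1%:M) (imid j) (imid k) * y k = \sum_k A (imid j) (imid k) * y k - y j.
      rewrite (bigD1 j) //= [in RHS](bigD1 j) //= !mxE eqxx mulrBl mul1r addrAC; congr (_ + _ - _).
      by apply: eq_bigr => k kj; rewrite !mxE idxE eq_sym (negbTE kj) subr0.
    by rewrite mulrBr mulr1 -e1; kadd.
  apply: le_trans (knorm_leD _ _) _; rewrite knormN.
  have -> : 2 * n.+1%:R * h = 2 * h + \sum_(k < n) h * 2.
    by rewrite sumr_const card_ord -mulr_natl -[n.+1%:R]natr1; ring.
  apply: lerD; first by rewrite knormM; apply: ler_pM; rewrite ?knorm_ge0 ?sx ?dl.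
  apply: le_trans (knorm_sum _ _ _) _; apply: ler_sum => k _; rewrite knormM.
  apply: ler_pM; rewrite ?knorm_ge0 ?sx //.
  by apply: dA; rewrite !gr_mid.
have hd k : knorm (A (ilst n) (imid k)) <= n%:R * ((2 * n.+1%:R) * h).
  apply: le_trans (iso_last_row k) _.
  have -> : n%:R * ((2 * n.+1%:R) * h) = \sum_(j < n) (2 * n.+1%:R) * h.
    by rewrite sumr_const card_ord [LHS]mulr_natl.
  by apply: ler_sum => j _.
have hc : knorm (A (ilst n) (ifst n)) <= n%:R * (n%:R * ((2 * n.+1%:R) * h) * 2) + 2 * h.
  have := row (ilst n); rewrite mul_embed_Some mxE big_ord1 embed_lst mxE eqxx mulr1n.
  set tau := _ + kr _ in tau1 *; set y := fun k => kr (Num.sqrt 2) * (val x).1 k 0 in sx *.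
  set m := A (ilst n) (ilst n) => e1.
  have dm : knorm (m - 1) <= h by have := dA (ilst n) (ilst n) erefl; rewrite !mxE eqxx.
  have -> : A (ilst n) (ifst n) = - (\sum_j A (ilst n) (imid j) * y j) + (tau * (l - 1) - (m - 1) * tau).
    rewrite mulrBr mulrBl mulr1 mul1r -e1; kadd.
  apply: le_trans (knorm_leD _ _) _; rewrite knormN; apply: lerD.
    apply: le_trans (knorm_sum _ _ _) _.
    rewrite [leRHS]mulr_natl -[X in _ *+ X]card_ord -sumr_const; apply: ler_sum => j _.
    by rewrite knormM; apply: ler_pM; rewrite ?knorm_ge0 ?sx ?hd.
  apply: le_trans (knorm_leD _ _) _; rewrite knormN !knormM.
  have -> : 2 * h = 1 * h + h * 1 by ring.
  by apply: lerD; apply: ler_pM; rewrite ?knorm_ge0 ?tau1 ?dl ?dm.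
have := @fix_close_bounds _ n%:R h (ler0n _ _) h0; rewrite natr1 => -[b0 b1 b2 b3 b4].
apply: idx_ind => [|i|]; apply: idx_ind => [|j|].
- by apply: le_trans (dA _ _ erefl) b1.
- by rewrite !mxE fm idxE subr0 knorm0.
- by rewrite !mxE fl idxE subr0 knorm0.
- by rewrite !mxE idxE subr0; apply: le_trans (hb i) b2.
- by apply: le_trans b1; apply: dA; rewrite !gr_mid.
- by rewrite !mxE ml idxE subr0 knorm0.
- by rewrite !mxE !idxE subr0; apply: le_trans hc b4.
- by rewrite !mxE !idxE subr0; apply: le_trans (hd j) b3.
- by apply: le_trans (dA _ _ erefl) b1.
Qed.
End Iso.
End Triangular.

Lemma imdim_le3 (kk : scalar_kind) : (imdim kk <= 3)%N.
Proof. by case: kk. Qed.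

Lemma knorm_coords_bound (R : realType) (kk : scalar_kind) (x : scalars R kk) (s : R) :
  (forall l, (l < 4)%N -> `|(kcoords x)`_l| <= s) -> knorm x <= 4 * s.
Proof.
move=> h; have s0 : 0 <= s by exact: le_trans (h 0%N isT).
apply: le_trans (knorm_kcoords _) _.
apply: (@le_trans _ _ (\sum_(l < (imdim kk).+1) s)).
  by apply: ler_sum => l _; apply: h; apply: leq_trans (ltn_ord l) _; exact: imdim_le3.
by rewrite sumr_const card_ord -[leLHS]mulr_natl ler_wpM2r // ler_nat; exact: imdim_le3.
Qed.

(** * Elements of the lattice close to translations *)

Section AlmostTranslations.
Variables (R : realType) (kk : scalar_kind) (n : nat).
Local Notation scal := (scalars R kk).
Local Notation kr := (@kreal R kk).
Local Notation X := (iwasawa R kk n).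
Local Notation D := (@bdist R kk n).
Local Notation o0 := (Some (iw0 R kk n)).
Local Notation N := (1 + (n + 1))%N.
Local Notation emb u := (embed (omap val (u : option X))).
Implicit Types (A B : 'M[scal]_N).
Variable CF : iwasawa_cf R kk n.
Local Notation Z := (cf_Z CF).
Hypothesis hn : (1 <= n)%N.
Variable r : R.
Hypotheses (r1 : r <= 1) (Kr : forall y, cf_K CF y -> D (Some y) o0 <= r).

Let ZG : subgroup Z := Z_subgroup CF.

Lemma Z_discrete : exists2 e : R, 0 < e & forall A f, rep A f ->
  (forall i j, knorm ((A - 1%:M) i j) < e) -> Z f -> f = id.
Proof.
have [_ _ [e e0 h] _] := cf_ZP CF; exists e => // A f [AJ Af] Ae Zf.
by apply: (h A f) => // i j; have := Ae i j; rewrite !mxE.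
Qed.

Lemma Z_cover (x : X) : exists a y, [/\ Z a, cf_K CF y & a (Some y) = Some x].
Proof.
have [_ cov _] := cf_KP CF.
have : (\bigcup_(a in Z) translate a (cf_K CF)) x by rewrite cov.
by move=> [a Za [y Ky e]]; exists a, y.
Qed.

Lemma Z_minvK a : Z a -> cancel a (minv a) /\ cancel (minv a) a.
Proof. by move=> Za; split; [exact: (minvKl ZG Za)|exact: (minvKr ZG Za)]. Qed.

Lemma rep_conj_sub1 a A B : Z a -> rep A a -> invJ A *m B *m A - 1%:M = invJ A *m (B - 1%:M) *m A.
Proof. by move=> _ [AJ _]; rewrite mulmxBr mulmx1 mulmxBl invJ_mul. Qed.

(** Conjugation by Z moves the fixed point into K, within distance 1 of 0, and enlarges the
    rotational deviation by a bounded factor only. Then [iso_fix_close] puts the conjugate close to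
    1, and Z is discrete. *)
Lemma near_id_fix : exists2 h : R, 0 < h & forall z A q, Z z -> rep A z ->
  diag_le (A - 1%:M) h -> z (Some q) = Some q -> z = id.
Proof.
have [e e0 disc] := Z_discrete.
pose H : R := n.+1%:R * (4 + 8 * n%:R ^+ 2).
have H0 : 0 < H by rewrite mulr_gt0 ?ltr0n // ltr_wpDr // mulr_ge0 // sqr_ge0.
(* The loss in [diag_le_mul] for the two products of the conjugation, each with a diagonal bounded
   by 1. *)
pose m : R := N%:R * (N%:R * (1 * 1) * 1).
have N0 : 0 < N%:R :> R by rewrite ltr0n.
have m0 : 0 < m by rewrite /m !mulr1 mulr_gt0.
pose h := e / (2 * H * m).
have h0 : 0 < h by rewrite divr_gt0 // !mulr_gt0.
exists h => // z A q Zz rA dA zq.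
have [a [y [Za Ky ay]]] := Z_cover q.
have [aK Ka] := Z_minvK Za.
have [Aa ra] := rep_ex ZG Za.
have Zw : Z (minv a \o z \o a) by do 2!apply: (subgroup_comp ZG) => //; exact: (subgroup_minv ZG).
have ri := rep_inv ZG Za ra.
have rB := rep_mul (rep_mul ri rA) ra.
have [uA _] := iso_upper0 hn (Z_isoD Zz) rA.
have [ua _] := iso_upper0 hn (Z_isoD Za) ra.
have Zi : Z (minv a) by exact: (subgroup_minv ZG).
have [ui _] := iso_upper0 hn (Z_isoD Zi) ri.
have [da _] := iso_diag hn (Z_isoD Za) ra.
have [di _] := iso_diag hn (Z_isoD Zi) ri.
have u1 := upper0D uA (@upper0_1 R kk n).
have d1 := diag_le_mul ui u1 ler01 (ltW h0) di dA.
have d2 := diag_le_mul (upper0_mul ui u1) ua _ ler01 d1 da.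
have /d2 {}d2 : 0 <= N%:R * (1 * h) by rewrite mul1r mulr_ge0 ?(ltW N0) ?(ltW h0).
rewrite -(rep_conj_sub1 _ Za ra) in d2.
have wid : minv a \o z \o a = id.
  apply: (disc _ _ rB) => // i j.
  have y1 : D (Some y) o0 <= 1 by apply: le_trans r1; exact: Kr.
  have wy : (minv a \o z \o a) (Some y) = Some y by rewrite /= ay zq -ay aK.
  have d0 : 0 <= N%:R * (N%:R * (1 * h) * 1) by rewrite mulr1 mul1r; apply: mulr_ge0 (ltW N0) (mulr_ge0 (ltW N0) (ltW h0)).
  apply: le_lt_trans (iso_fix_close hn (Z_isoD Zw) rB d0 wy y1 d2 i j) _.
  rewrite -/H; have -> : H * (N%:R * (N%:R * (1 * h) * 1)) = e / 2.
    have -> : N%:R * (N%:R * (1 * h) * 1) = m * h by rewrite /m; ring.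
    by rewrite /h; field; rewrite !gt_eqF.
  by rewrite ltr_pdivrMr // ltr_pMr // ltr1n.
apply/funext => u; rewrite -[u]Ka.
have := congr1 (fun f => a (f (minv a u))) wid; rewrite /= !Ka => -> //.
Qed.

(** The tile [a K] lies within 1 of the image of 0, so the tile covering a point of gauge at least c
    + 2 comes from an element that moves 0 far. *)
Lemma far_Z (c : R) : exists2 a, Z a & c < D (a o0) o0.
Proof.
pose x := @iwh R kk n (c + 2).
have [a [y [Za Ky ay]]] := Z_cover x.
exists a => //; have [aN ai] := Z_isoD Za.
have := gauge_iwh kk hn (c + 2); rewrite -/x => gx.
have : D (a o0) (Some x) <= 1 by rewrite -ay ai bdist_sym; apply: le_trans (Kr Ky) r1.
have [w ew] : exists w, a o0 = Some w.
  case E : (a o0) => [w|]; first by exists w.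
  by have := weight_inj (isoD_weight (Z_isoD Za)) (etrans E (esym aN)).
rewrite ew => h.
have := bdist_triangle x w (iw0 R kk n); rewrite bdist_sym in h.
have := ler_norm (c + 2).
move: gx h; set d := D _ o0; set d' := D _ _; set d'' := D (Some w) _; clearbody d d' d''.
by clear -R => *; lra.
Qed.

Lemma Z_sequence : exists a : nat -> option X -> option X,
  (forall k, Z (a k)) /\ injective a.
Proof.
have nxt (b : option X -> option X) : {c | Z c /\ D (b o0) o0 < D (c o0) o0}.
  by apply: cid; have [c Zc h] := far_Z (D (b o0) o0); exists c.
pose a k := iter k (fun b => sval (nxt b)) id.
have Za k : Z (a k) by case: k => [|k]; [exact: Z_id|rewrite /a /=; case: (nxt _) => c []].
have mono : {homo (fun k => D (a k o0) o0) : i j / (i < j)%N >-> i < j}.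
  apply: homo_ltn => [y x z|k]; first exact: lt_trans.
  by rewrite /a /=; case: (nxt _) => c [].
exists a; split=> // i j e.
by have [/mono|/mono|//] := ltngtP i j; rewrite e ltxx.
Qed.

Lemma ltr_truncn_eq (x y : R) : 0 <= x -> 0 <= y -> Num.truncn x = Num.truncn y -> `|x - y| <= 1.
Proof.
move=> x0 y0 e.
have := truncn_itv x0; have := truncn_itv y0; rewrite -e -natr1 => /andP[h1 h2] /andP[h3 h4].
by rewrite ler_norml; apply/andP; split; move: (Num.truncn x)%:R h1 h2 h3 h4 => t *; lra.
Qed.

(** Pigeonhole: the rotational parts of an infinite sequence in Z stay bounded, so two of them
    nearly agree, and the quotient of these two elements is the required one. *)
Lemma almost_translation (h : R) : 0 < h ->
  exists z A, [/\ Z z, rep A z, z <> id & diag_le (A - 1%:M) h].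
Proof.
move=> h0; have [a [Za ia]] := Z_sequence.
have [A rA] : {A | forall k, rep (A k) (a k)}.
  have ex k : {B | rep B (a k)} by apply: cid; exact: (rep_ex ZG (Za k)).
  by exists (fun k => sval (ex k)) => k; case: (ex k).
(* Agreement of the codes gives 4 / m for each entry, and multiplication by the inverse matrix loses
   a factor N. *)
pose m := (Num.truncn (4 * N%:R / h)).+1.
have N0 : 0 < N%:R :> R by rewrite ltr0n.
have mh : 4 * N%:R / m%:R <= h.
  rewrite ler_pdivrMr ?ltr0n // [h * _]mulrC -ler_pdivrMr //.
  by apply: ltW; apply: truncnS_gt.
pose T := {ffun 'I_N * 'I_N * 'I_4 -> 'I_(2 * m).+1}.
pose co k i j l := ((kcoords (A k i j))`_l + 1) * m%:R.
(* The shift by 1 in [co] places the coordinates of the diagonal blocks in [0, 2]. Other entries may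
   leave the range of [inord]; their codes are junk and never read. *)
pose code (k : 'I_#|T|.+1) : T :=
  [ffun p : 'I_N * 'I_N * 'I_4 => inord (Num.truncn (co k p.1.1 p.1.2 p.2))].
have d1 k i j : gr i = gr j -> knorm (A k i j) <= 1.
  by have [d _] := iso_diag hn (Z_isoD (Za k)) (rA k); exact: d.
have cb k i j l : gr i = gr j -> 0 <= co k i j l /\ (Num.truncn (co k i j l) < (2 * m).+1)%N.
  move=> ij; have := le_trans (kcoords_le (A k i j) l) (d1 k i j ij).
  rewrite ler_norml /co => /andP[c1 c2].
  have c0 : 0 <= ((kcoords (A k i j))`_l + 1) * m%:R.
    by rewrite mulr_ge0 // -lerBlDr sub0r.
  split=> //; rewrite ltnS -(ler_nat R); apply: (le_trans (y := ((kcoords (A k i j))`_l + 1) * m%:R)); first by rewrite truncn_le.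
  by rewrite natrM ler_wpM2r // -[leRHS]/(1 + 1) lerD2r.
have [k1 [k2 [k12 ek]]] : exists k1 k2, k1 <> k2 /\ code k1 = code k2.
  apply: contrapT => no.
  have /leq_card : injective code.
    by move=> k1 k2 e; apply: contrapT => ne; apply: no; exists k1, k2.
  by rewrite card_ord ltnn.
have aij i j : gr i = gr j -> knorm (A k2 i j - A k1 i j) <= 4 / m%:R.
  move=> ij; apply: knorm_coords_bound => l l4; rewrite kcoordsD kcoordsN.
  have [p1 q1] := cb k1 i j l ij; have [p2 q2] := cb k2 i j l ij.
  have := congr1 (fun f : T => val (f (i, j, Ordinal l4))) ek; rewrite !ffunE /=.
  rewrite !inordK // => /esym/(ltr_truncn_eq p2 p1).
  rewrite /co -mulrBl normrM normr_nat opprD addrACA subrr addr0.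
  by rewrite -ler_pdivlMr ?ltr0n // div1r.
have Zi : Z (minv (a k1)) by exact: (subgroup_minv ZG).
have ri := rep_inv ZG (Za k1) (rA k1).
have [aK Ka] := Z_minvK (Za k1).
exists (minv (a k1) \o a k2), (invJ (A k1) *m A k2); split.
- exact: (subgroup_comp ZG).
- exact: rep_mul.
- move=> e; apply: k12; apply: val_inj; apply: ia; apply/funext => u.
  by rewrite -[RHS]Ka; have := congr1 (fun f => a k1 (f u)) e => /= ->.
have -> : invJ (A k1) *m A k2 - 1%:M = invJ (A k1) *m (A k2 - A k1).
  by rewrite mulmxBr invJ_mul //; case: (rA k1).
have [ui _] := iso_upper0 hn (Z_isoD Zi) ri.
have [di _] := iso_diag hn (Z_isoD Zi) ri.
have [u1 _] := iso_upper0 hn (Z_isoD (Za k1)) (rA k1).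
have [u2 _] := iso_upper0 hn (Z_isoD (Za k2)) (rA k2).
have m0 : 0 <= 4 / m%:R :> R by rewrite divr_ge0.
have dd : diag_le (A k2 - A k1) (4 / m%:R) by move=> i j /aij; rewrite !mxE.
have := diag_le_mul ui (upper0D u2 u1) ler01 m0 di dd.
move=> d i j /d {}d; apply: le_trans d _; apply: le_trans mh.
by rewrite le_eqVlt; apply/orP; left; apply/eqP; ring.
Qed.
End AlmostTranslations.

(** * The Shimizu lemma *)

Lemma le_sqr_add1 (R : realFieldType) (g x : R) : 0 <= g ->
  x <= 1 \/ x <= 2 * g \/ x <= g ^+ 2 -> x <= (1 + g) ^+ 2.
Proof.
move=> g0; have : 0 <= g ^+ 2 by rewrite sqr_ge0.
rewrite sqrrD expr1n mul1r mulr2n => ? -[h|[h|h]]; lra.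
Qed.

Section Dilations.
Variables (R : realType) (kk : scalar_kind) (n : nat).
Local Notation scal := (scalars R kk).
Local Notation kr := (@kreal R kk).
Local Notation X := (iwasawa R kk n).
Local Notation D := (@bdist R kk n).
Local Notation o0 := (Some (iw0 R kk n)).
Local Notation N := (1 + (n + 1))%N.
Local Notation emb u := (embed (omap val (u : option X))).
Implicit Types (A B : 'M[scal]_N).

Definition Smat (s : R) : 'M[scal]_N := \matrix_(i, j) (kr (s ^+ gr i) *+ (i == j)).

Lemma mul_Smat s p (A : 'M[scal]_(N, p)) i j : (Smat s *m A) i j = kr (s ^+ gr i) * A i j.
Proof.
rewrite mxE (bigD1 i) //= big1 ?addr0 => [|k ki]; first by rewrite mxE eqxx.
by rewrite mxE eq_sym (negbTE ki) mul0r.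
Qed.

Lemma mul_mxS s p (A : 'M[scal]_(p, N)) i j : (A *m Smat s) i j = A i j * kr (s ^+ gr j).
Proof.
rewrite mxE (bigD1 j) //= big1 ?addr0 => [|k kj]; first by rewrite mxE eqxx.
by rewrite mxE (negbTE kj) mulr0.
Qed.

Lemma SmatV s : s != 0 -> Smat s *m Smat s^-1 = 1%:M.
Proof.
move=> s0; apply/matrixP => i j; rewrite mul_Smat !mxE; case: eqP => [->|_]; last by rewrite mulr0.
by rewrite mulr1n -krealM -exprMn mulfV // expr1n kreal1.
Qed.

Lemma dil_re s (u : X) : kRe (kr (s ^+ 2) * (val u).2) == 0.
Proof. by rewrite kRe_realM iw_re mulr0. Qed.

Definition dil s (u : X) : X :=
  exist _ ((kr s *: (val u).1, kr (s ^+ 2) * (val u).2) : kpt R kk n) (dil_re s u).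

Lemma vnorm_scale s (z : 'cV[scal]_n) : vnorm (kr s *: z) ^+ 2 = s ^+ 2 * vnorm z ^+ 2.
Proof.
rewrite !vnorm_sq mulr_sumr; apply: eq_bigr => i _.
by rewrite mxE knormM knorm_real exprMn real_normK ?num_real.
Qed.

Lemma Smat_emb s (u : X) : Smat s *m emb (Some u) = emb (Some (dil s u)).
Proof.
apply/matrixP => i j; rewrite ord1 mul_Smat; move: i; apply: idx_ind => [|i|].
- by rewrite !embed_fst gr_fst expr0 kreal1 mulr1.
- by rewrite !embed_mid gr_mid expr1 /= mxE !mulrA -!krealM mulrC.
- by rewrite !embed_lst gr_lst /= vnorm_scale krealM mulrDr.
Qed.

Lemma Smat_emb_None s : Smat s *m emb None = emb None *m (kr (s ^+ 2))%:M.
Proof.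
apply/matrixP => i j; rewrite ord1 mul_Smat [RHS]mxE big_ord1 !embed_None !mxE eqxx mulr1n.
by case: eqP => [->|_]; rewrite ?mul0r ?mulr0 // mulr1 mul1r gr_lst.
Qed.

Lemma dil_gauge s (u : X) : 0 <= s -> D (Some (dil s u)) o0 = s * D (Some u) o0.
Proof.
move=> s0; rewrite -!gauge_bdist; apply/eqP; rewrite -(@eqrXn2 _ 4) ?mulr_ge0 ?gauge_ge0 //.
have v4 (z : 'cV[scal]_n) : vnorm (kr s *: z) ^+ 4 = s ^+ 4 * vnorm z ^+ 4.
  by rewrite (exprM _ 2 2) vnorm_scale exprMn -!exprM.
rewrite exprMn !gauge4 ?iw_re //= v4 knormM knorm_real ger0_norm ?sqr_ge0 //.
by rewrite exprMn -exprM mulrDr.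
Qed.

Lemma mnorm_embed (u : X) : mnorm (emb (Some u)) <= (1 + D (Some u) o0) ^+ 2 *+ N.
Proof.
have ru := iw_re u; rewrite -gauge_bdist; have g0 := gauge_ge0 (val u).
rewrite -[X in _ *+ X]muln1; apply: mnorm_le => i j; rewrite ord1; move: i.
have b x := @le_sqr_add1 _ _ x g0.
apply: idx_ind => [|k|].
- by rewrite embed_fst knorm1; apply: b; left.
- rewrite embed_mid; apply: b; right; left; rewrite knormM knorm_real ger0_norm ?sqrtr_ge0 //.
  apply: ler_pM; rewrite ?sqrtr_ge0 ?knorm_ge0 //.
    by rewrite -[leRHS](@sqr_sqrtr _ 2) // expr2 ler_peMr ?sqrtr_ge0 // -[leLHS]sqrtr1 ler_sqrt // ler1n.
  by apply: le_trans (vnorm_le_gauge ru); exact: knorm_le_vnorm.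
- by rewrite embed_lst; apply: b; right; right; rewrite addrC -gaugeE.
Qed.

Lemma mnorm_scalar1 (l : scal) : mnorm (l%:M : 'M[scal]_1) = knorm l.
Proof. by rewrite /mnorm !big_ord1 mxE mulr1n. Qed.

Lemma mnorm_None : mnorm (emb None) = 1.
Proof.
rewrite /mnorm (bigD1 (ilst n)) //= big_ord1 embed_None eqxx knorm1 big1 ?addr0 // => i il.
by rewrite big_ord1 embed_None (negbTE il) knorm0.
Qed.

Definition sconj s A := Smat s^-1 *m A *m Smat s.

Lemma sconjM s A B : s != 0 -> sconj s (A *m B) = sconj s A *m sconj s B.
Proof.
by move=> s0; rewrite /sconj -!mulmxA (mulmxA (Smat s)) SmatV // mul1mx.
Qed.

Lemma SVmat s : s != 0 -> Smat s^-1 *m Smat s = 1%:M.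
Proof. by move=> s0; rewrite -{2}(invrK s) SmatV // invr_neq0. Qed.

Lemma sconj1 s : s != 0 -> sconj s 1%:M = 1%:M.
Proof. by move=> s0; rewrite /sconj mulmx1 SVmat. Qed.

Lemma sconj_sub1 s A : s != 0 -> sconj s A - 1%:M = sconj s (A - 1%:M).
Proof. by move=> s0; rewrite -{1}(sconj1 s0) /sconj mulmxBr mulmxBl. Qed.

Lemma sconjK s A : s != 0 -> A = Smat s *m sconj s A *m Smat s^-1.
Proof.
by move=> s0; rewrite /sconj !mulmxA SmatV // mul1mx -mulmxA SmatV // mulmx1.
Qed.

(** Conjugation multiplies the entry (i, j) by s ^ ([gr j] - [gr i]): diagonal blocks stay, and the
    entries below them shrink at least by 1 / s, so a large dilation makes any translation part
    negligible. *)
Lemma sconj_near s A h : 1 <= s -> 0 <= h -> upper0 A -> diag_le (A - 1%:M) h ->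
  mnorm (sconj s A - 1%:M) <= (h + mnorm (A - 1%:M) / s) *+ (N * N).
Proof.
move=> s1 h0 uA dA; have s0 : 0 < s := lt_le_trans ltr01 s1.
rewrite sconj_sub1 ?gt_eqF //; apply: mnorm_le => i j.
have := upper0D uA (@upper0_1 R kk n); move: dA; move: (A - 1%:M) => B dB uB.
rewrite /sconj mul_mxS mul_Smat !knormM !knorm_real !ger0_norm ?exprn_ge0 ?invr_ge0 ?(ltW s0) //.
have m0 := mnorm_ge0 B.
have [ij|ji|ij] := ltngtP (gr i) (gr j).
- by rewrite uB // knorm0 mulr0 mul0r addr_ge0 // divr_ge0 // ltW.
- rewrite mulrAC -[leLHS]mulrC; apply: (@le_trans _ _ (mnorm B / s)); last by rewrite lerDr.
  apply: ler_pM; rewrite ?knorm_ge0 ?knorm_le_mnorm //.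
    by rewrite mulr_ge0 // exprn_ge0 // ?invr_ge0 ltW.
  rewrite -(subnK (ltnW ji)) exprD -mulrA -exprMn mulVf ?gt_eqF // expr1n mulr1.
  rewrite -[leRHS]expr1 ler_wiXn2l ?invr_ge0 ?(ltW s0) ?invf_le1 //.
  by rewrite subn_gt0.
- rewrite mulrAC ij -exprMn mulVf ?gt_eqF // expr1n mul1r.
  by apply: le_trans (dB _ _ ij) _; rewrite lerDl divr_ge0 // ltW.
Qed.

Hypothesis hn : (1 <= n)%N.

Lemma hbasis_gauge j : D (Some (hbasis R kk j)) o0 <= 1.
Proof.
rewrite -gauge_bdist -(@expr_le1 _ 2) ?gauge_ge0 //.
have re := iw_re (hbasis R kk j).
by apply: le_trans (gauge_le re) _; rewrite /= vnorm_delta knorm0 addr0 expr1n.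
Qed.

(* Conjugation by the dilation of ratio the radius of the isometric sphere of
   g makes g a map of isometric sphere of radius 1, hence bounded. *)
Lemma sconj_bound A g (s : option X -> R) (p q : X) : rep A g -> weight g s ->
  g None = Some p -> g (Some q) = None -> D (Some p) o0 <= 1 -> D (Some q) o0 <= 1 ->
  s None <= 1 ->
  mnorm (sconj (s None)^-1 A) <= (3 * (25 *+ N)) *+ (N * N).
Proof.
move=> rA gs gN gq p1 q1 s1; have [s0 sE] := gs.
have sq : s (Some q) = (s None)^-1.
  have := sE (Some q) None; rewrite gq gN /= mul1r => e.
  by apply: (@mulIf _ (s None)); rewrite ?gt_eqF // e mulVf ?gt_eqF.
move: sq; set S := (s None)^-1 => sq; have S0 : 0 < S by rewrite invr_gt0.
have SV : S^-1 = s None by rewrite /S invrK.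
have S1 : 1 <= S by rewrite /S invf_ge1.
have Sn : 0 <= S := ltW S0.
have Vn : 0 <= S^-1 by rewrite SV ltW.
clearbody S.
have emb_scal (v : X) (l : scal) c : (1 + D (Some v) o0) ^+ 2 * knorm l <= c ->
    mnorm (emb (Some v) *m l%:M) <= c *+ N.
  move=> h; apply: le_trans (mnormM _ _) _; rewrite mnorm_scalar1.
  apply: (@le_trans _ _ ((1 + D (Some v) o0) ^+ 2 * knorm l *+ N)); last by rewrite lerMn2r h orbT.
  by rewrite -mulrnAl ler_wpM2r ?knorm_ge0 // mnorm_embed.
have main (u : X) : D (Some u) o0 <= 1 -> mnorm (sconj S A *m emb (Some u)) <= 25 *+ N.
  move=> u1; pose w := Some (dil S u).
  have [AJ Ag] := rA; have [l l0 e] := Ag w; have nl := rep_scalar hn rA gs e.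
  rewrite /sconj -!mulmxA Smat_emb e mulmxA.
  have w1 : D w o0 <= S by rewrite dil_gauge // ler_piMr // ltW.
  case E : (g w) => [v|].
    rewrite Smat_emb; apply: emb_scal; rewrite dil_gauge // nl -exprMn.
    (* The 25 is (2 + 3)^2: the entries are at most (s(w) + s(w) |v| / S)^2, where s(w) <= 2 because
       s(w) S is the distance from w to q, and the second term is at most 3. *)
    have sw : s w <= 2.
      have := sE w (Some q); rewrite E gq /= mul1r sq => e2.
      have tr : s w * S <= S + 1.
        rewrite e2; apply: le_trans (bdist_triangle _ (iw0 R kk n) _) _.
        by apply: lerD w1 _; rewrite bdist_sym.
      rewrite -(@ler_pM2r _ S) //; apply: le_trans tr _.
      by rewrite -[2]/(1 + 1) mulrDl mul1r lerD2l.
    have sv : s w * (S^-1 * D (Some v) o0) <= 3.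
      have := sE w None; rewrite E gN mulrCA mulrA => e2.
      have tr : D (Some v) o0 <= D (Some v) (Some p) + 1.
        by apply: le_trans (bdist_triangle _ p _) _; rewrite lerD2l.
      have -> : s w * (S^-1 * D (Some v) o0) = s w * s None * D (Some v) o0 by rewrite SV mulrA.
      apply: (@le_trans _ _ (s w * s None * (D (Some v) (Some p) + 1))).
        by rewrite ler_wpM2l // mulr_ge0 // ltW.
      rewrite mulrDr mulr1.
      have -> : s w * s None * D (Some v) (Some p) = 1 by rewrite -[RHS]e2 /=; ring.
      rewrite (_ : 3 = 1 + 2 * 1) ?lerD2l; last by ring.
      by apply: ler_pM => //; rewrite ltW.
    rewrite (_ : 25 = 5 ^+ 2); last by ring.
    rewrite ler_pXn2r ?nnegrE ?mulr_ge0 ?addr_ge0 ?mulr_ge0 ?bdist_ge0 ?(ltW (s0 _)) //.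
    rewrite mulrDl mul1r (mulrC _ (s w)) (_ : 5 = 2 + 3); last by ring.
    exact: lerD.
  have wq : w = Some q by apply: (weight_inj gs); rewrite E gq.
  rewrite Smat_emb_None; apply: le_trans (mnormM _ _) _.
  apply: (@le_trans _ _ 1).
    apply: (@le_trans _ _ (mnorm (emb None) * knorm (kr (S^-1 ^+ 2)) * knorm l)).
      apply: ler_pM; rewrite ?mnorm_ge0 ?mnorm_scalar1 //.
      by apply: le_trans (mnormM _ _) _; rewrite mnorm_scalar1.
    rewrite mnorm_None mul1r knorm_real nl wq sq ger0_norm ?sqr_ge0 // -exprMn mulVf ?gt_eqF //.
  by rewrite -mulrnA ler1n.
have [AJ Ag] := rA; have [l l0 e] := Ag None; have nl := rep_scalar hn rA gs e.
apply: mnorm_emb => [||j]; last by apply: main; exact: hbasis_gauge.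
  rewrite /sconj -!mulmxA Smat_emb_None (mulmxA A) e gN !mulmxA Smat_emb -mulmxA -scalar_mxM.
  apply: emb_scal; rewrite dil_gauge // knormM nl knorm_real ger0_norm ?sqr_ge0 //.
  rewrite -exprMn -SV mulVf ?gt_eqF // expr1n mulr1.
  rewrite (_ : 25 = 5 ^+ 2); last by ring.
  have b : S^-1 * D (Some p) o0 <= 1 by rewrite SV mulr_ile1 // ?bdist_ge0 // ltW.
  rewrite ler_pXn2r ?nnegrE ?addr_ge0 ?mulr_ge0 ?bdist_ge0 //.
  by apply: le_trans (lerD (lexx 1) b) _; rewrite -[1 + 1]/(2%:R) ler_nat.
by apply: main; rewrite bdist_diag.
Qed.
End Dilations.

(** * Iterated commutators and the bound on radii of cusps *)

Section Shimizu.
Variables (R : realType) (kk : scalar_kind) (n : nat).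
Local Notation scal := (scalars R kk).
Local Notation X := (iwasawa R kk n).
Local Notation D := (@bdist R kk n).
Local Notation o0 := (Some (iw0 R kk n)).
Local Notation N := (1 + (n + 1))%N.
Variable CF : iwasawa_cf R kk n.
Local Notation Z := (cf_Z CF).
Local Notation M := (modular_group CF).
Hypotheses (hn : (1 <= n)%N) (compl : cf_complete CF) (discr : cf_discrete CF).
Variable r : R.
Hypotheses (r1 : r <= 1) (Kr : forall y, cf_K CF y -> D (Some y) o0 <= r).

Let ZG : subgroup Z := Z_subgroup CF.
Let MG : subgroup M := modular_subgroup compl.

Section Commutators.
Variables (z w : option X -> option X).

Fixpoint iter_comm k : option X -> option X :=
  if k is k'.+1 then z \o iter_comm k' \o minv z \o minv (iter_comm k') else w.

Hypotheses (Zz : Z z) (Mw : M w) (zfree : forall q, z (Some q) <> Some q).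

Lemma iter_comm_mod k : M (iter_comm k).
Proof.
elim: k => [|k IH] //=.
have Mz : M z := modular_Z Zz.
apply: (subgroup_comp MG); last exact: (subgroup_minv MG).
by apply: (subgroup_comp MG); [exact: (subgroup_comp MG Mz IH)|exact: (subgroup_minv MG)].
Qed.

(** If the commutator of z and w_k fixes infinity, then z fixes the preimage of infinity under w_k;
    since z has no finite fixed point, this preimage is infinity. *)
Lemma iter_comm_fix k : iter_comm k None = None -> w None = None.
Proof.
elim: k => [|k IH] //= e; apply: IH.
have Mk := iter_comm_mod k; have Mz : M z by exact: modular_Z.
set v := minv (iter_comm k) None.
have zN : z None = None by have [] := Z_isoD Zz.
have : iter_comm k (minv z v) = None.
  by apply: (subgroup_inj MG Mz); rewrite zN.
move/(congr1 (minv (iter_comm k))); rewrite (minvKl MG Mk) -/v => zv.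
have : z v = v by rewrite -{1}zv (minvKr MG Mz).
case E : v => [q|]; first by move/zfree.
by move=> _; rewrite -{1}E (minvKr MG Mk).
Qed.

Variables (A W : 'M[scal]_N) (s : R).
Hypotheses (rA : rep A z) (rW : rep W w) (s0 : s != 0).
Let eps : R := (16 * N%:R ^+ 2)^-1.
Hypotheses (A1 : mnorm (sconj s A - 1%:M) <= eps) (W1 : mnorm (sconj s W - 1%:M) <= eps).

(** By [mnorm_comm] a step multiplies the deviation by at most 2 eps (2 N)^2, the two inverses being
    bounded by 2 N; the choice of [eps] makes this 1 / 2. *)
Lemma iter_comm_near k : exists B, rep B (iter_comm k) /\ mnorm (sconj s B - 1%:M) <= eps * 2^-1 ^+ k.
Proof.
have N1 : 1 <= N%:R :> R by rewrite ler1n.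
have N2 : 0 < 16 * N%:R ^+ 2 :> R by rewrite mulr_gt0 // exprn_gt0 // ltr0n.
have eps0 : 0 < eps by rewrite invr_gt0.
have eps2 : eps <= 1 / 2.
  rewrite /eps div1r lef_pV2 ?posrE // -[leLHS]mulr1; apply: ler_pM => //; first by rewrite ler_nat.
  by rewrite expr_ge1 // ltW // (lt_le_trans ltr01).
elim: k => [|k [B [rB hB]]]; first by exists W; rewrite expr0 mulr1.
have Mk := iter_comm_mod k; have Mz : M z by exact: modular_Z.
have rAi := rep_inv MG Mz rA; have rBi := rep_inv MG Mk rB.
exists (A *m B *m invJ A *m invJ B); split.
  exact: (rep_mul (rep_mul (rep_mul rA rB) rAi) rBi).
have AV : sconj s A *m sconj s (invJ A) = 1%:M by rewrite -sconjM // (rep_mulV MG Mz rA) sconj1.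
have BV : sconj s B *m sconj s (invJ B) = 1%:M by rewrite -sconjM // (rep_mulV MG Mk rB) sconj1.
have VA : sconj s (invJ A) *m sconj s A = 1%:M.
  by rewrite -sconjM // invJ_mul ?sconj1 //; case: rA.
have VB : sconj s (invJ B) *m sconj s B = 1%:M.
  by rewrite -sconjM // invJ_mul ?sconj1 //; case: rB.
rewrite (sconjM _ (invJ B) s0) (sconjM _ (invJ A) s0) (sconjM A B s0).
apply: le_trans (mnorm_comm AV BV) _.
have hB2 : mnorm (sconj s B - 1%:M) <= 1 / 2.
  apply: le_trans hB _; apply: le_trans eps2; rewrite ler_piMr ?(ltW eps0) //.
  by rewrite exprn_ile1 // ?invr_ge0 // invf_le1 // ler1n.
have iA := mnorm_inv VA (le_trans A1 eps2); have iB := mnorm_inv VB hB2.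
have -> : eps * 2^-1 ^+ k.+1 = 2 * eps * (eps * 2^-1 ^+ k) * (2 * N%:R * (2 * N%:R)).
  by rewrite exprS /eps; field; rewrite gt_eqF // (lt_le_trans ltr01).
by apply: ler_pM; rewrite ?mulr_ge0 ?mnorm_ge0 //; apply: ler_pM; rewrite ?mulr_ge0 ?mnorm_ge0 // ler_wpM2l.
Qed.

(* The iterated commutators converge to the identity, hence are eventually
   trivial by discreteness. *)
Lemma zassenhaus : w None = None.
Proof.
have [e e0 disc] := discr.
pose c := mnorm (Smat kk n s) * mnorm (Smat kk n s^-1).
have c0 : 0 <= c by rewrite mulr_ge0 ?mnorm_ge0.
have N2 : 0 < 16 * N%:R ^+ 2 :> R by rewrite mulr_gt0 // exprn_gt0 // ltr0n.
have eps0 : 0 < eps by rewrite invr_gt0.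
have [|||k hk] := @exp_small R 2^-1 (e / ((c + 1) * eps)) _ _ _.
- by rewrite invr_ge0.
- by rewrite invf_lt1 // ltr1n.
- by rewrite divr_gt0 // mulr_gt0 // ltr_wpDl.
have [B [[BJ Bi] hB]] := iter_comm_near k.
have id_k : iter_comm k = id.
  apply: (disc B) => //; last exact: iter_comm_mod.
  move=> i j; have := knorm_le_mnorm (B - 1%:M) i j; rewrite !mxE => h.
  apply: le_lt_trans h _; rewrite (sconjK (B - 1%:M) s0) -sconj_sub1 //.
  apply: le_lt_trans (mnormM _ _) _.
  apply: (@le_lt_trans _ _ (c * (eps * 2^-1 ^+ k))).
    rewrite /c mulrAC ler_wpM2r ?mnorm_ge0 //; apply: le_trans (mnormM _ _) _.
    by rewrite ler_wpM2l ?mnorm_ge0.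
  rewrite ltr_pdivlMr ?mulr_gt0 ?ltr_wpDl // in hk.
  apply: le_lt_trans hk; rewrite [leRHS]mulrC -[leRHS]mulrA ler_wpM2r ?lerDl //.
  by rewrite mulr_ge0 ?(ltW eps0) // exprn_ge0 // invr_ge0.
by apply: (@iter_comm_fix k); rewrite id_k.
Qed.
End Commutators.

(** Suppose the weight at infinity is below 1 / R0. Multiplying by Z on both sides puts g oo and the
    preimage of oo in K. After the dilation of ratio S, the inverse of that weight, g is bounded and
    z close to 1, so the conjugate of z by g is close to 1 as well. By [zassenhaus] it fixes
    infinity, so z fixes a finite point. *)
Lemma shimizu : exists2 R0 : R, 0 < R0 &
  forall g (s : option X -> R), M g -> weight g s -> g None <> None -> 1 <= R0 * s None.
Proof.
have [h1 h10 fixid] := near_id_fix hn r1 Kr.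
have N0 : 0 < N%:R :> R by rewrite ltr0n.
pose eps : R := (16 * N%:R ^+ 2)^-1.
have eps0 : 0 < eps by rewrite invr_gt0 mulr_gt0 // exprn_gt0.
pose C : R := (3 * (25 *+ N)) *+ (N * N).
have C0 : 0 < C by rewrite pmulrn_lgt0 // mulr_gt0 // pmulrn_lgt0.
(* Room for the conjugation by g, whose rescaled matrix and inverse are both bounded by C. *)
pose eps1 := eps / (1 + C * C).
have C1 : 1 <= 1 + C * C by rewrite lerDl mulr_ge0 ?ltW.
have Cp : 0 < 1 + C * C := lt_le_trans ltr01 C1.
have eps10 : 0 < eps1 by rewrite divr_gt0.
have NN : 0 < (N * N)%:R :> R by rewrite ltr0n.
pose h := Num.min h1 (eps1 / (2 * (N * N)%:R)).
have h0 : 0 < h by rewrite lt_min h10 divr_gt0 // mulr_gt0.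
have [z [A [Zz rA zid dA]]] := almost_translation hn r1 Kr h0.
have zfree q : z (Some q) <> Some q.
  move=> zq; apply: zid; apply: (fixid z A q Zz rA _ zq) => i j ij.
  by apply: le_trans (dA i j ij) _; rewrite ge_min lexx.
have Mz : M z by exact: modular_Z.
have [uA _] := iso_upper0 hn (Z_isoD Zz) rA.
pose m := mnorm (A - 1%:M).
have m0 : 0 <= m by exact: mnorm_ge0.
(* Chosen so that m / S, the rescaled translation part of z, uses up at most half of [eps1] in
   [sconj_near]; h accounts for the other half. *)
pose R0 := 1 + 2 * (N * N)%:R * m / eps1.
have R01 : 1 <= R0 by rewrite lerDl divr_ge0 ?(ltW eps10) // mulr_ge0 // mulr_ge0 // ltW.
have R00 : 0 < R0 := lt_le_trans ltr01 R01.
exists R0 => // g s Mg gs gN; rewrite leNgt; apply/negP => small.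
have [s0 _] := gs.
have [p gp] : exists p, g None = Some p by case: (g None) gN => [p|//]; exists p.
have [q gq] : exists q, g (Some q) = None.
  case E : (minv g None) => [q|]; first by exists q; rewrite -E (minvKr MG Mg).
  by case: gN; rewrite -{1}E (minvKr MG Mg).
have [a [y [Za Ky ay]]] := Z_cover CF p.
have [b [y' [Zb Ky' by']]] := Z_cover CF q.
have Zai := subgroup_minv ZG Za.
have Ma := modular_Z Zai; have Mb := modular_Z Zb.
pose g2 := minv a \o g \o b.
have Mg2 : M g2 := subgroup_comp MG (subgroup_comp MG Ma Mg) Mb.
pose s2 u := s (b u) * 1.
have gs2 : weight g2 s2.
  by apply: weight_comp (isoD_weight (Z_isoD Zb)); apply: isoD_comp_weight gs; exact: Z_isoD Zai.
have bN : b None = None by have [] := Z_isoD Zb.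
have aN : minv a None = None by have [] := Z_isoD Zai.
have g2N : g2 None = Some y by rewrite /g2 /= bN gp -ay (minvKl ZG Za).
have g2q : g2 (Some y') = None by rewrite /g2 /= by' gq.
have s2N : s2 None = s None by rewrite /s2 bN mulr1.
have sR : R0 < (s None)^-1 by rewrite -div1r ltr_pdivlMr.
have S1 : 1 <= (s None)^-1 := le_trans R01 (ltW sR).
have Sn : (s None)^-1 != 0 by rewrite invr_eq0 gt_eqF.
have s1 : s2 None <= 1 by rewrite s2N -(invrK (s None)) invf_le1 // invr_gt0.
have [Ag rg] := rep_ex MG Mg2.
have rgi := rep_inv MG Mg2 rg.
have y1 : D (Some y) o0 <= 1 by apply: le_trans r1; exact: Kr.
have y'1 : D (Some y') o0 <= 1 by apply: le_trans r1; exact: Kr.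
have Bg := sconj_bound hn rg gs2 g2N g2q y1 y'1 s1.
have gN' : minv g2 None = Some y' by rewrite -g2q (minvKl MG Mg2).
have gy' : minv g2 (Some y) = None by rewrite -g2N (minvKl MG Mg2).
have gsi := weight_inv gs2 (minvKr MG Mg2).
have siN : (s2 (minv g2 None))^-1 = s2 None.
  rewrite gN'; have [_ /(_ (Some y') None)] := gs2; rewrite g2N g2q /= mul1r => e.
  by apply: (@mulIf _ (s2 (Some y'))); rewrite ?gt_eqF ?mulVf ?gt_eqF ?(proj1 gs2) // mulrC e.
have Bi := sconj_bound hn rgi gsi gN' gy' y'1 y1.
rewrite siN s2N in Bi; have {}Bi := Bi ltac:(by rewrite -s2N).
rewrite s2N in Bg; set S := (s None)^-1 in S1 Sn sR Bg Bi.
have e1 : mnorm (sconj S A - 1%:M) <= eps1.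
  apply: le_trans (sconj_near S1 (ltW h0) uA dA) _.
  have -> : eps1 = (eps1 / (2 * (N * N)%:R) + eps1 / (2 * (N * N)%:R)) *+ (N * N).
    rewrite -mulr_natr; field; exact: lt0r_neq0.
  rewrite lerMn2r; apply/orP; right; apply: lerD; first by rewrite ge_min lexx orbT.
  rewrite -/m ler_pdivrMr ?(lt_le_trans ltr01) // mulrAC ler_pdivlMr ?mulr_gt0 //.
  rewrite -ler_pdivrMl // mulrC (mulrC m); apply: le_trans (ltW sR).
  by rewrite /R0 lerDr.
pose w := g2 \o z \o minv g2.
have Mw : M w := subgroup_comp MG (subgroup_comp MG Mg2 Mz) (subgroup_minv MG Mg2).
have rw := rep_mul (rep_mul rg rA) rgi.
have eA : mnorm (sconj S A - 1%:M) <= eps.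
  by apply: le_trans e1 _; rewrite ler_pdivrMr // ler_peMr // ltW.
have eW : mnorm (sconj S (Ag *m A *m invJ Ag) - 1%:M) <= eps.
  have -> : sconj S (Ag *m A *m invJ Ag) - 1%:M = sconj S Ag *m (sconj S A - 1%:M) *m sconj S (invJ Ag).
    rewrite mulmxBr mulmx1 mulmxBl -!sconjM //.
    by rewrite (rep_mulV MG Mg2 rg) sconj1.
  apply: le_trans (mnormM _ _) _.
  apply: (@le_trans _ _ (C * eps1 * C)).
    apply: ler_pM; rewrite ?mnorm_ge0 //.
    by apply: le_trans (mnormM _ _) _; apply: ler_pM; rewrite ?mnorm_ge0.
  have -> : C * eps1 * C = eps * (C * C) / (1 + C * C) by rewrite /eps1; ring.
  by rewrite ler_pdivrMr // ler_pM2l // lerDr ler01.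
have wN := zassenhaus Zz Mw zfree rA rw Sn eA eW.
move: wN; rewrite /w /= gN' => e; apply: (zfree y').
by apply: (subgroup_inj MG Mg2); rewrite g2q.
Qed.
End Shimizu.

(** * Null sets and porosity *)

Lemma ler_sum_uniq_sub (R : realType) (T : eqType) (s1 s2 : seq T) (f : T -> R) :
  (forall x, 0 <= f x) -> uniq s1 -> uniq s2 -> {subset s1 <= s2} ->
  \sum_(x <- s1) f x <= \sum_(x <- s2) f x.
Proof.
move=> f0 u1 u2 s12.
have p : perm_eq s1 [seq x <- s2 | x \in s1].
  apply: uniq_perm => // [|x]; first exact: filter_uniq.
  by rewrite mem_filter; case: (boolP (x \in s1)) => //= /s12 ->.
rewrite (perm_big _ p) big_filter big_mkcond /=.
by apply: ler_sum => x _; case: ifP.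
Qed.

Section Cover.
Variables (R : realType) (T C : Type) (cell : C -> set T) (cost : C -> R) (c0 : C).
Hypotheses (cost_ge0 : forall c, 0 <= cost c) (cost0 : cost c0 = 0).

(** Kept abstract to serve both coordinate boxes and Cygan balls. The cell [c0] of cost 0 pads
    finite families to sequences. *)
Definition covered (A : set T) (v : R) := exists F : nat -> C,
  A `<=` \bigcup_m cell (F m) /\ forall N, \sum_(m < N) cost (F m) <= v.

Definition cover_null (A : set T) := forall e : R, 0 < e -> covered A e.

Lemma covered_le A v w : v <= w -> covered A v -> covered A w.
Proof. by move=> vw [F [AF Fv]]; exists F; split=> // N; exact: le_trans vw. Qed.

Lemma covered_sub A B v : A `<=` B -> covered B v -> covered A v.
Proof. by move=> AB [F [BF Fv]]; exists F; split=> //; exact: subset_trans BF. Qed.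

Lemma cover_null_sub A B : A `<=` B -> cover_null B -> cover_null A.
Proof. by move=> AB nB e e0; exact: covered_sub (nB e e0). Qed.

Lemma covered_seq A (s : seq C) v : A `<=` [set x | exists i, (i < size s)%N /\ cell (nth c0 s i) x] ->
  \sum_(c <- s) cost c <= v -> covered A v.
Proof.
move=> As sv; exists (nth c0 s); split=> [x /As [i [_ ix]]|N]; first by exists i.
apply: le_trans sv; rewrite (big_nth c0) big_mkord.
have [Ns|sN] := leqP N (size s).
  rewrite (big_ord_widen_cond _ (fun=> true) (fun i => cost (nth c0 s i)) Ns) /=.
  by rewrite big_mkcond /=; apply: ler_sum => i _; case: ifP.
rewrite [leRHS](big_ord_widen_cond _ (fun=> true) (fun i => cost (nth c0 s i)) (ltnW sN)) /=.
rewrite [leRHS]big_mkcond /=; apply: ler_sum => i _; case: ltnP => // h.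
by rewrite nth_default // cost0.
Qed.

(** The double family is enumerated by [pickle]; any initial segment of the enumeration lies in a
    square B x B, whose cost is bounded row by row. *)
Lemma covered_bigcup (A : nat -> set T) (v : nat -> R) w :
  (forall k, covered (A k) (v k)) -> (forall N, \sum_(k < N) v k <= w) ->
  covered (\bigcup_k A k) w.
Proof.
move=> cA vw; pose F k := sval (cid (cA k)).
have FA k : A k `<=` \bigcup_m cell (F k m) by rewrite /F; case: cid => ? [].
have Fv k N : \sum_(m < N) cost (F k m) <= v k by rewrite /F; case: cid => ? [].
pose G j := if @pickle_inv (nat * nat)%type j is Some p then F p.1 p.2 else c0.
exists G; split=> [x [k _ /FA [m _ xm]]|N].
  by exists (pickle (k, m)) => //; rewrite /G pickleK_inv.
pose L := pmap (@pickle_inv (nat * nat)%type) (iota 0 N).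
have sumL : \sum_(j < N) cost (G j) = \sum_(p <- L) cost (F p.1 p.2).
  rewrite -(big_mkord xpredT (fun j => cost (G j))) /L /index_iota subn0.
  elim: (iota 0 N) => [|j s IH]; first by rewrite !big_nil.
  rewrite big_cons IH /= /G; case: pickle_inv => [p|] /=; first by rewrite big_cons.
  by rewrite cost0 add0r.
have uL : uniq L.
  by apply: (pmap_uniq (@pickle_invK (nat * nat)%type)); exact: iota_uniq.
have [B LB] : exists B, forall p, p \in L -> (p.1 < B)%N /\ (p.2 < B)%N.
  elim: L {sumL uL} => [|p s [B IH]]; first by exists 0%N.
  exists (maxn B (maxn p.1.+1 p.2.+1)) => q; rewrite inE => /orP[/eqP ->|/IH[h1 h2]].
    by rewrite !leq_max !leqnn !orbT.
  by rewrite !leq_max h1 h2.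
rewrite sumL; apply: (@le_trans _ _ (\sum_(p <- [seq (k, m) | k <- iota 0 B, m <- iota 0 B]) cost (F p.1 p.2))).
  apply: ler_sum_uniq_sub => //.
    by apply: allpairs_uniq; rewrite ?iota_uniq // => -[? ?] [? ?].
  move=> [k m] /LB /= [kB mB]; apply/allpairsP; exists (k, m).
  by rewrite !mem_iota.
rewrite big_allpairs; apply: le_trans (vw B).
rewrite -(big_mkord xpredT v) /index_iota subn0.
apply: ler_sum => k _ /=.
by have := Fv k B; rewrite -(big_mkord xpredT (fun m => cost (F k m))) /index_iota subn0.
Qed.

Lemma geometric_half (e : R) N : 0 <= e -> \sum_(k < N) e * 2^-1 ^+ k.+1 <= e.
Proof.
move=> e0; have -> : \sum_(k < N) e * 2^-1 ^+ k.+1 = e * (1 - 2^-1 ^+ N).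
  elim: N => [|N IH]; first by rewrite big_ord0 expr0 subrr mulr0.
  by rewrite big_ord_recr /= IH exprS; field.
by rewrite ler_piMr // gerBl exprn_ge0 // invr_ge0.
Qed.

Lemma cover_null_bigcup (A : nat -> set T) : (forall k, cover_null (A k)) -> cover_null (\bigcup_k A k).
Proof.
move=> nA e e0; apply: (@covered_bigcup _ (fun k => e * 2^-1 ^+ k.+1)) => [k|N].
  by apply: nA; rewrite mulr_gt0 // exprn_gt0 // invr_gt0.
exact/geometric_half/ltW.
Qed.

Lemma cover_nullU A B : cover_null A -> cover_null B -> cover_null (A `|` B).
Proof.
move=> nA nB; apply: (@cover_null_sub _ (\bigcup_k (if k is 0%N then A else B))).
  by move=> x [Ax|Bx]; [exists 0%N|exists 1%N].
by apply: cover_null_bigcup => -[|k].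
Qed.
End Cover.

(** The slack on the individual cells is summed as a geometric series, so each cell, even one of
    cost 0, may be recovered with an arbitrarily small loss. *)
Lemma cover_null_transfer (R : realType) (T C1 C2 : Type) (cell1 : C1 -> set T) (cell2 : C2 -> set T)
    (cost1 : C1 -> R) (cost2 : C2 -> R) (c2 : C2) (K : R) :
  (forall c, 0 <= cost2 c) -> cost2 c2 = 0 -> 0 < K ->
  (forall c e, 0 < e -> covered cell2 cost2 (cell1 c) (K * cost1 c + e)) ->
  forall A, cover_null cell1 cost1 A -> cover_null cell2 cost2 A.
Proof.
move=> cge0 c20 K0 tr A nA e e0.
have [|F [AF Fe]] := nA (e / (2 * K)); first by rewrite divr_gt0 // mulr_gt0.
apply: covered_sub AF _.
apply: (@covered_bigcup _ _ _ _ _ c2 cge0 c20 _ (fun k => K * cost1 (F k) + (e / 2) * 2^-1 ^+ k.+1)).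
  by move=> k; apply: tr; rewrite mulr_gt0 ?divr_gt0 // exprn_gt0 // invr_gt0.
move=> N; rewrite big_split /= -[X in X + _]mulr_sumr.
have {2}-> : e = K * (e / (2 * K)) + e / 2 by field; rewrite gt_eqF.
apply: lerD; first by apply: ler_wpM2l; [exact: ltW|exact: Fe].
by apply: geometric_half; rewrite divr_ge0 // ltW.
Qed.

(** * Grids adapted to the dilations *)

Section Grid.
Variables (R : realType) (kk : scalar_kind) (n : nat).
Local Notation scal := (scalars R kk).
Local Notation kr := (@kreal R kk).
Local Notation X := (iwasawa R kk n).
Local Notation D := (@bdist R kk n).
Local Notation o0 := (Some (iw0 R kk n)).
Local Notation I := (iw_index kk n).
Implicit Types (x y : X) (i : I) (e s : R).

(* The homogeneity of the coordinates under dilations. *)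
Definition wt i : nat := if i is inl _ then 1 else 2.

Definition hdim : nat := \sum_(i : I) wt i.

Lemma mk_ex (c : I -> R) : exists x : X, forall i, iw_coord x i = c i.
Proof.
pose zc j := sval (cid (kcoords_surj kk (fun l => c (inl (j, inord l))))).
have zcE j (l : 'I_(imdim kk).+1) : (kcoords (zc j))`_l = c (inl (j, l)).
  by rewrite /zc; case: cid => w /= -> //; rewrite ?inord_val // -ltnS.
pose tc := sval (cid (kcoords_surj kk (fun l => if l is l'.+1 then
   (if insub l' is Some k then c (inr k) else 0) else 0))).
have tcE l : (l <= imdim kk)%N -> (kcoords tc)`_l = if l is l'.+1 then
   (if insub l' is Some k then c (inr k) else 0) else 0.
  by rewrite /tc; case: cid => w /= h; exact: h.
have t0 : kRe tc == 0 by rewrite /kRe tcE.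
exists (exist _ ((\col_j zc j, tc) : kpt R kk n) t0) => -[[j l]|l] /=.
  by rewrite mxE zcE.
by rewrite tcE //; case: insubP => [k _ kl|]; [congr (c (inr _)); exact: val_inj|rewrite ltn_ord].
Qed.

Definition mk (c : I -> R) : X := sval (cid (mk_ex c)).

Lemma mkE c i : iw_coord (mk c) i = c i.
Proof. by rewrite /mk; case: cid. Qed.

Lemma horizontal_eq x y : (forall jl, iw_coord x (inl jl) = iw_coord y (inl jl)) ->
  (val x).1 = (val y).1.
Proof.
move=> h; apply/matrixP => j k; rewrite ord1; apply: kcoords_inj => l.
have [lk|kl] := ltnP l (imdim kk).+1; first exact: (h (j, Ordinal lk)).
by rewrite !nth_default ?size_kcoords.
Qed.

Lemma ldiv_re (p : X) x : kRe (hmul (- (val p).1, - (val p).2) (val x)).2 == 0.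
Proof. by apply/eqP/hmul_re; rewrite ?opp_re ?iw_re. Qed.

Definition ldiv (p : X) x : X :=
  exist _ (hmul (- (val p).1, - (val p).2) (val x) : kpt R kk n) (ldiv_re p x).

Lemma ldiv_gauge (p : X) x : D (Some p) (Some x) = gauge (val (ldiv p x)).
Proof. by []. Qed.

Definition tw (p : X) x (l : 'I_(imdim kk)) : R := (kcoords (hdot (val p).1 (val x).1))`_l.+1.

Definition twist (p : X) x i : R := if i is inr l then 2 * tw p x l else 0.

Lemma ldivE (p : X) x i : iw_coord (ldiv p x) i = iw_coord x i - iw_coord p i - twist p x i.
Proof.
case: i => [[j l]|l] /=; first by rewrite mxE mxE kcoordsD kcoordsN subr0 addrC.
rewrite hdotNl kImN mulr2n (kcoordsD (- _ + _)) (kcoordsD (- (sval p).2)).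
rewrite (kcoordsD (- kIm _)) !kcoordsN kcoords_kIm /tw /=; ring.
Qed.

Lemma coord_le_gauge x i : `|iw_coord x i| <= gauge (val x) ^+ wt i.
Proof.
have rx := iw_re x; case: i => [[j l]|l] /=.
  rewrite expr1; apply: le_trans (kcoords_le _ _) _.
  by apply: le_trans (knorm_le_vnorm _ _) _; exact: vnorm_le_gauge.
by apply: le_trans (kcoords_le _ _) _; exact: knorm_le_gauge.
Qed.

(** A scalar has at most 4 coordinates, whence 4 n for the horizontal norm; 2 is the square root of
    the 4 bounding the vertical part. *)
Definition gauge_const : nat := 4 * n + 2.

Lemma imdim3 : (imdim kk <= 3)%N. Proof. by case: kk. Qed.

Lemma knorm_coords_le (a : scal) s : (forall l : 'I_(imdim kk).+1, `|(kcoords a)`_l| <= s) ->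
  knorm a <= 4 * s.
Proof.
move=> h; have s0 : 0 <= s by exact: le_trans (h ord0).
apply: le_trans (knorm_kcoords _) _.
apply: (@le_trans _ _ (\sum_(l < (imdim kk).+1) s)); first by apply: ler_sum.
by rewrite sumr_const card_ord -[leLHS]mulr_natl ler_wpM2r // ler_nat ltnS imdim3.
Qed.

Lemma vnorm_coords_le x s : (forall jl, `|iw_coord x (inl jl)| <= s) ->
  vnorm (val x).1 <= (4 * n)%:R * s.
Proof.
move=> h; apply: le_trans (vnorm_le_sum _) _.
apply: (@le_trans _ _ (\sum_(j < n) 4 * s)).
  by apply: ler_sum => j _; apply: knorm_coords_le => l; exact: (h (j, l)).
by rewrite sumr_const card_ord -[leLHS]mulr_natl natrM mulrA [n%:R * _]mulrC.
Qed.

Lemma gauge_le_coords x s : 0 <= s -> (forall i, `|iw_coord x i| <= s ^+ wt i) ->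
  gauge (val x) <= gauge_const%:R * s.
Proof.
move=> s0 h; rewrite -(@ler_pXn2r _ 2) ?nnegrE ?gauge_ge0 ?mulr_ge0 //.
have rx := iw_re x; apply: le_trans (gauge_le rx) _.
have h1 : vnorm (val x).1 <= (4 * n)%:R * s.
  by apply: vnorm_coords_le => jl; have := h (inl jl); rewrite expr1.
have h2 : knorm (val x).2 <= 4 * s ^+ 2.
  apply: knorm_coords_le => l; case: (unliftP ord0 l) => [k ->|->].
    by rewrite lift0; exact: (h (inr k)).
  by rewrite -[_`_0]/(kRe _) rx normr0 sqr_ge0.
have -> : (gauge_const%:R * s) ^+ 2 = (((4 * n)%:R + 2) * s) ^+ 2 by rewrite /gauge_const natrD.
have h3 : vnorm (val x).1 ^+ 2 <= ((4 * n)%:R * s) ^+ 2.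
  by rewrite ler_pXn2r ?nnegrE ?vnorm_ge0 ?mulr_ge0.
apply: le_trans (lerD h3 h2) _.
have -> : (((4 * n)%:R + 2) * s) ^+ 2 = ((4 * n)%:R * s) ^+ 2 + 4 * s ^+ 2 + 4 * (4 * n)%:R * s ^+ 2 by ring.
by rewrite lerDl !mulr_ge0.
Qed.

Lemma tw_same (p p' : X) x x' l : (val p).1 = (val p').1 -> (val x).1 = (val x').1 -> tw p x l = tw p' x' l.
Proof. by rewrite /tw => -> ->. Qed.

Lemma tw_diff (p : X) x y l : tw p x l - tw p y l = (kcoords (hdot (val p).1 ((val x).1 - (val y).1)))`_l.+1.
Proof. by rewrite /tw hdotDr hdotNr kcoordsD kcoordsN. Qed.

Lemma tw_self (p : X) l : tw p p l = 0.
Proof. by rewrite /tw hdot_vnorm kcoords_real /= nth_nseq; case: ifP. Qed.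

Lemma tw_diff_le (p : X) x y s l : (forall jl, `|iw_coord x (inl jl) - iw_coord y (inl jl)| <= s) ->
  `|tw p x l - tw p y l| <= vnorm (val p).1 * ((4 * n)%:R * s).
Proof.
move=> h; rewrite tw_diff; apply: le_trans (kcoords_le _ _) _.
apply: le_trans (hdot_le _ _) _; rewrite ler_wpM2l ?vnorm_ge0 //.
have -> : (val x).1 - (val y).1 = (val (ldiv y x)).1 by rewrite /= addrC.
by apply: vnorm_coords_le => jl; rewrite ldivE subr0.
Qed.

Section Points.
Variable e : R.
Hypothesis e0 : 0 < e.
Implicit Types (p : {ffun I -> int}).

Definition grid (p : {ffun I -> int}) : X := mk (fun i => e ^+ wt i * (p i)%:~R).

Lemma gridE p i : iw_coord (grid p) i = e ^+ wt i * (p i)%:~R.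
Proof. exact: mkE. Qed.

Definition gh (p : {ffun I -> int}) := (p : I -> int) \o inl.

Lemma grid_horizontal p p' : gh p = gh p' -> (val (grid p)).1 = (val (grid p')).1.
Proof.
move=> h; apply: horizontal_eq => jl; rewrite !gridE.
by rewrite (congr1 (fun f => f jl) h : p (inl jl) = p' (inl jl)).
Qed.

(* The grid points at distance O(j e) of y are those whose i-th index is
   O(j ^ wt i)-close to the following real, in which the twist of the group law
   makes the vertical coordinates depend on the horizontal ones. *)
Definition grid_center y p i : R := (iw_coord y i - twist (grid p) y i) / e ^+ wt i.

Lemma grid_center_eq y p p' i : gh p = gh p' -> grid_center y p i = grid_center y p' i.
Proof.
move=> /grid_horizontal h; rewrite /grid_center; congr ((_ - _) / _).
by case: i => //= l; rewrite (tw_same l h erefl).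
Qed.

Lemma grid_center_inl y p jl : grid_center y p (inl jl) = iw_coord y (inl jl) / e.
Proof. by rewrite /grid_center subr0. Qed.

Lemma grid_centerE y p i : iw_coord (ldiv (grid p) y) i = e ^+ wt i * (grid_center y p i - (p i)%:~R).
Proof.
rewrite ldivE gridE mulrBr /grid_center [e ^+ _ * (_ / _)]mulrC divfK ?expf_neq0 ?gt_eqF //.
by rewrite addrAC.
Qed.

Lemma grid_near y p s : 0 <= s -> (forall i, `|grid_center y p i - (p i)%:~R| <= s ^+ wt i) ->
  D (Some (grid p)) (Some y) <= gauge_const%:R * (e * s).
Proof.
move=> s0 h; rewrite ldiv_gauge; apply: gauge_le_coords; first by rewrite mulr_ge0 // ltW.
move=> i; rewrite grid_centerE normrM ger0_norm ?exprn_ge0 ?(ltW e0) // exprMn.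
by rewrite ler_wpM2l // exprn_ge0 // ltW.
Qed.

Lemma near_grid y p s : D (Some (grid p)) (Some y) <= e * s ->
  forall i, `|grid_center y p i - (p i)%:~R| <= s ^+ wt i.
Proof.
rewrite ldiv_gauge => h i; have := coord_le_gauge (ldiv (grid p) y) i.
have ew : 0 < e ^+ wt i by rewrite exprn_gt0.
rewrite grid_centerE normrM (ger0_norm (ltW ew)) => h2.
rewrite -(ler_pM2l ew) -exprMn; apply: le_trans h2 _.
by rewrite lerXn2r ?nnegrE ?gauge_ge0 //; exact: le_trans (gauge_ge0 _) h.
Qed.

(* The horizontal indices are chosen first, then the vertical ones. *)
Definition of_offset y (k : I -> int) : {ffun I -> int} :=
  let p0 : {ffun I -> int} := [ffun i => Num.floor (iw_coord y i / e) - k i] in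
  [ffun i => Num.floor (grid_center y p0 i) - k i].

Lemma of_offsetE y k i : of_offset y k i = Num.floor (grid_center y (of_offset y k) i) - k i.
Proof.
rewrite {1}/of_offset ffunE; congr (Num.floor _ - _); apply: grid_center_eq.
by apply/funext => jl; rewrite /gh /= !ffunE grid_center_inl.
Qed.

Lemma of_offset_inj y k k' : of_offset y k = of_offset y k' -> k =1 k'.
Proof.
move=> h i; have := of_offsetE y k i; rewrite h of_offsetE.
by move/addrI/oppr_inj.
Qed.

Lemma of_offset_close y k i : 0 <= k i ->
  0 <= grid_center y (of_offset y k) i - (of_offset y k i)%:~R <= (k i + 1)%:~R.
Proof.
move=> k0; rewrite of_offsetE; set t := grid_center _ _ _.
have /andP[f1 f2] := floor_itv t; rewrite intrB.
have k0' : 0 <= (k i)%:~R :> R by rewrite ler0z.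
rewrite intrD mulr1z in f2; rewrite (_ : (k i + 1)%:~R = (k i)%:~R + 1 :> R) ?intrD //; move: (Num.floor t)%:~R (k i)%:~R f1 f2 k0' => a b f1 f2 k0'.
clearbody t; clear -f1 f2 k0'; apply/andP; split; lra.
Qed.

Definition offsets (m : nat) (b : I -> nat) : {set {ffun I -> 'I_m}} :=
  [set k : {ffun I -> 'I_m} | [forall i, (k i < b i)%N]].

Lemma card_offsets m b : (forall i, (b i <= m)%N) -> #|offsets m b| = (\prod_i b i)%N.
Proof.
move=> bm.
have -> : #|offsets m b| = #|family (fun i => [pred x : 'I_m | (x < b i)%N])|.
  by apply: eq_card => k; rewrite inE; apply/forallP/familyP => h i; have := h i; rewrite inE.
rewrite card_family foldrE big_map big_enum /=; apply: eq_bigr => i _.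
rewrite -sum1_card (eq_bigl (fun x : 'I_m => (x < b i)%N)) //.
rewrite -(big_ord_widen_cond _ (fun=> true) (fun=> 1%N) (bm i)) /=.
by rewrite sum1_card card_ord.
Qed.

Lemma offset_points y (m : nat) (b : I -> nat) : (forall i, (b i <= m)%N) ->
  exists s : seq {ffun I -> int}, [/\ uniq s, size s = (\prod_i b i)%N &
   forall p, p \in s -> forall i, `|grid_center y p i - (p i)%:~R| <= (b i)%:R].
Proof.
move=> bm; pose f (k : {ffun I -> 'I_m}) := of_offset y (fun i => (k i)%:Z).
have fi : injective f.
  by move=> k k' /of_offset_inj h; apply/ffunP => i; apply: val_inj; have [] := h i.
exists (map f (enum (offsets m b))); split.
- by rewrite map_inj_uniq ?enum_uniq.
- by rewrite size_map -cardE card_offsets.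
- move=> p /mapP[k]; rewrite mem_enum inE => /forallP kb -> i.
  have := @of_offset_close y (fun i => (k i)%:Z) i isT; rewrite -/(f k) => /andP[h1 h2].
  rewrite ger0_norm //; apply: le_trans h2 _.
  rewrite (_ : (k i)%:Z + 1 = (k i).+1%:Z); last by rewrite -addn1 PoszD.
  by rewrite -pmulrn ler_nat.
Qed.

(** The offsets from the centres determine the grid point: horizontal centres do not depend on the
    point, and vertical centres depend only on its horizontal indices. *)
Lemma offset_count y (m : nat) (b : I -> nat) (a : I -> int) (s : seq {ffun I -> int})  :
  (forall i, (b i <= m)%N) -> uniq s ->
  (forall p, p \in s -> forall i, 0 <= p i - (Num.floor (grid_center y p i) + a i) < (b i)%:Z) ->
  (size s <= \prod_i b i)%N.
Proof.
move=> bm us h.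
(* For m = 0 a member of [s] would need 0 < b i <= 0 at each index, so there is no index at all and
   [s] has at most one member. *)
case: m bm => [|m] bm.
  have [->|[p ps]] : s = [::] \/ exists p, p \in s by case: s {us h} => [|p s]; [left|right; exists p; rewrite mem_head].
    by [].
  have I0 i : False.
    have /andP[h1 h2] := h p ps i; have := bm i; rewrite leqn0 => /eqP b0.
    by have := le_lt_trans h1 h2; rewrite b0.
  have -> : (\prod_i b i = 1)%N by rewrite big1 // => i; case: (I0 i).
  case: s us ps {h} => [|q [|q' s]] // /andP[+ _] _; rewrite inE negb_or => /andP[/eqP + _].
  by case; apply/ffunP => i; case: (I0 i).
pose d (p : {ffun I -> int}) i := p i - (Num.floor (grid_center y p i) + a i).
have dn p i : p \in s -> (`|d p i|%N)%:Z = d p i /\ (`|d p i|%N < b i)%N.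
  move=> ps; have /andP[l1 u1] := h p ps i; have e1 := gez0_abs l1; split=> //.
  by rewrite -ltz_nat e1.
pose f (p : {ffun I -> int}) : {ffun I -> 'I_m.+1} := [ffun i => inord `|d p i|%N].
have fE p i : p \in s -> (f p i : nat) = `|d p i|%N.
  by move=> ps; rewrite ffunE inordK //; exact: leq_trans (dn p i ps).2 (bm i).
rewrite -(card_offsets bm) -(size_map f) cardE; apply: uniq_leq_size.
  rewrite map_inj_in_uniq // => p p' ps p's ff.
  have key i : grid_center y p i = grid_center y p' i -> p i = p' i.
    move=> e1; have := fE p i ps; rewrite ff fE // => /(congr1 Posz).
    by rewrite (dn p i ps).1 (dn p' i p's).1 /d e1 => /addIr.
  apply/ffunP => i; apply: (key); apply: grid_center_eq; apply/funext => jl.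
  by apply: key; rewrite !grid_center_inl.
move=> k /mapP[p ps ->]; rewrite mem_enum inE; apply/forallP => i.
by rewrite fE //; exact: (dn p i ps).2.
Qed.
End Points.
End Grid.

Lemma bounded_list (T : eqType) (P : T -> Prop) (B : nat) :
  (forall s : seq T, uniq s -> (forall p, p \in s -> P p) -> (size s <= B)%N) ->
  exists2 s : seq T, uniq s & forall p, p \in s <-> P p.
Proof.
move=> h; apply: contrapT => no.
have ext k : exists s : seq T, [/\ uniq s, forall p, p \in s -> P p & size s = k].
  elim: k => [|k [s [us sP sk]]]; first by exists [::].
  have [p [pP ps]] : exists p, P p /\ p \notin s.
    apply: contrapT => np; apply: no; exists s => // p; split; first exact: sP.
    by move=> pP; apply: contrapT => /negP ps; apply: np; exists p.
  exists (p :: s); split=> /=; [by rewrite ps| |by rewrite sk].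
  by move=> q; rewrite inE => /orP[/eqP ->|/sP].
have [s [us sP sk]] := ext B.+1.
by have := h s us sP; rewrite sk ltnn.
Qed.

(** Count the pairs (p, q) with q in H p: there are m1 for each p, and at most m2 for each q, which
    lies in S but not in S'. *)
Lemma double_count (T : eqType) (S S' : seq T) (H : T -> seq T) (m1 m2 : nat) :
  uniq S -> uniq S' -> {subset S' <= S} ->
  (forall p, p \in S -> [/\ uniq (H p), size (H p) = m1 &
     forall q, q \in H p -> q \in S /\ q \notin S']) ->
  (forall q, q \in S -> (size [seq p <- S | q \in H p] <= m2)%N) ->
  (size S * m1 + m2 * size S' <= m2 * size S)%N.
Proof.
move=> uS uS' S'S HP Hm.
pose F := [seq q <- S | q \notin S'].
have sF : (size F + size S' = size S)%N.
  have e : size S' = count [in S'] S.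
    rewrite -size_filter; apply/eqP; rewrite -(perm_size (s1 := S')) //.
    apply: uniq_perm => // [|x]; first exact: filter_uniq.
    by rewrite mem_filter andb_idr //; exact: S'S.
  by rewrite /F size_filter e addnC (count_predC [in S']).
have cE (a : pred T) (r : seq T) : count a r = (\sum_(x <- r) a x)%N.
  by rewrite -sum1_count big_mkcond; apply: eq_bigr => x _; case: (a x).
have uF : uniq F by exact: filter_uniq.
rewrite -{2}sF mulnDr leq_add2r.
have -> : (size S * m1 = \sum_(p <- S) \sum_(q <- F) (q \in H p))%N.
  rewrite -sum1_size big_distrl /= big_seq [RHS]big_seq; apply: eq_bigr => p /HP [uH <- HS].
  rewrite mul1n -(cE [in H p]) -size_filter; apply/eqP; rewrite -(perm_size (s1 := H p)) //.
  apply: uniq_perm => // [|x]; first exact: filter_uniq.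
  by rewrite !mem_filter andb_idr // => /HS [-> ->].
rewrite exchange_big /= mulnC -sum1_size big_distrl /= big_seq [leqRHS]big_seq.
apply: leq_sum => q; rewrite mem_filter => /andP[_ qS].
rewrite mul1n; apply: leq_trans (Hm q qS).
by rewrite size_filter (cE (fun p => q \in H p)).
Qed.

Lemma porous_sum1 (R : realFieldType) (a b c s : R) : c <= 1 -> 0 <= s ->
  a <= c * s / 4 -> b <= s / 2 -> a + b <= s.
Proof.
move=> c1 s0 ha hb; have : c * s <= 1 * s by rewrite ler_wpM2r.
rewrite mul1r; move: (c * s) ha => t ha ht; lra.
Qed.

Lemma porous_sum2 (R : realFieldType) (a b c s : R) : 0 < c * s ->
  a <= c * s / 8 -> b <= c * s / 4 -> b + a < c * (s / 2).
Proof. by rewrite mulrA; move: (c * s) => t *; lra. Qed.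

(** * Porous sets are null *)

Section Porous.
Variables (R : realType) (kk : scalar_kind) (n : nat).
Local Notation X := (iwasawa R kk n).
Local Notation D := (@bdist R kk n).
Local Notation o0 := (Some (iw0 R kk n)).
Local Notation I := (iw_index kk n).
Local Notation Q := (hdim kk n).
Local Notation G := {ffun I -> int}.
Local Notation gauge_const := (gauge_const n).
Implicit Types (x y : X) (e s : R) (p q : G).

Lemma prod_wt (j : nat) : (\prod_(i : I) j ^ wt i = j ^ Q)%N.
Proof. by rewrite /hdim expn_sum. Qed.

Lemma grid_lower e y (j : nat) : 0 < e -> (0 < j)%N -> exists s : seq G,
  [/\ uniq s, size s = (j ^ Q)%N & forall p, p \in s -> D (Some (grid e p)) (Some y) <= gauge_const%:R * (e * j%:R)].
Proof.
move=> e0 j0; have [|s [us ss sP]] := @offset_points R kk n e y (j ^ 2) (fun i : I => j ^ wt i)%N.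
  by move=> [i|i] //=; rewrite leq_pexp2l.
exists s; split=> //; first by rewrite ss prod_wt.
by move=> p /sP h; apply: grid_near => // i; apply: le_trans (h i) _; rewrite natrX.
Qed.

(** In each direction the indices differ from a fixed real by at most j ^ [wt i], so they take at
    most 2 j ^ [wt i] + 1 values; hence the 3. *)
Lemma grid_upper e y (j : nat) (s : seq G) : 0 < e -> (0 < j)%N -> uniq s ->
  (forall p, p \in s -> D (Some (grid e p)) (Some y) <= e * j%:R) ->
  (size s <= 3 ^ #|{: I}| * j ^ Q)%N.
Proof.
move=> e0 j0 us h.
have -> : (3 ^ #|{: I}| * j ^ Q = \prod_(i : I) (3 * j ^ wt i))%N.
  by rewrite big_split /= prod_wt prod_nat_const.
apply: (@offset_count R kk n e y (3 * j ^ 2) _ (fun i => - (j ^ wt i)%:Z)) => // [[i|i]|p ps i].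
- by rewrite leq_mul2l /= leq_pexp2l.
- by [].
have := near_grid e0 (h p ps) i; set t := grid_center e y p i.
have /andP[f1 f2] := floor_itv t.
rewrite ler_norml => /andP[h1 h2].
have jw : (1 <= j ^ wt i)%N by rewrite expn_gt0 j0.
have jR : j%:R ^+ wt i = (j ^ wt i)%:Z%:~R :> R by rewrite -natrX pmulrn.
rewrite jR in h1 h2; move: (j ^ wt i)%N jw h1 h2 => w w1 h1 h2.
apply/andP; split.
  rewrite subr_ge0 -(ler_int R) intrD mulrNz; lra.
rewrite ltrBlDr -(ltr_int R) !intrD mulrNz PoszM intrM.
have w1' : 1 <= w%:Z%:~R :> R by rewrite -pmulrn ler1n.
rewrite intrD mulr1z in f2.
move: (Num.floor t)%:~R (p i)%:~R w%:Z%:~R f1 f2 h1 h2 w1' => a b c f1 f2 h1 h2 c1.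
clearbody t; clear -f1 f2 h1 h2 c1; lra.
Qed.

Definition ball_cell (c : X * R) : set X := [set x | D (Some c.1) (Some x) <= c.2].
Definition ball_cost (c : X * R) : R := `|c.2| ^+ Q.

Lemma ball_cost_ge0 c : 0 <= ball_cost c.
Proof. by rewrite exprn_ge0. Qed.

Hypothesis hn : (1 <= n)%N.

Lemma hdim_gt0 : (0 < Q)%N.
Proof.
by rewrite /hdim (bigD1 (inl (Ordinal hn, ord0) : I)).
Qed.

Lemma ball_cost0 : ball_cost (iw0 R kk n, 0) = 0.
Proof. by rewrite /ball_cost normr0 expr0n gtn_eqF // hdim_gt0. Qed.

Local Notation cnull := (cover_null ball_cell ball_cost).

Definition porous (E : set X) (c s0 : R) := forall x, E x -> forall s, 0 < s -> s <= s0 ->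
  exists q : X, D (Some x) (Some q) <= s /\ forall y, E y -> c * s <= D (Some q) (Some y).

Section PorousNull.
Variables (E : set X) (c s0 : R) (b : nat).
Hypotheses (c_gt0 : 0 < c) (c1 : c <= 1) (s0_gt0 : 0 < s0) (s01 : s0 <= 1).
Hypotheses (Eb : forall x, E x -> D (Some x) o0 <= 1) (Ep : porous E c s0).
Hypotheses (b4 : 4 * gauge_const%:R <= c * b%:R) (b8 : 8 <= c * b%:R) (bg : gauge_const%:R <= b%:R :> R) (b1 : (1 <= b)%N).

Definition near_list e s (S : seq G) := uniq S /\
  forall p, p \in S <-> exists2 x, E x & D (Some (grid e p)) (Some x) <= s.

Lemma near_list_ex e s : 0 < e -> 0 < s -> s <= 1 -> exists2 S, near_list e s S &
  (size S <= 3 ^ #|{: I}| * (Num.truncn (2 / e)).+1 ^ Q)%N.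
Proof.
move=> e0 s_gt0 s1.
have hb (S : seq G) : uniq S -> (forall p, p \in S -> exists2 x, E x & D (Some (grid e p)) (Some x) <= s) ->
    (size S <= 3 ^ #|{: I}| * (Num.truncn (2 / e)).+1 ^ Q)%N.
  move=> uS SP; apply: (grid_upper (y := iw0 R kk n) e0 _ uS) => // p /SP [x /Eb x1 px].
  apply: le_trans (bdist_triangle _ x _) _; apply: le_trans (lerD px x1) _.
  rewrite mulrC -ler_pdivrMr //.
  apply: (@le_trans _ _ (2 / e)); last exact/ltW/truncnS_gt.
  by rewrite ler_pM2r ?invr_gt0 // -[2]/(1 + 1) lerD2r.
have [S uS SP] := bounded_list hb.
by exists S; [split|apply: hb => // p /SP].
Qed.

(* The holes remove a fixed proportion of the grid points at each scale. *)
Lemma near_list_step e (j : nat) S S' : 0 < e -> (0 < j)%N -> e * (b * j)%:R <= s0 ->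
  near_list e (e * (b * j)%:R) S -> near_list e (e * j%:R) S' ->
  (size S + 3 ^ #|{: I}| * (2 * b) ^ Q * size S' <= 3 ^ #|{: I}| * (2 * b) ^ Q * size S)%N.
Proof.
move=> e0 j0 es0 [uS SP] [uS' S'P].
set s := e * (b * j)%:R in es0 SP.
have jR : 0 < j%:R :> R by rewrite ltr0n.
have bR : 0 < b%:R :> R by rewrite ltr0n.
have s_gt0 : 0 < s by rewrite mulr_gt0 // natrM mulr_gt0.
have ej : e * j%:R = s / b%:R by rewrite /s natrM; field; rewrite gt_eqF.
have ejs : e * j%:R <= s by rewrite ej ler_pdivrMr // ler_peMr ?(ltW s_gt0) // ler1n.
have hole p : p \in S -> exists H : seq G, [/\ uniq H, size H = (j ^ Q)%N &
    forall q, q \in H -> [/\ q \in S, q \notin S' & D (Some (grid e p)) (Some (grid e q)) <= e * (2 * b * j)%:R]].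
  move=> /SP [x Ex px].
  (* The hole is taken at scale s / 2, so that the grid points within c s / 4 of its centre are
     still within s of x, yet farther than s / b from E. *)
  have s2 : 0 < s / 2 by rewrite divr_gt0.
  have s20 : s / 2 <= s0 by apply: le_trans es0; rewrite ler_pdivrMr // ler_peMr ?(ltW s_gt0) // ler1n.
  have [q [xq qE]] := Ep Ex s2 s20.
  have [H [uH sH HP]] := grid_lower q e0 j0.
  exists H; split=> // g /HP gq.
  have gq4 : D (Some (grid e g)) (Some q) <= c * s / 4.
    apply: le_trans gq _; rewrite ej mulrA ler_pdivrMr // mulrC.
    have -> : c * s / 4 * b%:R = s * (c * b%:R / 4) by ring.
    by rewrite ler_pM2l // ler_pdivlMr // mulrC.
  have cs0 : 0 <= c * s by rewrite mulr_ge0 // ltW.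
  have csb : s / b%:R <= c * s / 8.
    rewrite ler_pdivrMr //; have -> : c * s / 8 * b%:R = s * (c * b%:R / 8) by ring.
    by rewrite ler_peMr ?(ltW s_gt0) // ler_pdivlMr // mul1r.
  have gx : D (Some (grid e g)) (Some x) <= s.
    apply: le_trans (bdist_triangle _ q _) _; rewrite [D (Some q) _]bdist_sym.
    by move: gq4 xq; exact: porous_sum1 c1 (ltW s_gt0).
  split.
  - by apply/SP; exists x.
  - apply/negP => /S'P [y Ey]; rewrite ej => gy.
    have := qE y Ey; apply/negP; rewrite -ltNge.
    apply: le_lt_trans (bdist_triangle _ (grid e g) _) _; rewrite [D (Some q) _]bdist_sym.
    by move: (le_trans gy csb) gq4; apply: porous_sum2; rewrite mulr_gt0.
  - apply: le_trans (bdist_triangle _ x _) _; rewrite [D (Some x) _]bdist_sym.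
    by apply: le_trans (lerD px gx) _; rewrite /s -mulnA natrM; rewrite le_eqVlt; apply/orP; left; apply/eqP; ring.
pose H p := if pselect (p \in S) is left h then sval (cid (hole p h)) else [::].
have HP p : p \in S -> [/\ uniq (H p), size (H p) = (j ^ Q)%N &
    forall q, q \in H p -> [/\ q \in S, q \notin S' & D (Some (grid e p)) (Some (grid e q)) <= e * (2 * b * j)%:R]].
  by rewrite /H; case: pselect => // h _; case: cid.
have bj0 : (0 < 2 * b * j)%N by rewrite !muln_gt0 j0 b1.
set C := (3 ^ #|{: I}| * (2 * b) ^ Q)%N.
have m2E : (3 ^ #|{: I}| * (2 * b * j) ^ Q = C * j ^ Q)%N by rewrite expnMn mulnA.
rewrite -(@leq_pmul2r (j ^ Q)) ?expn_gt0 ?j0 // mulnDl.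
rewrite (mulnAC C (size S')) (mulnAC C (size S)) -m2E.
apply: (double_count (H := H) uS uS') => [p /S'P [x Ex px]|p /HP [uH sH h]|q qS].
- by apply/SP; exists x => //; exact: le_trans ejs.
- by split=> // q /h [].
- apply: (grid_upper (y := grid e q) e0 bj0); first exact: filter_uniq.
  by move=> p; rewrite mem_filter => /andP[qH pS]; have [_ _ h] := HP p pS; have [] := h q qH.
Qed.

(** With mesh e = s0 / b^(J+1), the list at scale e b has at most lam^J times the size of that at
    scale s0, which is at most 3^|I| (3 / e)^Q. Balls of radius e b about its points then cost at
    most lam^J B, with B independent of J. *)
Lemma porous_covered : cnull E.
Proof.
move=> eta eta0.
have bR1 : 1 <= b%:R :> R by rewrite ler1n.
have bR : 0 < b%:R :> R by rewrite ltr0n.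
pose C : nat := (3 ^ #|{: I}| * (2 * b) ^ Q)%N.
have C0 : (0 < C)%N by rewrite muln_gt0 !expn_gt0 /= muln_gt0 b1.
have CR : 0 < C%:R :> R by rewrite ltr0n.
pose lam : R := 1 - C%:R^-1.
have lam1 : lam < 1 by rewrite ltrBlDr ltrDl invr_gt0.
have lam0 : 0 <= lam by rewrite subr_ge0 invf_le1 // ler1n.
pose B : R := (3 ^ #|{: I}|)%:R * (3 * b%:R) ^+ Q.
have B0 : 0 < B by rewrite mulr_gt0 ?exprn_gt0 ?mulr_gt0 // ltr0n expn_gt0.
have [|J hJ] := @exp_small R lam (eta / B) lam0 lam1; first by rewrite divr_gt0.
pose e := s0 / b%:R ^+ J.+1.
have e0 : 0 < e by rewrite divr_gt0 // exprn_gt0.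
have ebJ : e * b%:R ^+ J.+1 = s0 by rewrite divfK // gt_eqF // exprn_gt0.
have e1 : e <= 1.
  apply: le_trans s01; rewrite /e ler_pdivrMr ?exprn_gt0 // ler_peMr ?(ltW s0_gt0) //.
  by rewrite expr_ge1 // ltW.
clearbody e.
have sc k : (k <= J.+1)%N -> 0 < e * (b ^ k)%:R /\ e * (b ^ k)%:R <= s0.
  move=> kJ; split; first by rewrite mulr_gt0 // ltr0n expn_gt0 b1.
  by rewrite -[leRHS]ebJ natrX ler_wpM2l ?(ltW e0) // ler_weXn2l.
have ex k : {S : seq G | (k <= J.+1)%N -> near_list e (e * (b ^ k)%:R) S /\
    (size S <= 3 ^ #|{: I}| * (Num.truncn (2 / e)).+1 ^ Q)%N}.
  apply: cid; have [kJ|kJ] := leqP k J.+1; last by exists [::].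
  have [p1 p2] := sc k kJ.
  by have [S h1 h2] := near_list_ex e0 p1 (le_trans p2 s01); exists S.
pose S k := sval (ex k).
have SP k : (k <= J.+1)%N -> near_list e (e * (b ^ k)%:R) (S k) by rewrite /S; case: (ex k) => ? h /h [].
have dec k : (k <= J)%N -> (size (S k))%:R <= lam * (size (S k.+1))%:R.
  move=> kJ.
  have := @near_list_step e (b ^ k) (S k.+1) (S k) e0; rewrite expn_gt0 b1 -expnS => /(_ isT).
  move=> /(_ (proj2 (sc k.+1 kJ)) (SP k.+1 kJ) (SP k (leqW kJ))); rewrite -/C.
  rewrite -(ler_nat R) natrD !(natrM _ C) => h.
  rewrite -(ler_pM2l CR) mulrA /lam mulrBr mulr1 mulfV ?gt_eqF // mulrBl mul1r.
  by rewrite lerBrDr addrC.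
have dec2 k : (k <= J)%N -> (size (S 1%N))%:R <= lam ^+ k * (size (S k.+1))%:R.
  elim: k => [|k IH] kJ; first by rewrite expr0 mul1r.
  apply: le_trans (IH (ltnW kJ)) _; rewrite exprSr -mulrA ler_wpM2l ?exprn_ge0 //; exact: dec.
have top : (size (S J.+1))%:R <= (3 ^ #|{: I}|)%:R * (3 / e) ^+ Q.
  have : (size (S J.+1) <= 3 ^ #|{: I}| * (Num.truncn (2 / e)).+1 ^ Q)%N.
    by rewrite /S; case: (ex J.+1) => ? h; have [] := h (leqnn _).
  rewrite -(ler_nat R) natrM [X in _ <= _ * X]natrX => h; apply: le_trans h _.
  rewrite ler_wpM2l // lerXn2r ?nnegrE ?divr_ge0 ?(ltW e0) // -natr1.
  have -> : 3 / e = 2 / e + 1 / e by rewrite -mulrDl; congr (_ / _); ring.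
  apply: lerD; first by rewrite truncn_le divr_ge0 // ltW.
  by rewrite ler_pdivlMr // mul1r.
have eb : e * (b ^ 1)%:R = e * b%:R by rewrite expn1.
apply: (@covered_seq _ _ _ ball_cell ball_cost (iw0 R kk n, 0) ball_cost_ge0 ball_cost0 _
  [seq (grid e p, e * b%:R) | p <- S 1%N]).
  (* The list S 1 is used and not S 0, because a point has a grid point within [gauge_const] e only,
     which is at most b e. *)
  move=> x Ex; have [s [us ss sP]] := grid_lower x e0 (ltn0Sn 0).
  have [p ps] : exists p, p \in s.
    by case: s us ss sP => [|p s] _; rewrite exp1n // => _ _; exists p; rewrite mem_head.
  have px : D (Some (grid e p)) (Some x) <= e * b%:R.
    by apply: le_trans (sP p ps) _; rewrite mulr1 mulrC ler_wpM2l // ltW.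
  have pS : p \in S 1%N by apply/(proj2 (SP 1%N _)) => //; exists x => //; rewrite eb.
  exists (index p (S 1%N)); rewrite size_map index_mem; split=> //.
  by rewrite (nth_map p) ?index_mem // nth_index.
rewrite big_map (eq_bigr (fun=> (e * b%:R) ^+ Q)); last first.
  by move=> p _; rewrite /ball_cost /= ger0_norm // mulr_ge0 // ltW.
rewrite big_const_seq count_predT iter_addr_0 -[leLHS]mulr_natl.
have ebQ : 0 <= (e * b%:R) ^+ Q by rewrite exprn_ge0 // mulr_ge0 // ltW.
apply: le_trans (ler_wpM2r ebQ (dec2 J (leqnn J))) _.
apply: (@le_trans _ _ (lam ^+ J * ((3 ^ #|{: I}|)%:R * (3 / e) ^+ Q) * (e * b%:R) ^+ Q)).
  by rewrite ler_wpM2r // ler_wpM2l // exprn_ge0.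
have -> : lam ^+ J * ((3 ^ #|{: I}|)%:R * (3 / e) ^+ Q) * (e * b%:R) ^+ Q = lam ^+ J * B.
  rewrite -!mulrA -exprMn /B; congr (_ * (_ * _ ^+ _)).
  by field; rewrite gt_eqF.
by rewrite -ler_pdivlMr // ltW.
Qed.
End PorousNull.

Lemma porous_null (E : set X) c s0 : 0 < c -> 0 < s0 -> (forall x, E x -> D (Some x) o0 <= 1) ->
  porous E c s0 -> cnull E.
Proof.
move=> c0 s00 Eb Ep.
pose c' := Num.min c 1; pose s' := Num.min s0 1.
have c'0 : 0 < c' by rewrite lt_min c0 ltr01.
have s'0 : 0 < s' by rewrite lt_min s00 ltr01.
pose t := (4 * gauge_const%:R + 8) / c' + gauge_const%:R + 1.
have t0 : 0 <= (4 * gauge_const%:R + 8) / c' by rewrite divr_ge0 ?(ltW c'0) // addr_ge0 // mulr_ge0.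
pose b := (Num.truncn t).+1.
have tb : t < b%:R by exact: truncnS_gt.
have b48 : 4 * gauge_const%:R + 8 <= c' * b%:R.
  rewrite [c' * _]mulrC -ler_pdivrMr //; apply: le_trans (ltW tb); rewrite /t -addrA lerDl.
  by rewrite addr_ge0.
apply: (@porous_covered E c' s' b) => //.
- by rewrite ge_min lexx orbT.
- by rewrite ge_min lexx orbT.
- move=> x Ex s s_gt0; rewrite le_min => /andP[ss0 s1].
  have [q [xq h]] := Ep x Ex s s_gt0 ss0; exists q; split=> // y /h hy.
  by apply: le_trans hy; rewrite ler_wpM2r ?(ltW s_gt0) // ge_min lexx.
- by apply: le_trans b48; rewrite lerDl.
- by apply: le_trans b48; rewrite lerDr mulr_ge0.
- by apply: le_trans (ltW tb); rewrite /t -addrA addrC -addrA lerDl addr_ge0.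
Qed.
End Porous.

Lemma prod_perturb (R : realFieldType) (T : finType) (l : T -> R) : (forall i, 0 <= l i) ->
  exists2 C : R, 0 <= C & forall t, 0 <= t -> t <= 1 ->
    \prod_i (l i + t) <= \prod_i l i + C * t.
Proof.
move=> l0.
have pl (r : seq T) : 0 <= \prod_(i <- r) l i by apply: prodr_ge0.
suff [C C0 h] : exists2 C : R, 0 <= C & forall t, 0 <= t -> t <= 1 ->
    \prod_(i <- index_enum T) (l i + t) <= \prod_(i <- index_enum T) l i + C * t.
  by exists C.
elim: (index_enum T) => [|i r [C C0 IH]].
  by exists 0 => // t _ _; rewrite !big_nil mul0r addr0.
exists (l i * C + \prod_(i <- r) l i + C).
  by rewrite !addr_ge0 ?mulr_ge0.
move=> t t0 t1; rewrite !big_cons.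
apply: (@le_trans _ _ ((l i + t) * (\prod_(i <- r) l i + C * t))).
  by rewrite ler_wpM2l ?addr_ge0 // IH.
set P := \prod_(i <- r) l i.
have -> : (l i + t) * (P + C * t) = l i * P + (l i * C + P + C * t) * t by ring.
rewrite lerD2l ler_wpM2r // lerD2l -[leRHS]mulr1 ler_wpM2l //.
Qed.

Lemma box_slab (R : realFieldType) (V S t1 t2 xi yi : R) : 2 * V <= S ->
  `|t1 - t2| <= V -> `|xi - yi - 2 * t1| <= S ->
  yi + 2 * t2 - 2 * S <= xi <= yi + 2 * t2 - 2 * S + 4 * S.
Proof.
rewrite !ler_norml => VS /andP[h1 h2] /andP[h3 h4]; apply/andP; split; lra.
Qed.

Lemma abs_in_box (R : realFieldType) (a l x : R) : a <= x -> x <= a + `|l| -> `|x| <= `|a| + `|l|.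
Proof.
move=> h1 h2; have := ler_norm a; have := ler_norm (- a); rewrite normrN ler_norml.
have := normr_ge0 l; move: `|a| `|l| h2 => A L *; apply/andP; split; lra.
Qed.

Lemma box_index (R : realFieldType) (a l x w v E p : R) : 0 < E -> a <= x -> x <= a + l ->
  `|w| <= v -> `|(x - w) / E - p| <= 1 ->
  (a - v) / E - 1 <= p <= (a + l + v) / E + 1.
Proof.
move=> E0 h1 h2; rewrite !ler_norml => /andP[w1 w2] /andP[p1 p2].
have t1 : (a - v) / E <= (x - w) / E by rewrite ler_pM2r ?invr_gt0 //; lra.
have t2 : (x - w) / E <= (a + l + v) / E by rewrite ler_pM2r ?invr_gt0 //; lra.
move: (_ / E) (_ / E) ((x - w) / E) t1 t2 p1 p2 => A B C *; apply/andP; split; lra.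
Qed.

(** * Coordinate boxes against Cygan balls *)

Section BoxBall.
Variables (R : realType) (kk : scalar_kind) (n : nat).
Local Notation X := (iwasawa R kk n).
Local Notation D := (@bdist R kk n).
Local Notation o0 := (Some (iw0 R kk n)).
Local Notation I := (iw_index kk n).
Local Notation Ih := ('I_n * 'I_(imdim kk).+1)%type.
Local Notation Iv := ('I_(imdim kk)).
Local Notation Q := (hdim kk n).
Local Notation G := {ffun I -> int}.
Local Notation gauge_const := (gauge_const n).
Hypothesis hn : (1 <= n)%N.

Definition box_cell (c : (I -> R) * (I -> R)) : set X := box c.1 (fun i => c.1 i + `|c.2 i|).
Definition box_cost (c : (I -> R) * (I -> R)) : R := \prod_i `|c.2 i|.
Definition box0 : (I -> R) * (I -> R) := (fun=> 0, fun=> 0).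

Lemma box_cost_ge0 c : 0 <= box_cost c.
Proof. by apply: prodr_ge0. Qed.

Lemma box_cost0 : box_cost box0 = 0.
Proof. by rewrite /box_cost (bigD1 (inl (Ordinal hn, ord0) : I)) //= normr0 mul0r. Qed.

Local Notation bnull := (cover_null box_cell box_cost).
Local Notation cnull := (cover_null (@ball_cell R kk n) (@ball_cost R kk n)).

Lemma leb_nullP (A : set X) : leb_null A <-> bnull A.
Proof.
rewrite /leb_null /lebesgue_outer; set S := [set v | _]; split=> [h e e0|h].
  have : (ereal_inf S < e%:E)%E by rewrite h lte_fin.
  move=> /ereal_inf_lt [v [a [b [ab Ab ->]]] ve].
  exists (fun m => (a m, fun i => b m i - a m i)); split.
    move=> x /Ab [m _ xm]; exists m => // i /=; have := xm i.
    by rewrite ger0_norm ?subr_ge0 // addrC subrK.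
  move=> N; rewrite -lee_fin; apply: le_trans (ltW ve).
  apply: le_trans (nneseries_lim_ge N _); last first.
    by move=> k _ _; rewrite lee_fin; apply: prodr_ge0 => i _; rewrite subr_ge0.
  rewrite big_mkord -sumEFin; apply: lee_sum => m _; rewrite lee_fin.
  rewrite le_eqVlt; apply/orP; left; apply/eqP; apply: eq_bigr => i _ /=.
  by rewrite ger0_norm ?subr_ge0.
apply/eqP; rewrite eq_le; apply/andP; split; last first.
  apply: le_ereal_inf_tmp => v [a [b [ab _ ->]]]; apply: nneseries_ge0 => m _ _.
  by rewrite lee_fin; apply: prodr_ge0 => i _; rewrite subr_ge0.
apply/lee_addgt0Pr => e e0; rewrite add0e.
have [F [AF Fe]] := h e e0.
apply: le_trans (_ : (\sum_(0 <= m <oo) (box_volume (F m).1 (fun i => (F m).1 i + `|(F m).2 i|))%:E <= _)%E).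
  apply: ereal_inf_lbound; exists (fun m => (F m).1), (fun m i => (F m).1 i + `|(F m).2 i|).
  by split=> // m i; rewrite lerDl.
apply: lime_le.
  apply: is_cvg_nneseries => m _ _; rewrite lee_fin; apply: prodr_ge0 => i _.
  by rewrite addrC addKr.
apply: nearW => N; rewrite big_mkord sumEFin lee_fin; apply: le_trans (Fe N).
rewrite le_eqVlt; apply/orP; left; apply/eqP; apply: eq_bigr => m _.
by apply: eq_bigr => i _; rewrite addrC addKr.
Qed.

Lemma prod_I (F : I -> R) : \prod_i F i = (\prod_(i : Ih) F (inl i)) * \prod_(i : Iv) F (inr i).
Proof. by rewrite big_sumType. Qed.

Lemma hdimE : Q = (#|{: Ih}| + 2 * #|{: Iv}|)%N.
Proof. by rewrite /hdim big_sumType /= !sum_nat_const muln1 mulnC. Qed.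

(** A ball away from the vertical axis is a sheared box. It is cut horizontally into cubes of side
    tau so small that the shear varies by at most s^2 on each, and boxes of height 4 s^2 then
    suffice. *)
Lemma ball_by_boxes (c : X * R) (e : R) : 0 < e ->
  covered box_cell box_cost (ball_cell c) (4 ^+ #|{: I}| * ball_cost c + e).
Proof.
move=> e0; case: c => y s.
have [s_gt0|s_le0] := ltP 0 s; last first.
  apply: (@covered_le _ _ _ _ _ _ 0); first by rewrite addr_ge0 ?(ltW e0) // mulr_ge0 // exprn_ge0.
  apply: (covered_seq box_cost_ge0 box_cost0 (s := [:: (iw_coord y, fun=> 0)])).
    move=> x /= h; exists 0%N; split=> // i /=.
    have -> : x = y; last by rewrite normr0 addr0 lexx.
    have /bdist_eq0 [] // : D (Some y) (Some x) = 0.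
    by apply/eqP; rewrite eq_le bdist_ge0 andbT; exact: le_trans s_le0.
  by rewrite big_seq1 /box_cost (bigD1 (inl (Ordinal hn, ord0) : I)) //= normr0 mul0r.
apply: (@covered_le _ _ _ _ _ _ (4 ^+ #|{: I}| * ball_cost (y, s))); first by rewrite lerDl ltW.
have V0 := vnorm_ge0 (val y).1.
(* The number of subdivisions that makes [Vtau] hold for tau = s / m. *)
pose m := (Num.truncn ((16 * n)%:R * vnorm (val y).1 / s)).+1.
have m0 : 0 < m%:R :> R by rewrite ltr0n.
pose tau := s / m%:R.
have tau0 : 0 < tau by rewrite divr_gt0.
have Vtau : 2 * (vnorm (val y).1 * ((4 * n)%:R * tau)) <= s ^+ 2.
  have h : (16 * n)%:R * vnorm (val y).1 / s <= m%:R by rewrite ltW // truncnS_gt.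
  rewrite ler_pdivrMr // in h.
  have -> : 2 * (vnorm (val y).1 * ((4 * n)%:R * tau)) = ((16 * n)%:R * vnorm (val y).1) * (s / (2 * m%:R)).
    by rewrite /tau !natrM; field; rewrite gt_eqF.
  rewrite mulrA ler_pdivrMr ?mulr_gt0 //.
  apply: (@le_trans _ _ (m%:R * s * s)); first by rewrite ler_pM2r.
  have -> : s ^+ 2 * (2 * m%:R) = 2 * (m%:R * s * s) by ring.
  by rewrite ler_peMl ?ler1n // !mulr_ge0 // ltW.
have s4 : 0 <= 4 * s ^+ 2 by apply: mulr_ge0 => //; exact: sqr_ge0.
pose corner (k : {ffun Ih -> 'I_(2 * m).+1}) : X :=
  mk (fun i => if i is inl jl then iw_coord y (inl jl) - s + tau * (k jl)%:R else 0).
pose bx k : (I -> R) * (I -> R) :=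
  (fun i => match i with
            | inl jl => iw_coord (corner k) (inl jl)
            | inr l => iw_coord y (inr l) + 2 * tw y (corner k) l - 2 * s ^+ 2 end,
   fun i => match i with inl _ => tau | inr _ => 4 * s ^+ 2 end).
apply: (covered_seq box_cost_ge0 box_cost0 (s := map bx (enum {: {ffun Ih -> 'I_(2 * m).+1}}))).
  move=> x /= yx.
  have hx i : `|iw_coord x i - iw_coord y i - twist y x i| <= s ^+ wt i.
    rewrite -ldivE; apply: le_trans (coord_le_gauge _ _) _.
    by rewrite lerXn2r ?nnegrE ?gauge_ge0 ?(ltW s_gt0).
  pose u jl := (iw_coord x (inl jl) - iw_coord y (inl jl) + s) / tau.
  have ub jl : 0 <= u jl /\ u jl <= (2 * m)%:R.
    have := hx (inl jl); rewrite /= subr0 expr1 ler_norml => /andP[h1 h2].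
    rewrite /u; split; first by rewrite divr_ge0 ?(ltW tau0) // -lerBlDr sub0r.
    rewrite ler_pdivrMr //.
    have -> : (2 * m)%:R * tau = 2 * s by rewrite /tau natrM; field; rewrite gt_eqF.
    by move: h1 h2; move: (_ - _) => w; clear -R; lra.
  pose k : {ffun Ih -> 'I_(2 * m).+1} := [ffun jl => inord (Num.truncn (u jl))].
  have kE jl : (k jl)%:R = (Num.truncn (u jl))%:R :> R.
    have [u0 u1] := ub jl; rewrite ffunE inordK // ltnS -(ler_nat R).
    by apply: le_trans u1; rewrite truncn_le.
  have hk jl : 0 <= iw_coord x (inl jl) - iw_coord (corner k) (inl jl) <= tau.
    rewrite mkE kE; have [u0 _] := ub jl; have := truncn_itv u0.
    move: (Num.truncn (u jl)) => t; rewrite -natr1 /u ler_pdivlMr // ltr_pdivrMr // mulrDl mul1r.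
    rewrite (mulrC tau); move: (_ * tau) (iw_coord x _) (iw_coord y _) => w xi yi /andP[w1 w2].
    by apply/andP; clear -w1 w2; split; lra.
  exists (index k (enum {: {ffun Ih -> 'I_(2 * m).+1}})); rewrite size_map index_mem mem_enum; split=> //.
  rewrite (nth_map k) ?index_mem ?mem_enum // nth_index ?mem_enum // => i.
  case: i => [jl|l]; rewrite /bx /=.
    have /andP[h1 h2] := hk jl; rewrite ger0_norm ?(ltW tau0) //.
    by rewrite -subr_ge0 h1 -lerBlDl.
  have := hx (inr l); rewrite /= -[(kcoords _)`_l.+1]/(iw_coord x (inr l)).
  have : `|tw y x l - tw y (corner k) l| <= vnorm (val y).1 * ((4 * n)%:R * tau).
    apply: tw_diff_le => jl; have /andP[h1 h2] := hk jl; rewrite ger0_norm //.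
  rewrite (ger0_norm s4).
  move: Vtau (tw y x l) (tw y (corner k) l) (iw_coord x _) (kcoords _)`_l.+1.
  move: (vnorm _ * _) (s ^+ 2) => V S VS t1 t2 xi yi.
  exact: box_slab.
rewrite big_map big_enum /= (eq_bigr (fun=> tau ^+ #|{: Ih}| * (4 * s ^+ 2) ^+ #|{: Iv}|)); last first.
  move=> k _; rewrite /box_cost prod_I /=; congr (_ * _).
    by rewrite (eq_bigr (fun=> tau)) ?prodr_const // => i _; rewrite ger0_norm // ltW.
  rewrite (eq_bigr (fun=> 4 * s ^+ 2)) ?prodr_const // => i _.
  by rewrite ger0_norm.
rewrite sumr_const card_ffun card_ord -[leLHS]mulr_natl natrX mulrA -exprMn.
have t3 : (2 * m).+1%:R * tau <= 4 * s.
  rewrite -natr1 natrM.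
  have -> : (2 * m%:R + 1) * tau = s * (2 + m%:R^-1) by rewrite /tau; field; rewrite gt_eqF.
  rewrite mulrC ler_pM2r // (_ : 4 = 2 + 2); last by ring.
  by rewrite lerD2l (@le_trans _ _ 1) ?ler1n // invf_le1 // ler1n.
have -> : 4 ^+ #|{: I}| * ball_cost (y, s) = (4 * s) ^+ #|{: Ih}| * (4 * s ^+ 2) ^+ #|{: Iv}|.
  rewrite /ball_cost /= (ger0_norm (ltW s_gt0)) hdimE card_sum (exprD s) (exprM s) (exprD 4) !exprMn; ring.
by rewrite !card_ord ler_wpM2r ?(exprn_ge0 _ s4) // lerXn2r ?nnegrE // mulr_ge0 // ltW.
Qed.

(** The grid points of mesh e near the box number at most the product of (L i + W' e) / e ^ [wt i],
    and each ball costs ([gauge_const] e)^Q. The powers of e cancel, and the excess over the volume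
    is O(e). *)
Lemma box_by_balls (c : (I -> R) * (I -> R)) (eta : R) : 0 < eta ->
  covered (@ball_cell R kk n) (@ball_cost R kk n) (box_cell c) (gauge_const%:R ^+ Q * box_cost c + eta).
Proof.
move=> eta0; case: c => a l; pose L i := `|l i|.
have L0 i : 0 <= L i by exact: normr_ge0.
pose Rb := \sum_i (`|a i| + L i).
have Rb0 : 0 <= Rb by apply: sumr_ge0 => i _; rewrite addr_ge0.
pose V := (4 * n)%:R * (Rb + 1).
have V0 : 0 <= V by rewrite mulr_ge0 // addr_ge0.
pose W := 2 * (V * (4 * n)%:R).
have W0 : 0 <= W by rewrite /W mulr_ge0 // mulr_ge0.
have [C C0 pert] := prod_perturb L0.
pose W' := 2 * W + 4.
have W'0 : 0 < W' by rewrite /W' ltr_wpDl // mulr_ge0.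
have W'1 : 1 <= W' by rewrite /W' (@le_trans _ _ 4) ?ler1n // lerDr mulr_ge0.
have W'E : W' = 2 * W + 4 by [].
clearbody W'.
have cg0 : 0 <= gauge_const%:R ^+ Q :> R by rewrite exprn_ge0.
have K0 : 0 <= gauge_const%:R ^+ Q * C * W' / eta by rewrite divr_ge0 ?(ltW eta0) // !mulr_ge0 // ltW.
pose K := gauge_const%:R ^+ Q * C * W' / eta.
have y0 : 0 < W' + K by rewrite ltr_wpDr.
pose e := (W' + K)^-1.
have e0 : 0 < e by rewrite invr_gt0.
have eW : W' * e <= 1 by rewrite /e ler_pdivrMr // mul1r lerDl.
have e1 : e <= 1 by apply: le_trans eW; rewrite ler_peMl // ltW.
have eeta : gauge_const%:R ^+ Q * C * (W' * e) <= eta.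
  rewrite mulrA /e ler_pdivrMr // mulrDr /K [eta * (_ / _)]mulrC divfK ?gt_eqF //.
  by rewrite lerDr mulr_ge0 // ltW.
clearbody e.
have ew (i : I) : 0 < e ^+ wt i by rewrite exprn_gt0.
pose lo i := (a i - W * e) / e ^+ wt i - 1.
pose hi i := (a i + L i + W * e) / e ^+ wt i + 1.
pose b i := (Num.truncn (hi i - lo i + 1)).+1.
pose P (p : G) := exists2 x, box_cell (a, l) x & forall i, `|grid_center e x p i - (p i)%:~R| <= 1.
have Pb p i : P p -> lo i <= (p i)%:~R <= hi i.
  move=> [x xb px].
  have xR jl : `|iw_coord x (inl jl)| <= Rb.
    have /andP[h1 h2] := xb (inl jl); rewrite /Rb (bigD1 (inl jl)) //=.
    apply: ler_wpDr; first by apply: sumr_ge0 => *; rewrite addr_ge0.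
    exact: abs_in_box h1 h2.
  have xg jl : `|iw_coord x (inl jl) - iw_coord (grid e p) (inl jl)| <= e.
    rewrite gridE expr1; have := px (inl jl); rewrite grid_center_inl => h.
    have -> : iw_coord x (inl jl) - e * (p (inl jl))%:~R = e * (iw_coord x (inl jl) / e - (p (inl jl))%:~R).
      by rewrite mulrBr [e * (_ / _)]mulrC divfK // gt_eqF.
    by rewrite normrM (ger0_norm (ltW e0)) ler_piMr // ltW.
  have gV : vnorm (val (grid e p)).1 <= V.
    apply: vnorm_coords_le => jl; apply: le_trans (lerD (xR jl) (le_trans (xg jl) e1)).
    rewrite -{1}[iw_coord (grid e p) _](subKr (iw_coord x (inl jl))).
    exact: ler_normB.
  (* The twist of p with itself vanishes and x is horizontally e-close to p, so the twist is O(e),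
     although p may be far from 0. *)
  have tb : `|twist (grid e p) x i| <= W * e.
    case: i => [jl|k] /=; first by rewrite normr0 mulr_ge0 // ltW.
    have -> : W * e = 2 * (V * ((4 * n)%:R * e)) by rewrite /W; ring.
    rewrite normrM (ger0_norm (ler0n _ 2)) ler_pM2l //.
    have := tw_diff_le (grid e p) k xg; rewrite tw_self subr0 => h; apply: le_trans h _.
    by rewrite ler_wpM2r // mulr_ge0 // ltW.
  have := px i; rewrite /grid_center.
  have /andP[h1 h2] := xb i.
  by move=> h3; have := box_index (ew i) h1 h2 tb h3.
have cnt (s : seq G) : uniq s -> (forall p, p \in s -> P p) -> (size s <= \prod_i b i)%N.
  move=> us sP; apply: (@offset_count R kk n e (iw0 R kk n) (\sum_i b i) b (fun i => Num.floor (lo i))) => //.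
    by move=> i; rewrite (bigD1 i) //= leq_addr.
  move=> p /sP Pp i.
  (* Seen from 0 there is no twist, so [offset_count] reduces to counting integers between [lo i]
     and [hi i]. *)
  have -> : grid_center e (iw0 R kk n) p i = 0.
    rewrite /grid_center; have -> : iw_coord (iw0 R kk n) i = 0.
      by case: i => [[j k]|k] /=; rewrite ?mxE kcoords0.
    have -> : twist (grid e p) (iw0 R kk n) i = 0.
      case: i => //= k; rewrite /tw /= /hdot big1 ?kcoords0 ?mulr0 // => j _.
      by rewrite mxE mulr0.
    by rewrite subrr mul0r.
  rewrite floor0 add0r; have /andP[p1 p2] := Pb p i Pp.
  have /andP[f1 f2] := floor_itv (lo i).
  apply/andP; split; first by rewrite subr_ge0 -(ler_int R); exact: le_trans p1.
  rewrite -(ltr_int R) intrB -pmulrn.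
  apply: le_lt_trans (truncnS_gt _); rewrite intrD mulr1z in f2.
  move: (Num.floor _)%:~R (p i)%:~R f2 p1 p2 => f q f2 p1 p2; clear -f2 p2; lra.
have [S uS SP] := bounded_list cnt.
have cgp : 0 <= gauge_const%:R * e by rewrite mulr_ge0 // ltW.
apply: (covered_seq (@ball_cost_ge0 R kk n) (@ball_cost0 R kk n hn)
  (s := [seq (grid e p, gauge_const%:R * e) | p <- S])).
  move=> x xb; have [s [_ ss sP]] := @offset_points R kk n e x 1 (fun=> 1%N) (fun=> leqnn 1).
  have [p ps] : exists p, p \in s.
    by case: s ss {sP} => [|p s]; rewrite big1 // => _; exists p; rewrite mem_head.
  have pS : p \in S by apply/SP; exists x => //; exact: sP.
  exists (index p S); rewrite size_map index_mem; split=> //.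
  have h : D (Some (grid e p)) (Some x) <= gauge_const%:R * (e * 1).
    by apply: grid_near => // i; rewrite expr1n; exact: sP.
  by rewrite (nth_map p) ?index_mem // nth_index //; rewrite mulr1 in h.
rewrite big_map (eq_bigr (fun=> (gauge_const%:R * e) ^+ Q)); last first.
  by move=> p _; rewrite /ball_cost /= ger0_norm.
rewrite big_const_seq count_predT iter_addr_0 -[leLHS]mulr_natl.
have sS : (size S)%:R <= \prod_i (b i)%:R :> R.
  by rewrite -natr_prod ler_nat; apply: cnt => // p /SP.
apply: le_trans (ler_wpM2r (exprn_ge0 _ cgp) sS) _.
have -> : (\prod_i (b i)%:R) * (gauge_const%:R * e) ^+ Q = gauge_const%:R ^+ Q * \prod_i ((b i)%:R * e ^+ wt i).
  by rewrite exprMn big_split /= prodrXr mulrCA.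
apply: (@le_trans _ _ (gauge_const%:R ^+ Q * \prod_i (L i + W' * e))).
  rewrite ler_wpM2l //; apply: ler_prod => i _; rewrite mulr_ge0 ?(ltW (ew i)) //=.
  rewrite /b -natr1.
  have hl : 0 <= hi i - lo i + 1.
    rewrite /hi /lo; have -> : (a i + L i + W * e) / e ^+ wt i + 1 - ((a i - W * e) / e ^+ wt i - 1) + 1 =
      (L i + 2 * (W * e)) / e ^+ wt i + 3 by ring.
    apply: addr_ge0 => //; apply: divr_ge0; [apply: addr_ge0 => //|exact: ltW].
    exact: mulr_ge0 (ler0n _ 2) (mulr_ge0 W0 (ltW e0)).
  apply: (@le_trans _ _ ((hi i - lo i + 1 + 1) * e ^+ wt i)).
    by rewrite ler_wpM2r ?(ltW (ew i)) // lerD2r truncn_le.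
  have -> : (hi i - lo i + 1 + 1) * e ^+ wt i = L i + 2 * W * e + 4 * e ^+ wt i.
    by rewrite /hi /lo; field; rewrite gt_eqF.
  rewrite W'E; have -> : L i + (2 * W + 4) * e = L i + 2 * W * e + 4 * e by ring.
  rewrite lerD2l ler_pM2l //.
  by case: (i) => k; rewrite /= ?expr1 // expr2 ler_piMl // ltW.
apply: le_trans (ler_wpM2l cg0 (pert (W' * e) _ eW)) _; first by rewrite mulr_ge0 // ltW.
by rewrite mulrDr lerD2l mulrA.
Qed.

Lemma bnull_cnull A : bnull A <-> cnull A.
Proof.
split.
  apply: (cover_null_transfer (c2 := (iw0 R kk n, 0)) (K := gauge_const%:R ^+ Q)).
  - exact: ball_cost_ge0.
  - exact: ball_cost0.
  - by rewrite exprn_gt0 // ltr0n /gauge_const addn2.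
  - exact: box_by_balls.
apply: (cover_null_transfer (c2 := box0) (K := 4 ^+ #|{: I}|)).
- exact: box_cost_ge0.
- exact: box_cost0.
- by rewrite exprn_gt0.
- exact: ball_by_boxes.
Qed.

Lemma leb_null_cnull A : leb_null A <-> cnull A.
Proof. by rewrite leb_nullP; exact: bnull_cnull. Qed.

(** The part of A mapped into a given ball lies in a ball of twice the radius about any one of its
    points, which costs 2^Q. *)
Lemma cnull_expanding (A B : set X) (f : X -> X) : cnull B -> (forall x, A x -> B (f x)) ->
  (forall x x', A x -> A x' -> D (Some x) (Some x') <= D (Some (f x)) (Some (f x'))) ->
  cnull A.
Proof.
move=> nB AB fe.
apply: (cover_null_transfer (cell1 := fun c => [set x | A x /\ ball_cell c (f x)])
   (cost1 := @ball_cost R kk n) (c2 := (iw0 R kk n, 0)) (K := 2 ^+ Q)).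
- exact: ball_cost_ge0.
- exact: ball_cost0.
- by rewrite exprn_gt0.
- move=> c e e0; apply: (@covered_le _ _ _ _ _ _ (2 ^+ Q * ball_cost c)); first by rewrite lerDl ltW.
  have [[x [Ax fx]]|no] := pselect (exists x, A x /\ ball_cell c (f x)).
    apply: (covered_seq (@ball_cost_ge0 R kk n) (@ball_cost0 R kk n hn) (s := [:: (x, 2 * c.2)])).
      move=> x' [Ax' fx']; exists 0%N; split=> //=; apply: le_trans (fe _ _ Ax Ax') _.
      apply: le_trans (bdist_triangle _ c.1 _) _.
      by rewrite mulr_natl mulr2n; apply: lerD => //; rewrite bdist_sym.
    by rewrite big_seq1 /ball_cost /= normrM exprMn ger0_norm.
  apply: (covered_seq (@ball_cost_ge0 R kk n) (@ball_cost0 R kk n hn) (s := [::])).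
    by move=> x xc; case: no; exists x.
  by rewrite big_nil mulr_ge0 ?exprn_ge0 // ball_cost_ge0.
- move=> e e0; have [F [BF Fe]] := nB e e0; exists F; split=> // x Ax.
  by have [m _ xm] := BF _ (AB x Ax); exists m.
Qed.

Lemma cnull_point (x : X) : cnull [set x].
Proof.
move=> e e0; apply: (covered_seq (@ball_cost_ge0 R kk n) (@ball_cost0 R kk n hn) (s := [:: (x, 0)])).
  by move=> y ->; exists 0%N; split=> //; change (D (Some x) (Some x) <= 0); rewrite bdist_diag.
by rewrite big_seq1 /ball_cost /= normr0 expr0n gtn_eqF ?hdim_gt0 // ltW.
Qed.
End BoxBall.

(** * Exceptional points *)

Section Countable.
Variables (R : realType) (kk : scalar_kind) (n : nat).
Local Notation scal := (scalars R kk).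
Local Notation X := (iwasawa R kk n).
Local Notation N := (1 + (n + 1))%N.
Local Notation J := (@formJ R kk n).
Variable CF : iwasawa_cf R kk n.
Local Notation Z := (cf_Z CF).

Let ZG : subgroup Z := Z_subgroup CF.

Lemma floor_eq_dist (x y : R) : Num.floor x = Num.floor y -> `|x - y| <= 1.
Proof.
move=> e; have /andP[h1 h2] := floor_itv x; have /andP[h3 h4] := floor_itv y.
rewrite e in h1 h2; rewrite intrD mulr1z in h2 h4.
by rewrite ler_norml; move: (Num.floor y)%:~R h1 h2 h3 h4 => t *; apply/andP; split; lra.
Qed.

(* Rounding the entries of representing matrices separates the elements of a
   discrete group. *)
Lemma Z_countable : exists f : nat -> option X -> option X,
  (forall k, Z (f k)) /\ forall a, Z a -> exists k, f k = a.
Proof.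
have [e e0 disc] := Z_discrete CF.
have ex a : {A : 'M[scal]_N | Z a -> rep A a}.
  apply: cid; have [Za|nZ] := pselect (Z a); last by exists 0.
  by have [A rA] := rep_ex ZG Za; exists A.
pose A a := sval (ex a).
have rA a : Z a -> rep (A a) a by rewrite /A; case: (ex a).
pose B a := Num.truncn (mnorm (A a)).
(* A rounding precision finer than 1 / c makes the quotient of two elements with equal code e-close
   to 1. It depends on the size of the matrix, which is why the code records the size too. *)
pose c (b : nat) := mnorm J * b.+1%:R * mnorm J * (4 * (N * N)%:R) / e.
have c0 b : 0 <= c b by rewrite divr_ge0 ?(ltW e0) // !mulr_ge0 ?mnorm_ge0.
pose m b := (Num.truncn (c b)).+1.
pose code a : nat * {ffun 'I_N * 'I_N * 'I_4 -> int} :=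
  (B a, [ffun p : 'I_N * 'I_N * 'I_4 =>
          Num.floor ((kcoords (A a p.1.1 p.1.2))`_(p.2) * (m (B a))%:R)]).
have code_inj a b : Z a -> Z b -> code a = code b -> a = b.
  move=> Za Zb [eB eF].
  have mR : 0 < (m (B a))%:R :> R by rewrite ltr0n.
  have near i j : knorm ((A b - A a) i j) <= 4 * (m (B a))%:R^-1.
    apply: knorm_coords_bound => l l4.
    have := congr1 (fun f : {ffun 'I_N * 'I_N * 'I_4 -> int} => f (i, j, Ordinal l4)) eF.
    rewrite !ffunE /= -eB => /esym/floor_eq_dist.
    rewrite -mulrBl normrM normr_nat !mxE kcoordsD kcoordsN.
    by rewrite -ler_pdivlMr // div1r.
  have idab : minv a \o b = id.
    have rBa := rep_mul (rep_inv ZG Za (rA a Za)) (rA b Zb).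
    apply: (disc _ _ rBa); last exact: (subgroup_comp ZG (subgroup_minv ZG Za) Zb).
    move=> i j; apply: le_lt_trans (knorm_le_mnorm _ i j) _.
    have -> : invJ (A a) *m A b - 1%:M = invJ (A a) *m (A b - A a).
      by rewrite mulmxBr invJ_mul //; case: (rA a Za).
    apply: le_lt_trans (mnormM _ _) _.
    apply: (@le_lt_trans _ _ ((mnorm J * (B a).+1%:R * mnorm J) * ((4 * (m (B a))%:R^-1) *+ (N * N)))).
      apply: ler_pM; rewrite ?mnorm_ge0 //; last exact: mnorm_le.
      apply: le_trans (mnorm_invJ _) _; rewrite ler_wpM2r ?mnorm_ge0 // ler_wpM2l ?mnorm_ge0 //.
      exact/ltW/truncnS_gt.
    have -> : (mnorm J * (B a).+1%:R * mnorm J) * ((4 * (m (B a))%:R^-1) *+ (N * N)) =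
        c (B a) * e / (m (B a))%:R.
      by rewrite /c divfK ?gt_eqF // -mulr_natr; ring.
    by rewrite ltr_pdivrMr // mulrC ltr_pM2l // truncnS_gt.
  apply/funext => u; rewrite -[RHS](minvKr ZG Za).
  by have := congr1 (fun f => a (f u)) idab; rewrite /= !(minvKr ZG Za).
pose P k a := Z a /\ pickle (code a) = k.
exists (fun k => if pselect (exists a, P k a) is left h then sval (cid h) else id).
split=> [k|a Za].
  by case: pselect => [h|_]; [case: (cid h) => a []|exact: Z_id].
exists (pickle (code a)); case: pselect => [h|[]]; last by exists a.
case: (cid h) => b [Zb /=] /(congr1 (@pickle_inv (nat * {ffun 'I_N * 'I_N * 'I_4 -> int})%type)).
by rewrite !pickleK_inv => /Some_inj/(code_inj b a Zb Za).
Qed.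
End Countable.

Lemma near_zero_bounds (R : realFieldType) (d l x y : R) : 0 < d -> d <= l -> x <= d / 2 ->
  l <= x + y -> y <= l + x -> l <= 2 * y /\ y <= 2 * l.
Proof. by move=> *; split; lra. Qed.

Lemma small_quality (R : realFieldType) (be rho l x y R0 k : R) : 0 < be -> 0 < rho -> 0 <= x ->
  y * be = rho * l -> y <= 2 * l -> 0 < y -> 4 * R0 ^+ 2 * x <= k ->
  x * rho * be * (R0 * be^-1) ^+ 2 <= k / 2.
Proof.
move=> be0 rho0 x0 e yl y0 hk.
have l0 : 0 < l by rewrite -(pmulr_rgt0 _ rho0) -e mulr_gt0.
have ebe : rho / be = y / l.
  by apply/eqP; rewrite eqr_div ?lt0r_neq0 // e.
have -> : x * rho * be * (R0 * be^-1) ^+ 2 = R0 ^+ 2 * x * (rho / be) by field; rewrite gt_eqF.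
rewrite ebe.
have h : y / l <= 2 by rewrite ler_pdivrMr.
apply: (@le_trans _ _ (R0 ^+ 2 * x * 2)); first by rewrite ler_wpM2l // mulr_ge0 // sqr_ge0.
by move: (R0 ^+ 2) hk => S hk; rewrite -mulrA in hk; move: (S * x) hk => t hk; lra.
Qed.

Lemma far_bounds (R : realFieldType) (be rho l x y : R) : 0 < rho -> 2 < l -> 0 <= x -> x <= 1 ->
  l <= x + y -> y <= l + x -> 0 < y -> y * be = rho * l ->
  1 / 2 * rho <= be /\ be <= 2 * rho /\ x * rho * be <= 2 * rho ^+ 2.
Proof.
move=> rho0 l2 x0 x1 t1 t2 y0 e.
have bE : be = rho * (l / y) by rewrite mulrA -e mulrAC divff ?mul1r ?gt_eqF.
have h1 : l / y <= 2 by rewrite ler_pdivrMr //; lra.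
have h2 : 1 / 2 <= l / y by rewrite ler_pdivlMr //; lra.
have b2 : be <= 2 * rho by rewrite bE mulrC ler_pM2r.
split; first by rewrite bE mulrC ler_pM2l.
split=> //; have -> : 2 * rho ^+ 2 = 1 * rho * (2 * rho) by ring.
have be0 : 0 <= be by rewrite bE mulr_ge0 ?(ltW rho0) // divr_ge0 // ltW //; lra.
by apply: ler_pM; rewrite ?mulr_ge0 ?(ltW rho0) // ler_wpM2r // ltW.
Qed.

(** * Cusps supplied by the algorithm *)

Section Generic.
Variables (R : realType) (kk : scalar_kind) (n : nat).
Local Notation X := (iwasawa R kk n).
Local Notation D := (@bdist R kk n).
Local Notation o0 := (Some (iw0 R kk n)).
Variable CF : iwasawa_cf R kk n.
Local Notation Z := (cf_Z CF).
Local Notation M := (modular_group CF).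
Local Notation T := (cf_shift CF).
Local Notation xs x m := (iter m T x).
Hypotheses (hn : (1 <= n)%N) (compl : cf_complete CF).
Variable r : R.
Hypotheses (r0 : 0 < r) (r1 : r < 1) (Kr : forall y, cf_K CF y -> D (Some y) o0 <= r).
Variables (R0 k : R).
Hypotheses (k0 : 0 < k) (k1 : 8 * k <= r^-1 - r).

Let MG : subgroup M := modular_subgroup compl.
Let del : R := r^-1 - r.

Lemma del_gt0 : 0 < del.
Proof. by apply: lt_le_trans k1; rewrite mulr_gt0. Qed.

(* [1 / s None] is the radius of g; small values of [D x (g oo) * (R0 * s None) ^ 2]
   mean that the geodesic to x goes deep into the horoball at g oo. *)
Definition good_approx (x : X) (eta : R) (c : R) := exists g (s : option X -> R),
  [/\ M g, weight g s, g None <> None, 1 < eta * s None &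
      D (Some x) (g None) * (R0 * s None) ^+ 2 <= c].

(** The two cusps which [cf_move x m] takes to infinity and to 0 are the analogues of consecutive
    convergents; the second goes to infinity at the next step. *)
Lemma cusp_over x m (t : option X) : t = None \/ t = o0 ->
  exists g s, [/\ M g, weight g s, cf_move CF x m (g None) = t &
     s None = (cf_fac CF x m (g None))^-1].
Proof.
have MB : M (cf_move CF x m) := cf_move_mod compl x m.
have w1 := weight_inv (cf_move_weight CF hn x m) (minvKr MG MB).
case=> ->.
  exists (minv (cf_move CF x m)), (fun y => (cf_fac CF x m (minv (cf_move CF x m) y))^-1).
  by split; [exact: (subgroup_minv MG)|exact: w1|exact: (minvKr MG MB)|].
have Mi : M (cf_iota CF) := @modular_iota _ _ _ CF.
have w2 := weight_inv (iota_weightP CF hn) (minvKr MG Mi).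
have i0 : minv (cf_iota CF) None = o0.
  by have [<- _ _] := cf_iotaP CF; rewrite (minvKl MG Mi).
exists (minv (cf_move CF x m) \o minv (cf_iota CF)), (fun y =>
  (cf_fac CF x m (minv (cf_move CF x m) (minv (cf_iota CF) y)))^-1 *
  (iota_weight (minv (cf_iota CF) y))^-1); split.
- exact: (subgroup_comp MG (subgroup_minv MG MB) (subgroup_minv MG Mi)).
- exact: (weight_comp w1 w2).
- by rewrite /= i0; exact: (minvKr MG MB).
- by rewrite /= i0 /= eqxx invr1 mulr1.
Qed.

Section Point.
Variables (x : X) (Kx : cf_K CF x) (ix : cf_infinite CF x).
Local Notation B := (cf_move CF x).
Local Notation b := (cf_fac CF x).
Local Notation rho := (cf_rho CF x).
Local Notation L := (cf_sep CF x).

Lemma cusp_rel m u : u <> None ->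
  [/\ D (B m None) (B m u) * b m u = rho m * L m,
      D (Some x) u = D (Some (xs x m)) (B m u) * rho m * b m u & 0 < D (B m None) (B m u)].
Proof.
move=> uN.
have h1 := cf_facE CF hn x m None u; have h2 := cf_sepE hn ix m.
have h3 := cf_facE CF hn x m (Some x) u.
have d1 : D None u = 1 by rewrite bdist_sym bdist_None.
have B0 : 0 < D (B m None) (B m u).
  by apply: bdist_gt0 => /(weight_inj (cf_move_weight CF hn x m)) /esym.
rewrite d1 in h1; rewrite (cf_move_self hn ix) in h3.
have rh := cf_rho_gt0 CF hn x m; have bn := cf_fac_gt0 CF hn x m None.
split=> //; last by rewrite -h3 mulrA.
apply: (mulIf (x := b m None)); first by rewrite gt_eqF.
by rewrite -mulrA [b m u * _]mulrC h1 mulrAC -[LHS]h2; ring.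
Qed.

(** For the cusp over 0 the quality is R0^2 |x_m| times the ratio of the distances of 0 and of x_m
    from the image of infinity. That ratio is at most 2, as x_m is close to 0 compared with its
    separation. *)
Lemma small_good_approx m (eta : R) : D (Some (xs x m)) o0 <= del / 2 ->
  4 * R0 ^+ 2 * D (Some (xs x m)) o0 <= k -> 2 * rho m < eta -> good_approx x eta (k / 2).
Proof.
move=> hd hk he.
have [g [s [Mg gs gt sE]]] := @cusp_over x m o0 (or_intror erefl).
have x0 := bdist_iter_gt0 ix m; have rh := cf_rho_gt0 CF hn x m.
have sep := cf_sep_ge hn Kx ix r0 r1 Kr m.
have dg := del_gt0.
have gN : g None <> None.
  move=> e; rewrite e in gt; case: sep; rewrite /cf_sep gt // => h.
  have : del <= del / 2 := le_trans h hd.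
  by rewrite ler_pdivlMr // mulr_natr mulr2n gerDl leNgt dg.
have [e1 e2 d0] := cusp_rel m gN; rewrite gt in e1 e2 d0.
set be := b m (g None) in e1 e2 sE.
have be0 : 0 < be by exact: cf_fac_gt0.
have [y1 y2] : L m <= 2 * D (B m None) o0 /\ D (B m None) o0 <= 2 * L m.
  case E : (B m None) sep => [y|] sep; rewrite /cf_sep E /=; last by rewrite !mulr1 ler1n.
  case: sep => // sep; rewrite /cf_sep E in sep.
  have t1 := bdist_triangle (xs x m) (iw0 R kk n) y.
  have t2 := bdist_triangle y (xs x m) (iw0 R kk n).
  rewrite [D o0 _]bdist_sym in t1; rewrite [D (Some y) (Some (xs x m))]bdist_sym in t2.
  exact: near_zero_bounds dg sep hd t1 t2.
have bele : be <= 2 * rho m.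
  rewrite -(ler_pM2l d0) e1.
  have -> : D (B m None) o0 * (2 * rho m) = rho m * (2 * D (B m None) o0) by ring.
  by rewrite ler_pM2l.
exists g, s; split=> //.
  by rewrite sE -ltr_pdivrMr ?invr_gt0 // invrK mul1r; exact: le_lt_trans bele he.
rewrite e2 sE; exact: small_quality be0 rh (ltW x0) e1 y2 d0 hk.
Qed.

(** If the image of infinity is infinity, the cusp over 0 has radius exactly rho. If its separation
    L is at most 2, the cusp over infinity has radius rho L. If L > 2, the cusp over 0 is taken
    again, as |x_m| <= 1 makes the distances of x_m and 0 from that image comparable. *)
Lemma hole_exists m : exists g (s : option X -> R),
  [/\ M g, weight g s, g None <> None,
      Num.min del (1 / 2) * rho m <= (s None)^-1 <= 2 * rho m &
      D (Some x) (g None) <= 2 * rho m ^+ 2].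
Proof.
have x0 := bdist_iter_gt0 ix m; have rh := cf_rho_gt0 CF hn x m.
have x1 : D (Some (xs x m)) o0 <= 1.
  by apply: le_trans (ltW r1); apply: Kr; exact: cf_K_iter.
have sep := cf_sep_ge hn Kx ix r0 r1 Kr m.
have dg := del_gt0.
have c1 : Num.min del (1 / 2) <= del by rewrite ge_min lexx.
have c2 : Num.min del (1 / 2) <= 1 / 2 by rewrite ge_min lexx orbT.
case E : (B m None) sep => [y|] sep; last first.
  have [g [s [Mg gs gt sE]]] := @cusp_over x m o0 (or_intror erefl).
  have gN : g None <> None by move=> e; rewrite e E in gt.
  have [e1 e2 d0] := cusp_rel m gN; rewrite gt in e2.
  have {}e1 : b m (g None) = rho m.
    by move: e1; rewrite gt E /cf_sep E bdist_sym !bdist_None // mul1r mulr1.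
  have m1 : Num.min del (1 / 2) <= 1 by apply: le_trans c2 _; rewrite ler_pdivrMr // mul1r ler1n.
  rewrite e1 in sE e2; exists g, s; split=> //.
    rewrite sE invrK ler_piMl ?(ltW rh) //=.
    by rewrite ler_peMl ?(ltW rh) // ler1n.
  rewrite e2 -mulrA -expr2; apply: ler_wpM2r; first by rewrite sqr_ge0.
  by apply: le_trans x1 _; rewrite ler1n.
case: sep => // sep; have LE : L m = D (Some (xs x m)) (Some y) by rewrite /cf_sep E.
rewrite -/del in sep.
have [L2|L2] := leP (L m) 2.
  have [g [s [Mg gs gt sE]]] := @cusp_over x m None (or_introl erefl).
  have gN : g None <> None by move=> e; rewrite e E in gt.
  have [e1 e2 d0] := cusp_rel m gN; rewrite gt bdist_None // mul1r in e2.
  have {}e1 : b m (g None) = rho m * L m.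
    by move: e1; rewrite gt E bdist_None // mul1r.
  rewrite e1 in sE e2; exists g, s; split=> //.
    rewrite sE invrK; apply/andP; split.
      by rewrite mulrC ler_pM2l //; exact: le_trans c1 sep.
    by rewrite mulrC ler_pM2r.
  by rewrite e2 mulrA -expr2 mulrC ler_wpM2r ?sqr_ge0.
have [g [s [Mg gs gt sE]]] := @cusp_over x m o0 (or_intror erefl).
have t1 := bdist_triangle (xs x m) (iw0 R kk n) y.
have t2 := bdist_triangle y (xs x m) (iw0 R kk n).
rewrite [D o0 _]bdist_sym -LE in t1; rewrite [D (Some y) (Some (xs x m))]bdist_sym -LE in t2.
have gN : g None <> None.
  move=> e; rewrite e E in gt; case: gt => ey; rewrite ey bdist_diag addr0 in t1.
  by have := lt_le_trans L2 (le_trans t1 x1); rewrite ltNge ler1n.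
have [e1 e2 d0] := cusp_rel m gN; rewrite gt E in e1 d0; rewrite gt in e2.
exists g, s; have [h1 [h2 h3]] := far_bounds rh L2 (ltW x0) x1 t1 t2 d0 e1.
split=> //; rewrite ?sE ?invrK ?e2 //.
by rewrite h2 andbT; apply: le_trans h1; rewrite ler_wpM2r // ltW.
Qed.
End Point.
End Generic.

(* In [poor_null], [p] is the conformal factor of the first level of the algorithm
   finer than the scale [s], and [p'] that of the level before. *)
Lemma hole_size (R : realFieldType) (k R0 c eta s p p' u d : R) : 0 < k -> 0 < R0 -> 0 < c -> 0 < eta ->
  0 < p' -> eta * p' <= p -> s < 2 * p' ^+ 2 -> 0 < u -> c * p <= u^-1 -> k / 2 < d * (R0 * u) ^+ 2 ->
  k * c ^+ 2 * eta ^+ 2 / (4 * R0 ^+ 2) * s <= d.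
Proof.
move=> k0 R00 c0 eta0 p'0 pp' sp' u0 cu kd.
have R2 : 0 < R0 ^+ 2 by rewrite exprn_gt0.
have u2 : 0 < u ^+ 2 by rewrite exprn_gt0.
have p0 : 0 < p by apply: lt_le_trans pp'; rewrite mulr_gt0.
have uc : c * p * u <= 1 by rewrite -ler_pdivlMr // div1r.
have e2 : c * (eta * p') * u <= 1 by apply: le_trans uc; rewrite ler_pM2r // ler_pM2l.
have e3 : c ^+ 2 * eta ^+ 2 * p' ^+ 2 * u ^+ 2 <= 1.
  have -> : c ^+ 2 * eta ^+ 2 * p' ^+ 2 * u ^+ 2 = (c * (eta * p') * u) ^+ 2 by ring.
  by rewrite expr_le1 // !mulr_ge0 ?(ltW c0) ?(ltW eta0) ?(ltW p'0) ?(ltW u0).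
have e4 : c ^+ 2 * eta ^+ 2 * s * u ^+ 2 <= 2.
  apply: le_trans (_ : 2 * (c ^+ 2 * eta ^+ 2 * p' ^+ 2 * u ^+ 2) <= _).
    have -> : 2 * (c ^+ 2 * eta ^+ 2 * p' ^+ 2 * u ^+ 2) = c ^+ 2 * eta ^+ 2 * (2 * p' ^+ 2) * u ^+ 2 by ring.
    by rewrite ler_pM2r // ler_pM2l ?(ltW sp') // mulr_gt0 ?exprn_gt0.
  by rewrite -[leRHS]mulr1 ler_pM2l.
rewrite mulrAC ler_pdivrMr ?mulr_gt0 // -(ler_pM2r u2).
apply: le_trans (_ : k * 2 <= _).
  have -> : k * c ^+ 2 * eta ^+ 2 * s * u ^+ 2 = k * (c ^+ 2 * eta ^+ 2 * s * u ^+ 2) by ring.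
  by rewrite ler_pM2l.
have -> : d * (4 * R0 ^+ 2) * u ^+ 2 = 4 * (d * (R0 * u) ^+ 2) by ring.
have -> : k * 2 = 4 * (k / 2) by field.
by rewrite ler_pM2l // ltW.
Qed.

(** * Points without good approximations *)

Section Poor.
Variables (R : realType) (kk : scalar_kind) (n : nat).
Local Notation X := (iwasawa R kk n).
Local Notation D := (@bdist R kk n).
Local Notation o0 := (Some (iw0 R kk n)).
Variable CF : iwasawa_cf R kk n.
Local Notation M := (modular_group CF).
Local Notation T := (cf_shift CF).
Local Notation xs x m := (iter m T x).
Local Notation cnull := (cover_null (@ball_cell R kk n) (@ball_cost R kk n)).
Hypotheses (hn : (1 <= n)%N) (compl : cf_complete CF).
Variable r : R.
Hypotheses (r0 : 0 < r) (r1 : r < 1) (Kr : forall y, cf_K CF y -> D (Some y) o0 <= r).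
Variables (R0 k : R).
Hypotheses (R00 : 0 < R0) (k0 : 0 < k) (k1 : 8 * k <= r^-1 - r).

Definition poor (eta : R) : set X := [set x | [/\ cf_K CF x, cf_infinite CF x,
  forall m, eta <= D (Some (xs x m)) o0 & ~ good_approx CF R0 x eta (k / 2)]].

(** Porosity at scale s: take the first level with 2 rho^2 <= s and its cusp from [hole_exists]. No
    poor point approximates this cusp well, and remainders bounded below keep rho from dropping too
    fast, so the radius is comparable to the square root of s and the hole to s. *)
Lemma poor_null eta : 0 < eta -> cnull (poor eta).
Proof.
move=> eta0; pose c := Num.min (r^-1 - r) (1 / 2).
have c0 : 0 < c by rewrite lt_min (del_gt0 k0 k1) divr_gt0.
apply: (@porous_null _ _ _ hn _ (k * c ^+ 2 * eta ^+ 2 / (4 * R0 ^+ 2)) (Num.min 1 (eta ^+ 2 / 4))).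
- by rewrite divr_gt0 ?mulr_gt0 ?exprn_gt0.
- by rewrite lt_min ltr01 divr_gt0 // exprn_gt0.
- by move=> x [Kx _ _ _]; apply: le_trans (ltW r1); exact: Kr.
(* The bound s <= 1 excludes level 0, where rho is 1; s <= eta^2 / 4 makes the cusp radius, at most
   2 rho, less than eta, as [good_approx] demands. *)
move=> x [Kx ix xe _] s s0; rewrite le_min => /andP[s1 se].
have rhole := cf_rho_le hn Kx ix Kr.
have rho0 m := cf_rho_gt0 CF hn x m.
have exm : exists m, 2 * cf_rho CF x m ^+ 2 <= s.
  have [|||m hm] := @exp_small R r (s / 2) => //; first exact: ltW.
    by rewrite divr_gt0.
  exists m; rewrite mulrC -ler_pdivlMr //; apply: le_trans (ltW hm).
  have rm1 : r ^+ m <= 1 by rewrite exprn_ile1 // ltW.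
  apply: le_trans (rhole m); rewrite expr2 ler_piMr ?(ltW (rho0 m)) //.
  exact: le_trans (rhole m) rm1.
case: (ex_minnP exm) => [[|m] ms mmin].
  have : (2 : R) <= 1 by apply: le_trans s1; move: ms; rewrite /cf_rho /= expr1n mulr1.
  by rewrite leNgt ltr1n.
have sm : s < 2 * cf_rho CF x m ^+ 2.
  by rewrite ltNge; apply/negP => /mmin; rewrite ltnn.
have [g [w [Mg gw gN /andP[w1 w2] xg]]] := hole_exists hn compl r0 r1 Kr k0 k1 Kx ix m.+1.
case E : (g None) gN => [q|] // _; exists q; rewrite E in xg; split.
  by apply: le_trans xg ms.
move=> y [Ky iy ye ny]; rewrite bdist_sym.
have [w0 _] := gw.
have rS : eta * cf_rho CF x m <= cf_rho CF x m.+1 by rewrite cf_rhoS // ler_pM2r.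
apply: (hole_size k0 R00 c0 eta0 (rho0 m) rS sm (w0 None) w1).
rewrite ltNge; apply/negP => h; apply: ny; exists g, w; rewrite E; split=> //.
rewrite -ltr_pdivrMr // div1r; apply: le_lt_trans w2 _.
have p0 : 0 <= 2 * cf_rho CF x m.+1 by rewrite mulr_ge0 ?(ltW (rho0 _)).
rewrite -(@ltr_pXn2r _ 2 isT _ _ p0 (ltW eta0)).
have h2 : 4 * cf_rho CF x m.+1 ^+ 2 <= eta ^+ 2 / 2.
  have -> : eta ^+ 2 / 2 = 2 * (eta ^+ 2 / 4) by field.
  have -> : 4 * cf_rho CF x m.+1 ^+ 2 = 2 * (2 * cf_rho CF x m.+1 ^+ 2) by ring.
  by rewrite ler_pM2l //; exact: le_trans ms se.
have -> : (2 * cf_rho CF x m.+1) ^+ 2 = 4 * cf_rho CF x m.+1 ^+ 2 by ring.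
apply: le_lt_trans h2 _.
by rewrite ltr_pdivrMr // ltr_pMr ?ltr1n // exprn_gt0.
Qed.

(* A small remainder x_m at a deep level gives a good approximation of x, the cusp
   which the algorithm sends to 0. *)
Lemma not_good_poor x : cf_K CF x -> cf_infinite CF x ->
  ~ (forall eta, 0 < eta -> good_approx CF R0 x eta (k / 2)) -> exists N, poor N.+1%:R^-1 x.
Proof.
move=> Kx ix /existsNP[eta /not_implyP[eta0 ng]].
have del0 := del_gt0 k0 k1.
have ng' e : e <= eta -> ~ good_approx CF R0 x e (k / 2).
  move=> ee [g [w [Mg gw gN ew xg]]]; apply: ng; exists g, w; split=> //.
  by apply: lt_le_trans ew _; rewrite ler_wpM2r //; case: gw => w0 _; exact: ltW.
pose a := Num.min ((r^-1 - r) / 2) (k / (4 * R0 ^+ 2)).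
have a0 : 0 < a by rewrite lt_min !divr_gt0 // mulr_gt0 // exprn_gt0.
have [|||m0 hm] := @exp_small R r (eta / 2) => //; [exact: ltW|by rewrite divr_gt0|].
have deep m : (m0 <= m)%N -> a <= D (Some (xs x m)) o0.
  move=> mm; rewrite leNgt; apply/negP; rewrite lt_min => /andP[h1 h2].
  apply: ng; apply: (small_good_approx hn compl r0 r1 Kr k0 k1 Kx ix (m := m)).
  - exact: ltW.
  - by rewrite mulrC -ler_pdivlMr ?(ltW h2) // mulr_gt0 // exprn_gt0.
  - rewrite mulrC -ltr_pdivlMr //; apply: le_lt_trans hm.
    apply: le_trans (cf_rho_le hn Kx ix Kr m) _.
    by rewrite ler_wiXn2l // ltW.
(* Levels before m0 are not deep enough to give cusps of small radius, but they are finitely many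
   and their remainders are nonzero. *)
clearbody a; have [b b0 hb] : exists2 b, 0 < b & forall m, (m < m0)%N -> b <= D (Some (xs x m)) o0.
  elim: (m0) => [|j [b b0 IH]]; first by exists 1.
  exists (Num.min b (D (Some (xs x j)) o0)); first by rewrite lt_min b0 bdist_iter_gt0.
  move=> m; rewrite ltnS leq_eqVlt ge_min => /orP[/eqP ->|mj]; first by rewrite lexx orbT.
  by rewrite IH.
have e0 : 0 < Num.min eta (Num.min a b) by rewrite !lt_min eta0 a0.
exists (Num.truncn (Num.min eta (Num.min a b))^-1).
set N := (Num.truncn _).+1.
have : (Num.min eta (Num.min a b))^-1 < N%:R by exact: truncnS_gt.
rewrite -ltf_pV2 ?posrE ?invr_gt0 ?ltr0n // invrK => /ltW; rewrite !le_min => /and3P[Ne Na Nb].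
split=> //; last exact: ng'.
move=> m; have [mm|mm] := leqP m0 m; first exact: le_trans Na (deep m mm).
exact: le_trans Nb (hb m mm).
Qed.
End Poor.

(** * Tile overlaps, and digits determining a point *)

Section Bad.
Variables (R : realType) (kk : scalar_kind) (n : nat).
Local Notation X := (iwasawa R kk n).
Local Notation D := (@bdist R kk n).
Local Notation o0 := (Some (iw0 R kk n)).
Variable CF : iwasawa_cf R kk n.
Local Notation Z := (cf_Z CF).
Local Notation M := (modular_group CF).
Local Notation T := (cf_shift CF).
Local Notation xs x m := (iter m T x).
Local Notation cnull := (cover_null (@ball_cell R kk n) (@ball_cost R kk n)).
Hypotheses (hn : (1 <= n)%N) (compl : cf_complete CF).
Variable r : R.
Hypotheses (r1 : r < 1) (Kr : forall y, cf_K CF y -> D (Some y) o0 <= r).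

Let ZG := Z_subgroup CF.

Definition overlap : set X := cf_K CF `&` \bigcup_(a in Z `\ id) translate a (cf_K CF).

(** At level m these are the points whose m-th remainder is 0 or meets another tile, provided the
    earlier remainders are nonzero. *)
Fixpoint exceptional (m : nat) : set X :=
  if m is m'.+1 then [set x | [/\ cf_K CF x, x != iw0 R kk n & exceptional m' (T x)]]
  else overlap `|` [set iw0 R kk n].

Lemma cf_step_countable : exists f : nat -> option X -> option X,
  (forall k, weight (f k) (@iota_weight R kk n)) /\
  forall x, x != iw0 R kk n -> exists k, f k (Some x) = Some (T x).
Proof.
have [f [fZ fs]] := Z_countable CF.
exists (fun k => minv (f k) \o cf_iota CF); split=> [k|x x0].
  by apply: isoD_comp_weight (iota_weightP CF hn); apply: minv_isoD; exact: fZ.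
have [k fk] := fs _ (cf_round_Z CF (cf_inv CF x)).
by exists k; rewrite fk; have [] := cf_stepP CF hn x0.
Qed.

(** T has countably many branches, one for each element of Z, and a branch divides the distance of x
    and x' by |x| |x'| <= 1. Preimages of null sets are thus null by [cnull_expanding]. *)
Lemma exceptional_null m : cnull (exceptional m).
Proof.
elim: m => [|m IH] /=.
  apply: (cover_nullU (@ball_cost_ge0 R kk n) (@ball_cost0 R kk n hn)); last exact: cnull_point.
  by apply/(leb_null_cnull hn); have [] := cf_KP CF.
have [f [fw fs]] := cf_step_countable.
pose A k := [set x | [/\ cf_K CF x, x != iw0 R kk n, f k (Some x) = Some (T x) & exceptional m (T x)]].
apply: (@cover_null_sub _ _ _ _ _ _ (\bigcup_k A k)).
  by move=> x [Kx x0 Ex]; have [k fk] := fs x x0; exists k.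
apply: (cover_null_bigcup (@ball_cost_ge0 R kk n) (@ball_cost0 R kk n hn)) => k.
apply: (cnull_expanding (f := T) hn IH) => [x []|x x' [Kx x0 fx _] [Kx' x'0 fx' _]] //.
have [_ fE] := fw k; rewrite -(fE (Some x)) fx fx'.
have le1 y : cf_K CF y -> y != iw0 R kk n -> 0 <= iota_weight (Some y) <= 1.
  move=> Ky y0; rewrite iota_weightE //; last by case=> e; rewrite e eqxx in y0.
  by rewrite bdist_ge0 (le_trans (Kr Ky) (ltW r1)).
have /andP[a0 a1] := le1 x Kx x0; have /andP[b0 b1] := le1 x' Kx' x'0.
by rewrite ler_piMr ?bdist_ge0 // mulr_ile1.
Qed.

Definition typical x := cf_K CF x /\ forall m, ~ exceptional m x.

Lemma typicalS x : typical x -> x != iw0 R kk n /\ typical (T x).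
Proof.
move=> [Kx nE]; have x0 : x != iw0 R kk n by apply/eqP => e; apply: (nE 0%N); right.
split=> //; split; first by have [] := cf_stepP CF hn x0.
by move=> m Em; apply: (nE m.+1).
Qed.

Lemma typical_iter x m : typical x -> typical (xs x m).
Proof. by move=> tx; elim: m => [|m IH] //=; have [] := typicalS IH. Qed.

Lemma typical_infinite x : typical x -> cf_infinite CF x.
Proof. by move=> tx m; have [] := typicalS (typical_iter m tx). Qed.

Lemma typical_unique x y a : typical y -> cf_K CF x -> Z a -> a (Some x) = Some y -> x = y.
Proof.
move=> [Ky nE] Kx Za axy; have [aid|aid] := pselect (a = id).
  by move: axy; rewrite aid => -[].
by case: (nE 0%N); left; split=> //; exists a => //; exists x.
Qed.

Lemma iter_infinite x l : cf_infinite CF x -> cf_infinite CF (xs x l).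
Proof. by move=> ix m; rewrite -iterD. Qed.

(** Equal digits mean equal maps [cf_move], so the distance of x and y is that of their remainders
    times two conformal factors, at most 2 r^m for every m. *)
Lemma equal_digits x y : cf_K CF x -> cf_K CF y -> cf_infinite CF x -> cf_infinite CF y ->
  (forall i, cf_digit CF x i.+1 = cf_digit CF y i.+1) -> x = y.
Proof.
move=> Kx Ky ix iy dig.
have mE m : cf_move CF x m = cf_move CF y m.
  elim: m => [|m IH] //=; rewrite IH /cf_step.
  by have := dig m; rewrite /cf_digit /= => ->.
have fE m u : cf_fac CF x m u = cf_fac CF y m u.
  by elim: m => [|m IH] //=; rewrite IH mE.
have dxy m : D (Some x) (Some y) <= 2 * r ^+ m.
  have := cf_facE CF hn x m (Some x) (Some y).
  rewrite {2}mE [cf_fac CF x m (Some y)]fE (cf_move_self hn ix) (cf_move_self hn iy) => <-.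
  have r0 : 0 <= r := le_trans (bdist_ge0 _ _) (Kr Kx).
  have h1 := cf_rho_le hn Kx ix Kr m; have h2 := cf_rho_le hn Ky iy Kr m.
  have p1 := cf_rho_gt0 CF hn x m; have p2 := cf_rho_gt0 CF hn y m.
  have t := bdist_triangle (xs x m) (iw0 R kk n) (xs y m).
  rewrite [D o0 _]bdist_sym in t.
  have d2 : D (Some (xs x m)) (Some (xs y m)) <= 2.
    apply: le_trans t _; apply: lerD; apply: le_trans (ltW r1); apply: Kr; exact: cf_K_iter.
  apply: ler_pM => //; rewrite ?bdist_ge0 //.
    by apply: ltW; exact: mulr_gt0 p1 p2.
  apply: (@le_trans _ _ (r ^+ m * 1)); last by rewrite mulr1.
  apply: ler_pM => //; [exact: ltW p1|exact: ltW p2|].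
  by apply: le_trans h2 _; rewrite exprn_ile1 // ltW.
suff [] : Some x = Some y by [].
apply: bdist_eq0; apply/eqP; rewrite -[_ == 0]negbK; apply/negP => d0.
have dpos : 0 < D (Some x) (Some y) by rewrite lt_def d0 bdist_ge0.
have [|||m] := @exp_small R r (D (Some x) (Some y) / 2) => //.
- exact: le_trans (bdist_ge0 _ _) (Kr Kx).
- by rewrite divr_gt0.
by rewrite ltr_pdivlMr // mulrC ltNge dxy.
Qed.

Lemma tail_equal x y : cf_infinite CF x -> cf_infinite CF y -> cf_K CF x -> cf_K CF y ->
  tail_equivalent CF x y <-> exists l l', xs x l = xs y l'.
Proof.
move=> ix iy Kx Ky; have dE z l i : cf_digit CF (xs z l) i.+1 = cf_digit CF z (l + i.+1).
  by rewrite /cf_digit addnS /= addnC iterD.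
split=> [[_ _ [l [l' h]]]|[l [l' h]]].
  exists l, l'; apply: equal_digits; [exact: cf_K_iter|exact: cf_K_iter| | |].
  - exact: iter_infinite.
  - exact: iter_infinite.
  - by move=> i; rewrite !dE; exact: h.
by split=> //; exists l, l' => -[|i] // _; rewrite -!dE h.
Qed.

Lemma tail_equal_moebius x y l l' : cf_infinite CF x -> cf_infinite CF y ->
  xs x l = xs y l' -> exists2 f, M f & f (Some x) = Some y.
Proof.
move=> ix iy e; have MG := modular_subgroup compl.
have My := cf_move_mod compl y l'.
exists (minv (cf_move CF y l') \o cf_move CF x l).
  by apply: (subgroup_comp MG); [exact: (subgroup_minv MG)|exact: cf_move_mod].
by rewrite /= (cf_move_self hn ix) e -(cf_move_self hn iy) (minvKl MG My).
Qed.
End Bad.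

(** A good cusp of small radius is at least as close to x as the pole of f is, dp being the distance
    from x to the pole. *)
Lemma close_bound (R : realFieldType) (k R0 eta w d dp : R) : 0 < k -> 0 < R0 -> 0 < eta -> eta <= 1 ->
  0 <= d -> eta <= R0 ^+ 2 * dp / k -> 1 < eta * w -> d * (R0 * w) ^+ 2 <= k / 2 -> d <= dp.
Proof.
move=> k0 R00 eta0 eta1 d0 edp ew dk.
have R2 : 0 < R0 ^+ 2 by rewrite exprn_gt0.
rewrite ler_pdivlMr // in edp.
rewrite -(ler_pM2l R2); apply: le_trans edp.
have ew2 : 1 <= eta ^+ 2 * w ^+ 2 by rewrite -exprMn expr_ge1 ?(ltW ew) // (le_trans ler01) ?(ltW ew).
apply: (@le_trans _ _ (R0 ^+ 2 * d * (eta ^+ 2 * w ^+ 2))).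
  by rewrite ler_peMr // mulr_ge0 ?(ltW R2).
have -> : R0 ^+ 2 * d * (eta ^+ 2 * w ^+ 2) = eta ^+ 2 * (d * (R0 * w) ^+ 2) by ring.
apply: (@le_trans _ _ (eta * k)) => //.
apply: ler_pM.
- exact: sqr_ge0.
- by rewrite mulr_ge0 // sqr_ge0.
- by rewrite expr2 ler_piMr // ltW.
by apply: le_trans dk _; rewrite ler_pdivrMr // ler_peMr ?ler1n // ltW.
Qed.

(** f multiplies the quality of the cusp by sq / sx, the ratio of the distances of the cusp and of x
    from the pole of f, which is at most 2; so k / 2 becomes k. *)
Lemma ratio_bound (R : realFieldType) (k E d w sx sq dx dq : R) : 0 <= d -> 0 < sx -> 0 < dx -> 0 < sq ->
  d * (sx * sq) = E -> sx * dq = sq * dx -> dq <= 2 * dx -> 0 <= w -> E * w <= k / 2 ->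
  d * (sq ^+ 2 * w) <= k.
Proof.
move=> d0 sx0 dx0 sq0 e1 e2 h w0 hk.
have h2 : sq <= 2 * sx.
  by rewrite -(ler_pM2r dx0) -e2 -mulrA [2 * _]mulrC -mulrA ler_pM2l // mulrC.
have E0 : d * sq * w * (2 * sx) <= k.
  have -> : d * sq * w * (2 * sx) = 2 * (E * w) by rewrite -e1; ring.
  by rewrite mulrC -ler_pdivlMr.
apply: le_trans E0.
have -> : d * (sq ^+ 2 * w) = d * sq * w * sq by ring.
by apply: ler_wpM2l => //; rewrite !mulr_ge0 // ltW.
Qed.

(** * Equivalent points under the modular group meet a common cusp *)

Section Main.
Variables (R : realType) (kk : scalar_kind) (n : nat).
Local Notation X := (iwasawa R kk n).
Local Notation D := (@bdist R kk n).
Local Notation o0 := (Some (iw0 R kk n)).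
Variable CF : iwasawa_cf R kk n.
Local Notation M := (modular_group CF).
Local Notation T := (cf_shift CF).
Local Notation xs x m := (iter m T x).
Hypotheses (hn : (1 <= n)%N) (compl : cf_complete CF).
Variable r : R.
Hypotheses (r0 : 0 < r) (r1 : r < 1) (Kr : forall y, cf_K CF y -> D (Some y) o0 <= r).
Variables (R0 k : R).
Hypotheses (R00 : 0 < R0) (k0 : 0 < k) (k1 : 8 * k <= r^-1 - r) (k2 : 8 * k <= 1 - r).
Hypothesis shim : forall g (s : option X -> R),
  M g -> weight g s -> g None <> None -> 1 <= R0 * s None.

Let MG : subgroup M := modular_subgroup compl.

(* The same cusp g oo is close to x, and f (g oo) is close to f x: by [legendre] both are
   met by the algorithm. *)
Lemma common_cusp x y f : cf_K CF x -> cf_K CF y -> cf_infinite CF x -> cf_infinite CF y ->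
  (forall eta, 0 < eta -> good_approx CF R0 x eta (k / 2)) -> M f -> f (Some x) = Some y ->
  exists q l l', cf_move CF x l q = None /\ cf_move CF y l' (f q) = None.
Proof.
move=> Kx Ky ix iy gx Mf fxy.
have [s fs] := subgroup_weight MG Mf; have [s0 sE] := fs.
pose p := minv f None; have fp : f p = None by exact: (minvKr MG Mf).
have px : Some x <> p by move=> e; rewrite -e fxy in fp.
have dxp : 0 < D (Some x) p by exact: bdist_gt0.
pose eta := Num.min 1 (R0 ^+ 2 * D (Some x) p / k).
have eta0 : 0 < eta by rewrite lt_min ltr01 divr_gt0 // mulr_gt0 // exprn_gt0.
have eta1 : eta <= 1 by rewrite ge_min lexx.
have etap : eta <= R0 ^+ 2 * D (Some x) p / k by rewrite ge_min lexx orbT.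
have [g [w [Mg gw gN ew xg]]] := gx _ eta0; have [w0 _] := gw.
have kk2 : k / 2 <= k by rewrite ler_pdivrMr // ler_peMr ?ler1n // ltW.
have [l hl] := legendre hn compl Kx ix r0 r1 Kr R00 shim k0 k1 k2 Mg gw (le_trans xg kk2).
exists (g None), l.
have [fq|fq] := pselect (f (g None) = None); first by exists 0%N.
have qp : g None <> p by move=> e; rewrite e in fq.
have dqx : D (Some x) (g None) <= D (Some x) p.
  exact: close_bound k0 R00 eta0 eta1 (bdist_ge0 _ _) etap ew xg.
have ex : s (Some x) * s p = D (Some x) p.
  by rewrite -(sE (Some x) p) fxy fp bdist_None // mul1r.
have eq : s (g None) * s p = D (g None) p.
  by rewrite -(sE (g None) p) fp bdist_None // mul1r.
have e2 : s (Some x) * D (g None) p = s (g None) * D (Some x) p by rewrite -ex -eq; ring.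
have h2 : D (g None) p <= 2 * D (Some x) p.
  case: (p) qp px dqx => [v|] qp px dqx; last first.
    by rewrite !bdist_None // mulr1 ler1n.
  case: (g None) gN dqx => [u|] // _ dqx.
  apply: le_trans (bdist_triangle u x v) _.
  by rewrite [D (Some u) _]bdist_sym mulr_natl mulr2n lerD2r.
have e1 := sE (Some x) (g None); rewrite fxy in e1.
have cl := ratio_bound (bdist_ge0 (Some y) (f (g None))) (s0 (Some x)) dxp (s0 (g None)) e1 e2 h2
  (sqr_ge0 (R0 * w None)) xg.
have [|l' hl'] := legendre hn compl Ky iy r0 r1 Kr R00 shim k0 k1 k2
  (subgroup_comp MG Mf Mg) (weight_comp fs gw).
  by apply: le_trans cl; rewrite /= le_eqVlt; apply/orP; left; apply/eqP; ring.
by exists l'.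
Qed.

Lemma moebius_tail_equal x y f : typical CF x -> typical CF y ->
  (forall eta, 0 < eta -> good_approx CF R0 x eta (k / 2)) -> M f -> f (Some x) = Some y ->
  exists l l', xs x l = xs y l'.
Proof.
move=> tx ty gx Mf fxy.
have ix := typical_infinite hn tx; have iy := typical_infinite hn ty.
have [Kx _] := tx; have [Ky _] := ty.
have [q [l [l' [h1 h2]]]] := common_cusp Kx Ky ix iy gx Mf fxy.
have Mx := cf_move_mod compl x l; have My := cf_move_mod compl y l'.
exists l, l'.
pose h := cf_move CF y l' \o f \o minv (cf_move CF x l).
have Mh : M h.
  by apply: (subgroup_comp MG); [exact: (subgroup_comp MG)|exact: (subgroup_minv MG)].
have Zh : cf_Z CF h.
  apply: (modular_fix compl Mh); rewrite /h /= -[X in minv _ X]h1 (minvKl MG Mx); exact: h2.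
have tyl := typical_iter hn l' ty.
apply: (typical_unique tyl _ Zh); first exact: cf_K_iter.
by rewrite /h /= -(cf_move_self hn ix) (minvKl MG Mx) fxy (cf_move_self hn iy).
Qed.

Lemma not_typical_good_null : leb_null (cf_K CF `\` [set x | typical CF x /\
  forall eta, 0 < eta -> good_approx CF R0 x eta (k / 2)]).
Proof.
apply/(leb_null_cnull hn).
have cost_ge0 := @ball_cost_ge0 R kk n; have cost0 := @ball_cost0 R kk n hn.
apply: (@cover_null_sub _ _ _ _ _ _
  ((\bigcup_m exceptional CF m) `|` (\bigcup_N poor CF R0 k N.+1%:R^-1))); last first.
  apply: (cover_nullU cost_ge0 cost0).
    by apply: (cover_null_bigcup cost_ge0 cost0) => m; exact: exceptional_null hn _ r1 Kr m.
  apply: (cover_null_bigcup cost_ge0 cost0) => N.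
  by apply: (poor_null hn compl r0 r1 Kr R00 k0 k1); rewrite invr_gt0 ltr0n.
move=> x [Kx ng]; have [tx|ntx] := pselect (typical CF x); last first.
  left; apply: contrapT => nE; apply: ntx; split=> // m Em; apply: nE; exists m => //.
right; have [|N pN] := not_good_poor hn compl r0 r1 Kr R00 k0 k1 Kx (typical_infinite hn tx).
  by move=> gx; apply: ng; split.
by exists N.
Qed.
End Main.

Lemma proper_bound (R : realType) (kk : scalar_kind) (n : nat) (CF : iwasawa_cf R kk n) :
  cf_proper CF -> exists r : R, [/\ 0 < r, r < 1 &
    forall y, cf_K CF y -> bdist (Some y) (Some (iw0 R kk n)) <= r].
Proof.
rewrite /cf_proper; set S := [set _ | _ in _] => h.
have h0 : 0 < (1 / 2 : R) by rewrite divr_gt0.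
have h1 : (1 / 2 : R) < 1 by rewrite ltr_pdivrMr // mul1r ltr1n.
have ub y : cf_K CF y -> ((gauge (val y))%:E <= ereal_sup S)%E.
  by move=> Ky; apply: ereal_sup_ubound; exists y.
case E : (ereal_sup S) h ub => [a||] // h ub.
  (* The maximum with 1 / 2 keeps r positive, as the bounds in terms of r^-1 require. *)
  exists (Num.max (1 / 2) a); rewrite lt_max gt_max h0 h1.
  split=> // y Ky; rewrite -gauge_bdist le_max; apply/orP; right.
  by have := ub y Ky; rewrite lee_fin.
exists (1 / 2); split=> //.
by move=> y /ub; rewrite leeNy_eq.
Qed.

Theorem theorem1p4 (R : realType) (kk : scalar_kind) (n : nat) (hn : (1 <= n)%N)
    (CF : iwasawa_cf R kk n) :
  cf_complete CF -> cf_discrete CF -> cf_proper CF ->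
  exists K0 : set (iwasawa R kk n),
    [/\ K0 `<=` cf_K CF,
        leb_null (cf_K CF `\` K0)
      & forall x y, K0 x -> K0 y ->
          (tail_equivalent CF x y <->
           exists2 M, modular_group CF M & M (Some x) = Some y)].
Proof.
move=> compl discr /proper_bound [r [r0 r1 Kr]].
have [R0 R00 shim] := shimizu hn compl discr (ltW r1) Kr.
(* With offsets up to 4 k in [legendre], 8 k <= r^-1 - r keeps the cusp images closer to x_m than
   half the separation, and 8 k <= 1 - r keeps their gauges below (1 + r) / 2. *)
pose k := Num.min (r^-1 - r) (1 - r) / 8.
have d0 : 0 < r^-1 - r by rewrite subr_gt0 (lt_trans r1) // invf_gt1.
have k0 : 0 < k by rewrite divr_gt0 // lt_min d0 subr_gt0.
have k8 : 8 * k = Num.min (r^-1 - r) (1 - r) by rewrite /k mulrC divfK.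
have k1 : 8 * k <= r^-1 - r by rewrite k8 ge_min lexx.
have k2 : 8 * k <= 1 - r by rewrite k8 ge_min lexx orbT.
exists [set x | typical CF x /\ forall eta, 0 < eta -> good_approx CF R0 x eta (k / 2)]; split.
- by move=> x [[]].
- exact: (not_typical_good_null hn compl r0 r1 Kr R00 k0 k1).
move=> x y [tx gx] [ty _].
have ix := typical_infinite hn tx; have iy := typical_infinite hn ty.
have [Kx _] := tx; have [Ky _] := ty.
rewrite (tail_equal hn r1 Kr ix iy Kx Ky); split=> [[l [l']]|[f Mf fxy]].
  exact: (tail_equal_moebius hn compl ix iy).
exact: (moebius_tail_equal hn compl r0 r1 Kr R00 k0 k1 k2 shim tx ty gx Mf fxy).
Qed.
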